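(* Let $S$ be a set of sorts, $\Sigma$ an $S$-sorted signature, $R$ a reduced and complete term rewriting system over $\Sigma$, and $L=\mathrm{Syn}(\Sigma,R)$. Then the set of edges $\mathcal M=\mathcal M_{\Sigma,R}$ described in the context is a Morse matching on the normalized bar complex $(B_\bullet,\delta_\bullet)$ of $L$.
   Context: **Lawvere theories.** $S^*$ is the set of finite strings over $S$. An $S$-sorted Lawvere theory $L$ is a small category with object set $S^*$ together with, for each $\vec X=X_1\dots X_n\in S^*$, a chosen product diagram $\pi_i:\vec X\to X_i$ ($i=1,\dots,n$). A morphism $\vec\pi:X_1\times\dots\times X_n\to Y_1\times\dots\times Y_m$ is a partial permutation if there is an injection $u:\{1,\dots,m\}\to\{1,\dots,n\}$ with $X_{u(i)}=Y_i$ and $\pi_i\vec\pi=\pi_{u(i)}$ for all $i$; it is a permutation if moreover $m=n$. **Essential morphisms.** In an $S$-sorted Lawvere theory, a morphism $\vec\omega$ is efficient if whenever $\vec\omega=\vec\omega'\vec\pi$ with $\vec\pi$ a partial permutation, $\vec\pi$ is a permutation. Write $\vec\omega\sim_\Pi\vec\omega'$ if $\vec\omega=\vec\omega'\vec\pi$ for some permutation $\vec\pi$. In each $\sim_\Pi$-class a representative is chosen, arbitrarily except that the class of an identity is represented by the identity itself; these choices are fixed. A morphism is essential if it is efficient and is the chosen representative of its $\sim_\Pi$-class. Every morphism is uniquely $\vec\omega'\vec\pi$ with $\vec\omega'$ essential and $\vec\pi$ a partial permutation. **Terms and $\mathrm{Syn}$.** Each sort $X$ has an infinite set $V_X$ of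 variables. An $S$-sorted signature $\Sigma$ is a set of operation symbols $f:X_1\times\dots\times X_n\to X$; terms are built as usual. A context $\Gamma=x_1:X_1,\dots,x_n:X_n$ is a list of distinct variables. For a set $E$ of equations, $\approx_E$ is the smallest equivalence relation on terms containing $E$ and closed under substitution and under rewrite contexts (replacing one subterm occurrence). $\mathrm{Syn}(\Sigma,E)$ is the $S$-sorted Lawvere theory with objects $S^*$; morphisms $X_1\dots X_n\to Y_1\dots Y_m$ are classes $(\Gamma\mid_E(t_1,\dots,t_m))$ with $t_i$ of sort $Y_i$ and variables in $\Gamma$, modulo $\approx_E$ componentwise and renaming of the context; composition is substitution. $\mathrm{Syn}(\Sigma)=\mathrm{Syn}(\Sigma,\emptyset)$. A tuple of terms $\vec t$ is identified with the morphism $(\Gamma\mid_\emptyset\vec t)$ of $\mathrm{Syn}(\Sigma)$. **TRS.** A term rewriting system (TRS) $R$ is a set of rules $l\to r$ (up to renaming of variables), $l,r$ terms of the same sort with $\mathrm{Var}(r)\subset\mathrm{Var}(l)$. $t\to_R t'$ if $t'$ arises from $t$ by replacing one subterm occurrence $l\vec s$ (an instance of $l$) by $r\vec s$. $R$ is complete if $\to_R$ is well-founded (no infinite $\to_R$-sequences) and Church–Rosser (if $a,b$ are related by the equivalence closure of $\to_R$, then $a\to_R^*c$, $b\to_R^*c$ for some $c$). A term (tuple) is $R$-irreducible if no rule applies. $R$ is reduced if for every $l\to r\in R$, $l$ is $(R\setminus\{l\to r\})$-irreducible and $r$ is $R$-irreducible. $R_{\mathrm L}=\{l\mid l\to r\in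 R\text{ for some }r\}$. $\mathrm{Syn}(\Sigma,R)$ regards rules as equations; each of its morphisms is $(\Gamma\mid_R\vec t)$ for a unique $R$-irreducible tuple $\vec t$ (up to renaming). **Ringoid modules.** A ringoid is a small $\mathbf{Ab}$-enriched category; a left module over a ringoid $\mathcal R$ is an additive functor $\mathcal R\to\mathbf{Ab}$; the free left module on a family of sets $(\mathcal X_j)_{j\in\mathrm{Ob}\,\mathcal R}$ is $i\mapsto\bigoplus_j\bigoplus_{x\in\mathcal X_j}\mathcal R(j,i)x$. **Enveloping ringoid $\mathcal U_L$.** For $\vec X\in S^*$, $\mathcal R_L^{\vec X}$ is the ringoid presented as follows: objects are the morphisms $\vec X\to Y$ of $L$ with $Y\in S$; generators $\partial_i(\omega)_{\vec\sigma}:\sigma_i\to\omega\vec\sigma$ for $\vec\sigma=\langle\sigma_1,\dots,\sigma_n\rangle:\vec X\to\vec Y$, $\omega:\vec Y\to Z$ ($Z\in S$), $1\le i\le n$; relations $\partial_i(\pi_i)_{\vec\sigma}=1_{\sigma_i}$, $\partial_i(\pi_j)_{\vec\sigma}=0$ ($i\ne j$), $\partial_i(\omega\langle\omega_1',\dots,\omega_k'\rangle)_{\vec\sigma}=\sum_{j=1}^k\partial_j(\omega)_{\langle\omega_1'\vec\sigma,\dots,\omega_k'\vec\sigma\rangle}\partial_i(\omega_j')_{\vec\sigma}$. For $\vec\alpha:\vec X\to\vec X'$, the additive functor $\mathcal R_L^{\vec\alpha}:\mathcal R_L^{\vec X'}\to\mathcal R_L^{\vec X}$ is $\sigma\mapsto\sigma\vec\alpha$,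 $\partial_i(\omega)_{\vec\sigma}\mapsto\partial_i(\omega)_{\vec\sigma\vec\alpha}$. $\mathcal U_L$ has as objects the morphisms of $L$ with codomain in $S$; for $f:\vec X'\to Y$, $g:\vec X\to Z$, $\mathcal U_L(f,g)=\bigoplus_{\vec\alpha:\vec X\to\vec X'}\mathcal R_L^{\vec X}(f\vec\alpha,g)$; composition $(r'\circ r)_{\vec\beta}=\sum_{\vec\alpha\vec\alpha'=\vec\beta}r'_{\vec\alpha'}\circ\mathcal R_L^{\vec\alpha'}(r_{\vec\alpha})$. $\partial_i(\omega)_{\vec\sigma}$ also denotes the element of the summand indexed by an identity, and $\vec\alpha^*:\omega\to\omega\vec\alpha$ denotes $1_{\omega\vec\alpha}$ in the summand indexed by $\vec\alpha$. **Cells.** An essential morphism $(\Gamma\mid_R\vec t)$ of $L$, with $\vec t$ $R$-irreducible, is simply written $\vec t$. For $n\ge1$ an $n$-cell is a tuple $(t_1,\vec t_2,\dots,\vec t_n)$ of composable essential non-identity morphisms of $L$ (composite $t_1\circ\vec t_2\circ\dots\circ\vec t_n$ defined), $t_1$ having codomain in $S$. The $0$-cells are symbols $()_X$, $X\in S$. **Normalized bar complex.** $B_n$ ($n\ge1$) is the free left $\mathcal U_L$-module on $n$-cells, $(t_1,\dots,\vec t_n)$ placed at the object $t_1\circ\dots\circ\vec t_n$ of $\mathcal U_L$; $B_0$ is free on $()_X$ placed at $1_X$. Let $B_n^u$ be defined in the same way using all composable tuples $(\omega_1,\vec\omega_2,\dots,\vec\omega_n)$ of morphisms of $L$ with codomain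 of $\omega_1$ in $S$ ($B_0^u=B_0$), with $\delta_1^u(\omega)=\sum_i\partial_i(\omega)_{1_{\vec X}}\pi_i^*()_{X_i}-\omega^*()_Y$ for $\omega:\vec X\to Y$, and, for $n\ge2$, $\delta_n^u=\sum_{k=0}^n(-1)^kd_k$ with $d_0(\omega_1,\dots,\vec\omega_n)=\sum_i\partial_i(\omega_1)_{\vec\omega_2\vec\omega_3\cdots\vec\omega_n}(\omega_{2,i},\vec\omega_3,\dots,\vec\omega_n)$ where $\vec\omega_2=\langle\omega_{2,1},\omega_{2,2},\dots\rangle$, $d_j$ composing $\vec\omega_j\vec\omega_{j+1}$ for $0<j<n$, and $d_n(\omega_1,\dots,\vec\omega_n)=\vec\omega_n^*(\omega_1,\dots,\vec\omega_{n-1})$. Let $\Phi:B_m^u\to B_m$ be the $\mathcal U_L$-linear map with $\Phi=\mathrm{id}$ for $m=0$ and, for $m\ge1$: $\Phi(\tau)=\tau$ if $\tau$ is a cell; $\Phi(\tau)=0$ if some entry is a partial permutation; otherwise, with $i$ the smallest index such that $\vec\omega_i$ is not essential and $\vec\omega_i=\vec\omega_i'\vec\pi$ ($\vec\omega_i'$ essential, $\vec\pi$ a partial permutation), $\Phi(\tau)=\Phi(\omega_1,\dots,\vec\omega_i',\vec\pi\vec\omega_{i+1},\dots,\vec\omega_m)$ if $i<m$ and $\Phi(\tau)=\vec\pi^*(\omega_1,\dots,\vec\omega_{m-1},\vec\omega_m')$ if $i=m$. Then $\delta_n(\tau)=\Phi(\delta_n^u(\tau))$ on cells. **Chains and $\mathcal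 M$.** For $R$-irreducible tuples, juxtaposition $\vec t\vec t'$ denotes composition in $\mathrm{Syn}(\Sigma)$ (substitution without reduction). $t|_p$ is the subterm of $t$ at position $p$ (a finite sequence of positive integers). $P(t)=\{(p,l)\mid p\text{ a position of }t,\ l\in R_{\mathrm L},\ t|_p=l\vec s\text{ for some }\vec s\}$. Fix a total order $<$ on $R_{\mathrm L}$ without infinite increasing sequences; put $(p,l)<(p',l')$ if $p$ is smaller than $p'$ in the lexicographic order, or $p=p'$ and $l<l'$. $\mathbf p(t)$ is the maximum of $P(t)$, and $-\infty$ (the least value) if $P(t)=\emptyset$. A unifier of a pair $(\vec t,\vec t')$ of morphisms $\vec t:\vec X\to\vec Y$, $\vec t':\vec X'\to\vec Y$ of $\mathrm{Syn}(\Sigma)$ is a pair $(\vec s,\vec s')$ of morphisms $\vec s:\vec Z\to\vec X$, $\vec s':\vec Z\to\vec X'$ of $\mathrm{Syn}(\Sigma)$ with $\vec t\vec s=\vec t'\vec s'$; it is the most general unifier if $\vec t\vec s$ is essential and for any other unifier $(\vec r,\vec r')$ there is $\vec u$ with $\vec r=\vec s\vec u$ and $\vec r'=\vec s'\vec u$. One writes $t\in\Sigma$ if $t=f(x_1,\dots,x_n)$ with $f\in\Sigma$. Chains: every $()_X$ is a $0$-chain; a $1$-cell $(t_1)$ is a $1$-chain if $t_1\in\Sigma$; for $n>1$ an $n$-cell $(t_1,\dots,\vec t_n)$ is an $n$-chain if $(t_1,\dots,\vec t_{n-1})$ is an $(n-1)$-chain, $\mathbf p(t_1\cdots\vec t_{n-1})<\mathbf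 p(t_1\cdots\vec t_n)$, and for $(p,l)=\mathbf p(t_1\cdots\vec t_n)$ there is $\vec s$ such that $(\vec t_n,\vec s)$ is the most general unifier of $((t_1\cdots\vec t_{n-1})|_p,l)$. For an $n$-cell $\tau=(t_1,\dots,\vec t_n)$ ($n\ge1$), $\ell(\tau)$ is the largest integer in $\{1,\dots,n\}$ such that $(t_1,\dots,\vec t_{\ell(\tau)-1})$ is an $(\ell(\tau)-1)$-chain (the empty tuple counts as a $0$-chain). $\mathcal M$ is the set of edges $(t_1,\dots,\vec t_{\ell-1},\vec t_\ell',\vec t_\ell'',\vec t_{\ell+1},\dots,\vec t_n)\to\tau=(t_1,\dots,\vec t_n)$ between cells, with $\ell=\ell(\tau)$, $\vec t_\ell=\vec t_\ell'\vec t_\ell''$, such that either $\ell=1$ and $t_1'\in\Sigma$, or $\ell>1$ and, with $t=t_1\cdots\vec t_{\ell-1}$ and $(p,l)=\mathbf p(t\vec t_\ell)$, there is $\vec s$ such that $(\vec t_\ell',\vec s)$ is the most general unifier of $(t|_p,l)$. **Morse matching.** Write $\delta_n(\alpha)=\sum_\beta[\alpha:\beta]\beta$ over cells $\beta$. Let $G$ be the directed graph with vertices the cells and an edge $\alpha\to\beta$ whenever $[\alpha:\beta]\ne0$ ($\alpha$ an $n$-cell, $\beta$ an $(n-1)$-cell). A set $\mathcal M$ of edges of $G$ is a partial matching if no vertex is incident to more than one edge of $\mathcal M$. A partial matching is a Morse matching if (i) for each $(\alpha\to\beta)\in\mathcal M$, $\alpha$ and $\beta$ are placed at the same object $x$ of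 $\mathcal U_L$ and $[\alpha:\beta]=\pm1_x$; and (ii) there is no infinite sequence of cells $\alpha_1,\gamma_1,\alpha_2,\gamma_2,\dots$ with $(\gamma_i\to\alpha_i)\in\mathcal M$ and $\gamma_i\to\alpha_{i+1}$ an edge of $G$ not in $\mathcal M$, for all $i\ge1$.
   Formalization: That the elements of M are edges of G (nonzero incidence) is claimed only at objects x of U_L with 1_x ≠ 0; where 1_x = 0 (e.g. rules m(x,x,y)→x, m(x,y,x)→x, m(y,x,x)→x) G has no edges, so it fails there; all other Morse matching conditions are unconditional. *)

(* Defs.v *)
From HB Require Import structures.
From Stdlib Require Import Relation_Operators RelationClasses List.
From mathcomp Require Import all_boot all_order all_algebra.
From mathcomp Require Import boolp classical_sets functions cardinality fsbigop.

Set Implicit Arguments.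
Unset Strict Implicit.
Unset Printing Implicit Defensive.

Import GRing.Theory.
Local Open Scope quotient_scope.
Local Open Scope ring_scope.

Section Quotient.
Variables (T : Type) (r : T -> T -> Prop) (er : Equivalence r).

Let br : rel {classic T} := fun x y => `[< r x y >].

Let br_refl : reflexive br.
Proof. by move=> x; apply/asboolP; reflexivity. Qed.

Let br_sym : symmetric br.
Proof. by move=> x y; apply/asboolP/asboolP; symmetry. Qed.

Let br_trans : transitive br.
Proof.
move=> y x z /asboolP xy /asboolP yz; apply/asboolP.
by transitivity y.
Qed.

Definition quot_rel : equiv_rel {classic T} := EquivRel br br_refl br_sym br_trans.
Definition quot : Type := {eq_quot quot_rel}.
Definition qclass (x : T) : quot := \pi_{eq_quot quot_rel}%qT x.
Definition qrepr (q : quot) : T := repr (q : {eq_quot quot_rel}).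

Lemma qreprK q : qclass (qrepr q) = q.
Proof. exact: reprK. Qed.

Lemma qclassP x y : qclass x = qclass y <-> r x y.
Proof.
split=> [/eqmodP /asboolP//|rxy]; apply/eqmodP; exact/asboolP.
Qed.

Lemma qrepr_class x : r (qrepr (qclass x)) x.
Proof. by apply/qclassP; rewrite qreprK. Qed.

End Quotient.

Section DirectSum.
Variables (I : Type) (V : I -> zmodType).

Record dsum := DSum {
  dcoef :> forall i, V i;
  dcoef_fin : finite_set [set i | dcoef i <> 0] }.

Lemma dsumP (f g : dsum) : (forall i, f i = g i) -> f = g.
Proof.
case: f g => [f hf] [g hg] /= fg.
have {}fg := functional_extensionality_dep fg; subst g.
by rewrite (Prop_irrelevance hf hg).
Qed.

Let fin0 : finite_set [set i | (0 : V i) <> 0].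
Proof. by apply: sub_finite_set (finite_set0 I) => i /=. Qed.

Let finN (f : dsum) : finite_set [set i | - f i <> 0].
Proof.
apply: sub_finite_set (dcoef_fin f) => i /= fi0 e; apply: fi0.
by rewrite e oppr0.
Qed.

Let finD (f g : dsum) : finite_set [set i | f i + g i <> 0].
Proof.
have : finite_set ([set i | f i <> 0] `|` [set i | g i <> 0])%classic.
  by rewrite finite_setU; split; exact: dcoef_fin.
apply: sub_finite_set => i /= fgi.
have [fi|] := pselect (f i = 0); last by left.
by right=> gi; apply: fgi; rewrite fi gi addr0.
Qed.

HB.instance Definition _ := gen_eqMixin dsum.
HB.instance Definition _ := gen_choiceMixin dsum.

Let dadd f g := DSum (finD f g).
Let dopp f := DSum (finN f).
Let dzero := DSum fin0.

Let daddA : associative dadd.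
Proof. by move=> f g h; apply: dsumP => i /=; rewrite addrA. Qed.
Let daddC : commutative dadd.
Proof. by move=> f g; apply: dsumP => i /=; rewrite addrC. Qed.
Let dadd0 : left_id dzero dadd.
Proof. by move=> f; apply: dsumP => i /=; rewrite add0r. Qed.
Let daddN : left_inverse dzero dopp dadd.
Proof. by move=> f; apply: dsumP => i /=; rewrite addNr. Qed.

HB.instance Definition _ := GRing.isZmodule.Build dsum daddA daddC dadd0 daddN.

Definition dinj_fun (i : I) (v : V i) (j : I) : V j :=
  if pselect (i = j) is left e then eq_rect i (fun k => V k : Type) v j e else 0.

Let dinj_fin i (v : V i) : finite_set [set j | dinj_fun v j <> 0].
Proof.
apply: sub_finite_set (finite_set1 i) => j /=.
by rewrite /dinj_fun; case: pselect => // ->.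
Qed.

Definition dinj i (v : V i) : dsum := DSum (dinj_fin v).

(* The additive map out of the direct sum with additive components F i. *)
Definition dlift (W : zmodType) (F : forall i, V i -> W) (f : dsum) : W :=
  \sum_(i \in ([set: I] : set {classic I})) F i (f i).

End DirectSum.

Record lawvere (S : Type) := Lawvere {
  lhom : seq S -> seq S -> Type;
  lid : forall X, lhom X X;
  lcomp : forall X Y Z, lhom Y Z -> lhom X Y -> lhom X Z;
  lcompA : forall X Y Z W (h : lhom Z W) (g : lhom Y Z) (f : lhom X Y),
    lcomp h (lcomp g f) = lcomp (lcomp h g) f;
  lcomp1l : forall X Y (f : lhom X Y), lcomp (lid Y) f = f;
  lcomp1r : forall X Y (f : lhom X Y), lcomp f (lid X) = f;
  lproj : forall X (i : 'I_(size X)), lhom X [:: tnth (in_tuple X) i];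
  lprodP : forall Z X (w : forall i : 'I_(size X), lhom Z [:: tnth (in_tuple X) i]),
    exists! f : lhom Z X, forall i, lcomp (lproj i) f = w i }.

Arguments lid {S l} X.
Arguments lproj {S l} X i.

Notation "g \oL f" := (lcomp g f) (at level 50, left associativity).

Section Essential.
Variables (S : Type) (L : lawvere S).
Implicit Types X Y Z : seq S.

Definition mor_to Y := {X : seq S & lhom L X Y}.

Definition mk_to X Y (f : lhom L X Y) : mor_to Y := existT _ X f.

Definition mor_from X := {Y : S & lhom L X [:: Y]}.

Definition mk_from X (Y : S) (f : lhom L X [:: Y]) : mor_from X := existT _ Y f.

(* Equality in mor_from X says that the codomains agree as well, so the
   condition below contains Y_i = X_(u i). *)
Definition partial_perm X Y (p : lhom L X Y) : Prop :=
  exists u : 'I_(size Y) -> 'I_(size X), injective u /\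
    forall i, mk_from (lproj Y i \oL p) = mk_from (lproj X (u i)).

Definition permutation X Y (p : lhom L X Y) : Prop :=
  partial_perm p /\ size X = size Y.

Definition efficient X Y (w : lhom L X Y) : Prop :=
  forall X' (w' : lhom L X' Y) (p : lhom L X X'),
    partial_perm p -> w = w' \oL p -> permutation p.

Definition sim_perm Y (w w' : mor_to Y) : Prop :=
  exists p : lhom L (tag w) (tag w'), permutation p /\ tagged w = tagged w' \oL p.

Record representatives := Representatives {
  rep : forall Y, mor_to Y -> mor_to Y;
  rep_sim : forall Y (w : mor_to Y), sim_perm w (rep w);
  rep_eq : forall Y (w w' : mor_to Y), sim_perm w w' -> rep w = rep w';
  rep_id : forall Y, rep (mk_to (lid Y)) = mk_to (lid Y) }.

Definition essential (c : representatives) X Y (w : lhom L X Y) : Prop :=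
  efficient w /\ rep c (mk_to w) = mk_to w.

Definition is_identity X Y (w : lhom L X Y) : Prop := mk_to w = mk_to (lid Y).

Definition is_unifier X X' Y Z (t : lhom L X Y) (t' : lhom L X' Y)
    (s : lhom L Z X) (s' : lhom L Z X') : Prop :=
  t \oL s = t' \oL s'.

Definition is_universal_unifier X X' Y Z
    (t : lhom L X Y) (t' : lhom L X' Y) (s : lhom L Z X) (s' : lhom L Z X') : Prop :=
  is_unifier t t' s s' /\
  forall W (q : lhom L W X) (q' : lhom L W X'), is_unifier t t' q q' ->
    exists u : lhom L W Z, q = s \oL u /\ q' = s' \oL u.

Definition is_mgu (c : representatives) X X' Y Z
    (t : lhom L X Y) (t' : lhom L X' Y) (s : lhom L Z X) (s' : lhom L Z X') : Prop :=
  essential c (t \oL s) /\ is_universal_unifier t t' s s'.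

End Essential.

(* The ringoid R_L^X: formal expressions in the generators modulo the least
   congruence containing the ringoid axioms and the defining relations. The
   identity and the generators take equations between objects as arguments,
   since composites such as w \oL (w' \oL s) and (w \oL w') \oL s are only
   propositionally equal; "RId e" is the identity morphism along e. *)
Section SliceRingoid.
Variables (S : Type) (L : lawvere S).
Implicit Types Y Z : seq S.

Inductive rexp (X : seq S) : mor_from L X -> mor_from L X -> Type :=
| RId a b (e : a = b) : rexp a b
| RPart Y (Z : S) (i : 'I_(size Y)) (w : lhom L Y [:: Z]) (s : lhom L X Y) a b
    (ea : a = mk_from (lproj Y i \oL s)) (eb : b = mk_from (w \oL s)) : rexp a b
| RComp a b c (g : rexp b c) (f : rexp a b) : rexp a c
| RZero a b : rexp a b
| RAdd a b (f g : rexp a b) : rexp a b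
| ROpp a b (f : rexp a b) : rexp a b.

Arguments RId {X a b} e.
Arguments RPart {X Y Z} i w s {a b} ea eb.
Arguments RComp {X a b c} g f.
Arguments RZero {X} a b.
Arguments RAdd {X a b} f g.
Arguments ROpp {X a b} f.

Definition rsum (X : seq S) (a b : mor_from L X) (s : seq (rexp a b)) : rexp a b :=
  foldr (@RAdd X a b) (RZero a b) s.

Inductive rrel (X : seq S) : forall a b : mor_from L X, rexp a b -> rexp a b -> Prop :=
| rr_refl a b (f : rexp a b) : rrel f f
| rr_sym a b (f g : rexp a b) : rrel f g -> rrel g f
| rr_trans a b (f g h : rexp a b) : rrel f g -> rrel g h -> rrel f h
| rr_comp a b c (g g' : rexp b c) (f f' : rexp a b) :
    rrel g g' -> rrel f f' -> rrel (RComp g f) (RComp g' f')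
| rr_add a b (f f' g g' : rexp a b) :
    rrel f f' -> rrel g g' -> rrel (RAdd f g) (RAdd f' g')
| rr_opp a b (f f' : rexp a b) : rrel f f' -> rrel (ROpp f) (ROpp f')
| rr_addA a b (f g h : rexp a b) : rrel (RAdd f (RAdd g h)) (RAdd (RAdd f g) h)
| rr_addC a b (f g : rexp a b) : rrel (RAdd f g) (RAdd g f)
| rr_add0 a b (f : rexp a b) : rrel (RAdd (RZero a b) f) f
| rr_addN a b (f : rexp a b) : rrel (RAdd (ROpp f) f) (RZero a b)
| rr_compA a b c d (h : rexp c d) (g : rexp b c) (f : rexp a b) :
    rrel (RComp h (RComp g f)) (RComp (RComp h g) f)
| rr_comp1l a b (f : rexp a b) : rrel (RComp (RId (erefl b)) f) f
| rr_comp1r a b (f : rexp a b) : rrel (RComp f (RId (erefl a))) f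
| rr_compDl a b c (g g' : rexp b c) (f : rexp a b) :
    rrel (RComp (RAdd g g') f) (RAdd (RComp g f) (RComp g' f))
| rr_compDr a b c (g : rexp b c) (f f' : rexp a b) :
    rrel (RComp g (RAdd f f')) (RAdd (RComp g f) (RComp g f'))
| rr_part_same Y (i : 'I_(size Y)) (s : lhom L X Y) (a b : mor_from L X)
    (ea : a = mk_from (lproj Y i \oL s)) (eb : b = mk_from (lproj Y i \oL s))
    (e : a = b) :
    rrel (RPart i (lproj Y i) s ea eb) (RId e)
| rr_part_diff Y (i j : 'I_(size Y)) (s : lhom L X Y) (a b : mor_from L X)
    (ea : a = mk_from (lproj Y i \oL s)) (eb : b = mk_from (lproj Y j \oL s)) :
    i != j -> rrel (RPart i (lproj Y j) s ea eb) (RZero a b)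
| rr_chain Y Y' (Z : S) (i : 'I_(size Y)) (w : lhom L Y' [:: Z]) (w' : lhom L Y Y')
    (s : lhom L X Y) (a b : mor_from L X) (m : 'I_(size Y') -> mor_from L X)
    (ea : a = mk_from (lproj Y i \oL s))
    (em : forall j, m j = mk_from (lproj Y' j \oL w' \oL s))
    (em' : forall j, m j = mk_from (lproj Y' j \oL (w' \oL s)))
    (eb : b = mk_from (w \oL w' \oL s)) (eb' : b = mk_from (w \oL (w' \oL s))) :
    rrel (RPart i (w \oL w') s ea eb)
         (rsum [seq RComp (RPart j w (w' \oL s) (em' j) eb')
                          (RPart i (lproj Y' j \oL w') s ea (em j))
               | j <- enum 'I_(size Y')]).

Lemma rrel_equiv X (a b : mor_from L X) : Equivalence (@rrel X a b).
Proof.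
split; [exact: rr_refl | exact: rr_sym | exact: rr_trans].
Qed.

Definition rhom X (a b : mor_from L X) : Type := quot (rrel_equiv a b).

Definition rcls X (a b : mor_from L X) (f : rexp a b) : rhom a b :=
  qclass (rrel_equiv a b) f.

Definition rrep X (a b : mor_from L X) (f : rhom a b) : rexp a b := qrepr f.

Lemma rclsP X (a b : mor_from L X) (f g : rexp a b) :
  rcls f = rcls g <-> rrel f g.
Proof. exact: qclassP. Qed.

Lemma rrepK X (a b : mor_from L X) (f : rhom a b) : rcls (rrep f) = f.
Proof. exact: qreprK. Qed.

Lemma rrep_cls X (a b : mor_from L X) (f : rexp a b) : rrel (rrep (rcls f)) f.
Proof. exact: qrepr_class. Qed.

Section Zmodule.
Variables (X : seq S) (a b : mor_from L X).
Implicit Types f g h : rhom a b.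

HB.instance Definition _ := gen_eqMixin (rhom a b).
HB.instance Definition _ := gen_choiceMixin (rhom a b).

Let add f g : rhom a b := rcls (RAdd (rrep f) (rrep g)).
Let opp f : rhom a b := rcls (ROpp (rrep f)).
Let zero : rhom a b := rcls (RZero a b).

Let addA : associative add.
Proof.
move=> f g h; apply/rclsP.
apply: rr_trans (rr_add (rr_refl _) (rrep_cls _)) _.
apply: rr_trans (rr_addA _ _ _) _.
exact: rr_add (rr_sym (rrep_cls _)) (rr_refl _).
Qed.

Let addC : commutative add.
Proof. by move=> f g; apply/rclsP; exact: rr_addC. Qed.

Let add0 : left_id zero add.
Proof.
move=> f; rewrite -[RHS]rrepK; apply/rclsP.
exact: rr_trans (rr_add (rrep_cls _) (rr_refl _)) (rr_add0 _).
Qed.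

Let addN : left_inverse zero opp add.
Proof.
move=> f; apply/rclsP.
exact: rr_trans (rr_add (rrep_cls _) (rr_refl _)) (rr_addN _).
Qed.

HB.instance Definition _ := GRing.isZmodule.Build (rhom a b) addA addC add0 addN.

End Zmodule.

Definition rone X (a b : mor_from L X) (e : a = b) : rhom a b := rcls (RId e).

Definition rcomp X (a b c : mor_from L X) (g : rhom b c) (f : rhom a b) : rhom a c :=
  rcls (RComp (rrep g) (rrep f)).

Definition rpart X Y (Z : S) (i : 'I_(size Y)) (w : lhom L Y [:: Z]) (s : lhom L X Y)
    (a b : mor_from L X) (ea : a = mk_from (lproj Y i \oL s))
    (eb : b = mk_from (w \oL s)) : rhom a b :=
  rcls (RPart i w s ea eb).

Arguments rone {X a b} e.
Arguments rpart {X Y Z} i w s {a b} ea eb.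

Definition pre X X' (a : mor_from L X') (al : lhom L X X') : mor_from L X :=
  mk_from (tagged a \oL al).

Lemma pre_mk X X' Y (f : lhom L X' Y) (al : lhom L X X') (Z : S) (g : lhom L Y [:: Z])
  (a : mor_from L X') : a = mk_from (g \oL f) -> pre a al = mk_from (g \oL (f \oL al)).
Proof. by move=> ->; rewrite /pre /= lcompA. Qed.

Lemma pre_comp X X' X'' (a : mor_from L X'') (al : lhom L X' X'') (al' : lhom L X X') :
  pre a (al \oL al') = pre (pre a al) al'.
Proof. by rewrite /pre /= lcompA. Qed.

Lemma pre_id X (a : mor_from L X) : pre a (lid X) = a.
Proof. by case: a => Y f; rewrite /pre /= lcomp1r. Qed.

Fixpoint emap X X' (al : lhom L X X') (a b : mor_from L X') (f : rexp a b) :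
    rexp (pre a al) (pre b al) :=
  match f with
  | RId _ _ e => RId (congr1 (fun c => pre c al) e)
  | RPart _ _ i w s _ _ ea eb => RPart i w (s \oL al) (pre_mk al ea) (pre_mk al eb)
  | RComp _ _ _ g f => RComp (emap al g) (emap al f)
  | RZero _ _ => RZero _ _
  | RAdd _ _ f g => RAdd (emap al f) (emap al g)
  | ROpp _ _ f => ROpp (emap al f)
  end.

Lemma RPart_eq X Y (Z : S) (i : 'I_(size Y)) (w : lhom L Y [:: Z]) (s s' : lhom L X Y)
    (a b : mor_from L X) ea ea' eb eb' :
  s = s' -> RPart i w s ea eb = RPart i w s' ea' eb' :> rexp a b.
Proof. by move=> e; subst s'; congr RPart; exact: Prop_irrelevance. Qed.

Lemma emap_rrel X X' (al : lhom L X X') (a b : mor_from L X') (f g : rexp a b) :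
  rrel f g -> rrel (emap al f) (emap al g).
Proof.
elim => {a b f g}; try by move=> * /=; econstructor; eauto.
move=> Y Y' Z i w w' s a b m ea em em' eb eb' /=.
have em2 j := pre_mk al (em j).
have em2' j : pre (m j) al = mk_from (lproj Y' j \oL (w' \oL (s \oL al))).
  by rewrite (em' j) /pre /= !lcompA.
have eb2 : pre b al = mk_from (w \oL (w' \oL (s \oL al))).
  by rewrite eb' /pre /= !lcompA.
apply: rr_trans (rr_chain (pre_mk al ea) em2 em2' (pre_mk al eb) eb2) _.
have E : w' \oL (s \oL al) = w' \oL s \oL al by rewrite lcompA.
elim: (enum _) => [|j l IH] /=; first exact: rr_refl.
apply: rr_add => //; apply: rr_comp.
  by rewrite (RPart_eq _ (pre_mk al (em' j)) _ (pre_mk al eb') E); exact: rr_refl.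
by rewrite (RPart_eq _ (pre_mk al ea) _ (pre_mk al (em j)) (erefl _)); exact: rr_refl.
Qed.

(* The additive functor R_L^al on morphisms. *)
Definition rmap X X' (al : lhom L X X') (a b : mor_from L X') (f : rhom a b) :
    rhom (pre a al) (pre b al) :=
  rcls (emap al (rrep f)).

End SliceRingoid.

Arguments RId {S L X a b} e.
Arguments RPart {S L X Y Z} i w s {a b} ea eb.
Arguments RComp {S L X a b c} g f.
Arguments RZero {S L X} a b.
Arguments RAdd {S L X a b} f g.
Arguments ROpp {S L X a b} f.
Arguments rone {S L X a b} e.
Arguments rpart {S L X Y Z} i w s {a b} ea eb.

(* The enveloping ringoid U_L. *)
Section Enveloping.
Variables (S : Type) (L : lawvere S).

Definition uobj := {X : seq S & mor_from L X}.

Definition mk_uobj X (a : mor_from L X) : uobj := existT _ X a.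

Definition uhom (f g : uobj) : zmodType :=
  dsum (fun al : lhom L (tag g) (tag f) => rhom (pre (tagged f) al) (tagged g) : zmodType).

Definition ucomp (f g h : uobj) (r' : uhom g h) (r : uhom f g) : uhom f h :=
  dlift (fun al' (x' : rhom (pre (tagged g) al') (tagged h)) =>
    dlift (fun al (x : rhom (pre (tagged f) al) (tagged g)) =>
      dinj (V := fun be => rhom (pre (tagged f) be) (tagged h) : zmodType)
           (i := al \oL al')
        (rcomp (rcomp x' (rmap al' x)) (rone (pre_comp (tagged f) al al')))) r) r'.

Definition upart X Y (Z : S) (i : 'I_(size Y)) (w : lhom L Y [:: Z]) (s : lhom L X Y)
    (a b : mor_from L X) (ea : a = mk_from (lproj Y i \oL s))
    (eb : b = mk_from (w \oL s)) : uhom (mk_uobj a) (mk_uobj b) :=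
  dinj (V := fun al => rhom (pre a al) b : zmodType) (i := lid X)
    (rpart i w s (etrans (pre_id a) ea) eb).

Arguments upart {X Y Z} i w s {a b} ea eb.

(* The morphism al^* : f -> f al of U_L, for an object g equal to f al. *)
Definition upull (f g : uobj) (al : lhom L (tag g) (tag f))
    (e : pre (tagged f) al = tagged g) : uhom f g :=
  dinj (V := fun al => rhom (pre (tagged f) al) (tagged g) : zmodType) (i := al) (rone e).

Arguments upull {f g} al e.

Definition uone (f : uobj) : uhom f f := upull (lid (tag f)) (pre_id (tagged f)).

Definition uone_eq (f g : uobj) (e : f = g) : uhom f g :=
  eq_rect f (fun h => uhom f h : Type) (uone f) g e.

(* The free left U_L-module on a family T of elements x placed at pl x. *)
Section FreeModule.
Variables (T : Type) (pl : T -> uobj).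

Definition free_mod (x : uobj) : zmodType := dsum (fun t : T => uhom (pl t) x).

Definition fgen (t : T) (x : uobj) (r : uhom (pl t) x) : free_mod x :=
  dinj (V := fun t : T => uhom (pl t) x) r.

Definition fact_mod (x y : uobj) (r : uhom x y) (b : free_mod x) : free_mod y :=
  dlift (fun t (v : uhom (pl t) x) => fgen (ucomp r v)) b.

End FreeModule.

End Enveloping.

Arguments upart {S L X Y Z} i w s {a b} ea eb.
Arguments upull {S L f g} al e.

(* Composable strings of morphisms; an element of tup X Y is a string
   (w_1, ..., w_n) whose composite w_1 \oL ... \oL w_n goes from X to Y. *)
Section Strings.
Variables (S : Type) (L : lawvere S).

Inductive tup (X : seq S) : seq S -> Type :=
| tnil : tup X X
| tcons Y Z : lhom L Z Y -> tup X Z -> tup X Y.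

Arguments tnil {X}.

Fixpoint tcomp X Y (t : tup X Y) : lhom L X Y :=
  match t with
  | tnil => lid X
  | tcons _ _ w t' => w \oL tcomp t'
  end.

Fixpoint tsize X Y (t : tup X Y) : nat :=
  if t is tcons _ _ _ t' then (tsize t').+1 else 0.

Fixpoint tall (P : forall X Y, lhom L X Y -> Prop) X Y (t : tup X Y) : Prop :=
  if t is tcons _ _ w t' then P _ _ w /\ tall P t' else True.

Fixpoint thas (P : forall X Y, lhom L X Y -> Prop) X Y (t : tup X Y) : Prop :=
  if t is tcons _ _ w t' then P _ _ w \/ thas P t' else False.

Fixpoint tcat X Y Z (t : tup Y Z) : tup X Y -> tup X Z :=
  match t with
  | tnil => fun u => u
  | tcons _ _ w t' => fun u => tcons w (tcat t' u)
  end.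

Definition tone X Y (w : lhom L X Y) : tup X Y := tcons w tnil.

Definition tproj X Y (i : 'I_(size Y)) (t : tup X Y) : tup X [:: tnth (in_tuple Y) i] :=
  match t in tup _ Y return
    forall i : 'I_(size Y), tup X [:: tnth (in_tuple Y) i] with
  | tnil => fun i => tone (lproj X i)
  | tcons Y _ w t' => fun i => tcons (lproj Y i \oL w) t'
  end i.

Lemma tproj_comp X Y (i : 'I_(size Y)) (t : tup X Y) :
  tcomp (tproj i t) = lproj Y i \oL tcomp t.
Proof. by case: t i => [|Y' Z w t'] i /=; rewrite ?lcompA. Qed.

(* tmerge j composes the entries number j and j + 1, counted from 0. *)
Fixpoint tmerge (j : nat) X Y (t : tup X Y) : tup X Y :=
  match t with
  | tnil => tnil
  | tcons Y _ w t' =>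
    if j is j'.+1 then tcons w (tmerge j' t') else
    match t' in tup _ Z return lhom L Z Y -> tup X Y with
    | tnil => fun w => tone w
    | tcons _ _ w2 t'' => fun w => tcons (w \oL w2) t''
    end w
  end.

Lemma tmerge_comp j X Y (t : tup X Y) : tcomp (tmerge j t) = tcomp t.
Proof.
elim: t j => [|{}Y Z w t IH] [|j] //=; last by rewrite IH.
by case: t w IH => [|Y' Z' w2 t'] w IH //=; rewrite lcompA.
Qed.

Record split_head X Y (f : lhom L X Y) := SplitHead {
  sh_mid : seq S;
  sh_head : lhom L sh_mid Y;
  sh_tail : tup X sh_mid;
  sh_eq : f = sh_head \oL tcomp sh_tail }.

Definition tuncons X Y (t : tup X Y) : option (split_head (tcomp t)) :=
  match t with
  | tnil => None
  | tcons _ _ w t' => Some (SplitHead (erefl (w \oL tcomp t')))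
  end.

Definition tsingle X Y (t : tup X Y) : option {w : lhom L X Y | tcomp t = w} :=
  match t with
  | tnil => None
  | tcons Y _ w t' =>
    match t' in tup _ Z return
      forall w : lhom L Z Y, option {w' : lhom L X Y | w \oL tcomp t' = w'} with
    | tnil => fun w => Some (exist _ w (lcomp1r w))
    | tcons _ _ _ _ => fun _ => None
    end w
  end.

(* A string t' and a morphism p with t' \oL p = f; used for removing the
   last entry, and for factoring an entry through a partial permutation. *)
Record split_map X Y (f : lhom L X Y) := SplitMap {
  sm_mid : seq S;
  sm_tup : tup sm_mid Y;
  sm_map : lhom L X sm_mid;
  sm_eq : tcomp sm_tup \oL sm_map = f }.

Lemma sm_cons_eq X Y Z (w : lhom L Z Y) (f : lhom L X Z) (r : split_map f) :
  tcomp (tcons w (sm_tup r)) \oL sm_map r = w \oL f.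
Proof. by rewrite /= -lcompA sm_eq. Qed.

Definition sm_cons X Y Z (w : lhom L Z Y) (f : lhom L X Z) (r : split_map f) :
  split_map (w \oL f) := SplitMap (sm_cons_eq w r).

Definition sm_all X Y (t : tup X Y) : split_map (tcomp t) :=
  SplitMap (lcomp1r (tcomp t)).

Lemma tinit_eq X Y (w : lhom L X Y) :
  tcomp (@tnil Y) \oL w = w \oL tcomp (@tnil X).
Proof. by rewrite /= lcomp1l lcomp1r. Qed.

Fixpoint tinit X Y (t : tup X Y) : split_map (tcomp t) :=
  match t with
  | tnil => sm_all tnil
  | tcons Y _ w t' =>
    match t' in tup _ Z return
      forall w : lhom L Z Y, split_map (tcomp t') -> split_map (w \oL tcomp t') with
    | tnil => fun w _ => SplitMap (tinit_eq w)
    | tcons _ _ _ _ => fun w r => sm_cons w r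
    end w (tinit t')
  end.

End Strings.

Arguments tnil {S L X}.

Section Bar.
Variables (S : Type) (L : lawvere S) (c : representatives L).

Record factorization X Y (w : lhom L X Y) := Factorization {
  fz_mid : seq S;
  fz_ess : lhom L fz_mid Y;
  fz_perm : lhom L X fz_mid;
  fz_eq : fz_ess \oL fz_perm = w }.

Definition good_factorization X Y (w : lhom L X Y) (d : factorization w) : Prop :=
  essential c (fz_ess d) /\ partial_perm (fz_perm d).

Definition factorize X Y (w : lhom L X Y) : factorization w :=
  if pselect (exists d : factorization w, good_factorization d) is left h
  then projT1 (cid h) else Factorization (lcomp1r w).

Lemma push_last_eq X Y (w : lhom L X Y) (d : factorization w) :
  tcomp (tone (fz_ess d)) \oL fz_perm d = w \oL tcomp (@tnil S L X).
Proof. by rewrite /= !lcomp1r fz_eq. Qed.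

Lemma push_next_eq X Y Z W (w : lhom L Z Y) (d : factorization w) (w2 : lhom L W Z)
    (t : tup L X W) :
  tcomp (tcons (fz_ess d) (tcons (fz_perm d \oL w2) t)) \oL lid X =
  w \oL tcomp (tcons w2 t).
Proof. by rewrite /= lcomp1r -lcompA (lcompA (fz_ess d)) fz_eq. Qed.

(* Replaces the first entry w_i which is not essential, w_i = w' \oL p with
   w' essential, by w', and composes p with the next entry; if there is no
   next entry, p is returned as the second component. *)
Fixpoint push X Y (t : tup L X Y) : split_map (tcomp t) :=
  match t with
  | tnil => sm_all tnil
  | tcons Y _ w t' =>
    if pselect (essential c w) then sm_cons w (push t') else
    match t' in tup _ _ Z return
      forall w : lhom L Z Y, split_map (w \oL tcomp t') with
    | tnil => fun w => SplitMap (push_last_eq (factorize w))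
    | tcons _ _ w2 t'' => fun w => SplitMap (push_next_eq (factorize w) w2 t'')
    end w
  end.

(* Strings with codomain in S; the string of length 0 with codomain Y is ()_Y. *)
Record utup := UTup { udom : seq S; ucod : S; uval : tup L udom [:: ucod] }.

Definition place (t : utup) : uobj L := mk_uobj (mk_from (tcomp (uval t))).

Definition usize (t : utup) : nat := tsize (uval t).

Definition Bu (x : uobj L) : zmodType := free_mod place x.

Definition is_cell (t : utup) : Prop :=
  tall (fun X Y (w : lhom L X Y) => essential c w /\ ~ is_identity w) (uval t).

Definition cell := {t : utup | is_cell t}.

Definition cplace (a : cell) : uobj L := place (sval a).

Definition cdim (a : cell) : nat := usize (sval a).

(* The direct sum of the B_n; B_n is spanned by the cells of dimension n. *)
Definition Bbar (x : uobj L) : zmodType := free_mod cplace x.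

Lemma split_place X Y (f : lhom L X [:: Y]) (r : split_map f) :
  pre (tagged (place (UTup (sm_tup r)))) (sm_map r) = mk_from f.
Proof. by rewrite /pre /= sm_eq. Qed.

Lemma merge_place j X Y (t : tup L X [:: Y]) :
  pre (tagged (place (UTup (tmerge j t)))) (lid X) = mk_from (tcomp t).
Proof. by rewrite pre_id /= tmerge_comp. Qed.

Lemma cod_place X Y (f : lhom L X [:: Y]) (b : mor_from L X) : b = mk_from f ->
  pre (tagged (place (UTup (@tnil S L [:: Y])))) f = b.
Proof. by move=> ->; rewrite /pre /= lcomp1l. Qed.

Lemma proj_place X Z (i : 'I_(size Z)) (t : tup L X Z) :
  mk_from (tcomp (tproj i t)) = mk_from (lproj Z i \oL tcomp t).
Proof. by rewrite tproj_comp. Qed.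

Lemma one_place X Y (w : lhom L X [:: Y]) (b : mor_from L X) : b = mk_from w ->
  b = mk_from (w \oL lid X).
Proof. by rewrite lcomp1r. Qed.

Definition delta1 X Y (w : lhom L X [:: Y]) (b : mor_from L X) (e : b = mk_from w) :
    Bu (mk_uobj b) :=
  \sum_(i < size X)
    fgen (pl := place) (t := UTup (@tnil S L [:: tnth (in_tuple X) i]))
      (ucomp (upart i w (lid X) (one_place (erefl (mk_from (lproj X i)))) (one_place e))
             (upull (f := place (UTup tnil)) (g := mk_uobj (mk_from (lproj X i)))
                    (lproj X i) (cod_place (erefl _))))
  - fgen (pl := place) (t := UTup (@tnil S L [:: Y]))
      (upull (f := place (UTup tnil)) (g := mk_uobj b) w (cod_place e)).

Definition d_first (t : utup) : Bu (place t) :=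
  if tuncons (uval t) is Some (SplitHead Z w t' e) then
    \sum_(i < size Z)
      fgen (pl := place) (t := UTup (tproj i t'))
        (upart i w (tcomp t') (proj_place i t') (congr1 (@mk_from _ _ _ _) e))
  else 0.

(* d_j, where 0 < j < usize t *)
Definition d_mid (j : nat) (t : utup) : Bu (place t) :=
  fgen (pl := place) (t := UTup (tmerge j.-1 (uval t)))
    (upull (f := place (UTup (tmerge j.-1 (uval t)))) (g := place t)
           (lid (udom t)) (merge_place j.-1 (uval t))).

Definition d_last (t : utup) : Bu (place t) :=
  let r := tinit (uval t) in
  fgen (pl := place) (t := UTup (sm_tup r))
    (upull (f := place (UTup (sm_tup r))) (g := place t) (sm_map r) (split_place r)).

Definition deltaU (t : utup) : Bu (place t) :=
  match usize t with
  | 0 => 0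
  | 1 => if tsingle (uval t) is Some (exist w e) then delta1 (congr1 (@mk_from _ _ _ _) e)
         else 0
  | n => d_first t + \sum_(1 <= j < n) d_mid j t *~ (-1) ^+ j + d_last t *~ (-1) ^+ n
  end.

(* Phi on the generators of B^u. Each push strictly increases the index of the
   first entry which is not essential, so usize t pushes suffice; when a push
   stops before the last entry, the coefficient below is an identity. *)
Fixpoint Phi_rec (k : nat) (t : utup) : Bbar (place t) :=
  match pselect (is_cell t) with
  | left h => fgen (pl := cplace) (t := exist _ t h) (uone (place t))
  | right _ =>
    if pselect (thas (@partial_perm S L) (uval t)) then 0 else
    if k is k'.+1 then
      let r := push (uval t) in
      fact_mod (upull (f := place (UTup (sm_tup r))) (g := place t) (sm_map r) (split_place r))
           (Phi_rec k' (UTup (sm_tup r)))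
    else 0
  end.

Definition Phi (t : utup) : Bbar (place t) := Phi_rec (usize t) t.

Definition Phi_lin (x : uobj L) (b : Bu x) : Bbar x :=
  dlift (fun t (r : uhom (place t) x) => fact_mod r (Phi t)) b.

Definition delta (a : cell) : Bbar (cplace a) := Phi_lin (deltaU (sval a)).

Definition incidence (a b : cell) : uhom (cplace b) (cplace a) := delta a b.

Definition edge (a b : cell) : Prop := cdim a = (cdim b).+1 /\ incidence a b <> 0.

Definition at_most_one_edge (M : cell -> cell -> Prop) : Prop :=
  forall v a b a' b' : cell, M a b -> M a' b' ->
    v = a \/ v = b -> v = a' \/ v = b' -> a = a' /\ b = b'.

(* In an object x of U_L with 1_x = 0 every coefficient vanishes, so that no
   edge of the graph starts or ends at a cell placed at x, while [a : b] = 1_x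
   still makes sense there. Such objects exist for some complete reduced
   systems: for the rules m(x,x,y) -> x, m(x,y,x) -> x, m(y,x,x) -> x one has
   1 = d_1 m + d_2 m = 0 in each R_L^X. Membership of the matching edges in
   the graph is therefore required at the objects with 1_x <> 0. *)
Record morse_matching (M : cell -> cell -> Prop) : Prop := MorseMatching {
  mm_dim : forall a b, M a b -> cdim a = (cdim b).+1;
  mm_edge : forall a b, M a b -> uone (cplace a) <> 0 -> edge a b;
  mm_matching : at_most_one_edge M;
  mm_unit : forall a b, M a b -> exists e : cplace b = cplace a,
    incidence a b = uone_eq e \/ incidence a b = - uone_eq e;
  mm_acyclic : ~ exists al ga : nat -> cell, forall i : nat,
    [/\ M (ga i) (al i), edge (ga i) (al i.+1) & ~ M (ga i) (al i.+1)] }.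

End Bar.

Record signature (S : Type) := Signature {
  op : Type;
  op_dom : op -> seq S;
  op_cod : op -> S }.

Section All2P.
Variables (A B : Type) (P : A -> B -> Prop).

Fixpoint all2P (s : seq A) (t : seq B) : Prop :=
  match s, t with
  | [::], [::] => True
  | x :: s', y :: t' => P x y /\ all2P s' t'
  | _, _ => False
  end.

Lemma all2P_onth s t : all2P s t <-> size s = size t /\
    forall i x y, onth s i = Some x -> onth t i = Some y -> P x y.
Proof.
elim: s t => [|x s IH] [|y t] /=; [by split=> // _; split=> // i x y; rewrite onth0n
  | by split=> // -[] | by split=> // -[] |].
split=> [[Pxy /IH [-> Pst]]|[[st] Pst]].
  by split=> // -[|i] x' y' /=; [move=> [<-] [<-] | exact: Pst].
split; first exact: (Pst 0).
by apply/IH; split=> // i; exact: (Pst i.+1).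
Qed.

End All2P.

(* Terms, with variables V_X = {X} x nat. Well-sortedness is the predicate has_sort. *)
Section Terms.
Variables (S : Type) (Sg : signature S).

Definition var : Type := S * nat.

Inductive term : Type :=
| Var of S & nat
| App of op Sg & seq term.

Section TermInd.
Variable P : term -> Prop.
Hypothesis PVar : forall X x, P (Var X x).
Hypothesis PApp : forall f ts, (forall t, In t ts -> P t) -> P (App f ts).

Lemma term_ind' : forall t, P t.
Proof.
fix IH 1 => -[X x|f ts]; first exact: PVar.
apply: PApp; elim: ts => [t []|t ts IHts t' [<-|]]; [exact: IH | exact: IHts].
Qed.

End TermInd.

Fixpoint has_sort (t : term) (Y : S) : Prop :=
  match t with
  | Var X _ => X = Y
  | App f ts => op_cod f = Y /\ all2P has_sort ts (op_dom f)
  end.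

Fixpoint tvars (t : term) : seq var :=
  match t with
  | Var X x => [:: (X, x)]
  | App _ ts => flatten (map tvars ts)
  end.

Fixpoint subst (s : S -> nat -> term) (t : term) : term :=
  match t with
  | Var X x => s X x
  | App f ts => App f (map (subst s) ts)
  end.

Definition wsubst (s : S -> nat -> term) : Prop := forall X x, has_sort (s X x) X.

(* Positions are sequences of positive integers. *)
Fixpoint subterm (p : seq nat) (t : term) : option term :=
  match p, t with
  | [::], _ => Some t
  | i.+1 :: p', App _ ts => obind (subterm p') (onth ts i)
  | _, _ => None
  end.

Inductive conv (E : term -> term -> Prop) : term -> term -> Prop :=
| conv_ax l r : E l r -> conv E l r
| conv_refl t : conv E t t
| conv_sym t u : conv E t u -> conv E u t
| conv_trans t u v : conv E t u -> conv E u v -> conv E t v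
| conv_subst s t u : wsubst s -> conv E t u -> conv E (subst s t) (subst s u)
| conv_ctx f ts1 ts2 t u : conv E t u ->
    conv E (App f (ts1 ++ t :: ts2)) (App f (ts1 ++ u :: ts2)).

(* t is well sorted with variables among x_0 : X_0, ..., x_(n-1) : X_(n-1), where x_i
   is the variable (X_i, i). *)
Definition in_ctx (X : seq S) (t : term) : Prop :=
  forall Z x, In (Z, x) (tvars t) -> onth X x = Some Z.

Definition typed (X Y : seq S) (ts : seq term) : Prop :=
  all2P (fun t Z => has_sort t Z /\ in_ctx X t) ts Y.

Definition tuple_of (X Y : seq S) : Type := {ts : seq term | typed X Y ts}.

Definition tsubst (us : seq term) : term -> term :=
  subst (fun Z x => nth (Var Z x) us x).

Lemma subst_ext s s' t : (forall Z x, In (Z, x) (tvars t) -> s Z x = s' Z x) ->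
  subst s t = subst s' t.
Proof.
elim/term_ind': t => [X x|f ts IH] /= st; first by apply: st; left.
congr App; elim: ts IH st => [//|t ts IHts] IH st /=.
rewrite IH; [|by left|by move=> Z x Zx; apply: st; apply/in_app_iff; left].
rewrite IHts // => [u uts|Z x Zx]; first by apply: IH; right.
by apply: st; apply/in_app_iff; right.
Qed.

Lemma subst_subst s s' t :
  subst s (subst s' t) = subst (fun Z x => subst s (s' Z x)) t.
Proof.
elim/term_ind': t => [//|f ts IH] /=; congr App; rewrite -map_comp.
elim: ts IH => [//|t ts IHts] IH /=; rewrite IH; last by left.
by rewrite IHts // => u uts; apply: IH; right.
Qed.

Lemma subst_id s t : (forall Z x, In (Z, x) (tvars t) -> s Z x = Var Z x) ->
  subst s t = t.
Proof.
elim/term_ind': t => [X x|f ts IH] /= st; first by apply: st; left.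
congr App; elim: ts IH st => [//|t ts IHts] IH st /=.
rewrite IH; [|by left|by move=> Z x Zx; apply: st; apply/in_app_iff; left].
rewrite IHts // => [u uts|Z x Zx]; first by apply: IH; right.
by apply: st; apply/in_app_iff; right.
Qed.

Lemma subst_sort s t Y : has_sort t Y ->
  (forall Z x, In (Z, x) (tvars t) -> has_sort (s Z x) Z) -> has_sort (subst s t) Y.
Proof.
elim/term_ind': t Y => [X x|f ts IH] Y /=; first by move=> <- h; apply: h; left.
move=> [-> tsf] h; split=> //; move: (op_dom f) tsf.
elim: ts IH h => [//|t ts IHts] IH h [//|Z Zs] /= [tZ tsZs]; split.
  by apply: IH => //; [left | move=> W x Wx; apply: h; apply/in_app_iff; left].
apply: IHts => // [u uts|W x Wx]; first by apply: IH; right.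
by apply: h; apply/in_app_iff; right.
Qed.

Lemma tvars_subst s t v : In v (tvars (subst s t)) ->
  exists Z x, In (Z, x) (tvars t) /\ In v (tvars (s Z x)).
Proof.
elim/term_ind': t => [X x|f ts IH] /=; first by exists X, x; split=> //; left.
elim: ts IH => [//|t ts IHts] IH /= /in_app_iff [vt|vts].
  have [|Z [x [Zx vZx]]] := IH t _ vt; first by left.
  by exists Z, x; split=> //; apply/in_app_iff; left.
have [u uts|Z [x [Zx vZx]]] := IHts _ vts; first by apply: IH; right.
by exists Z, x; split=> //; apply/in_app_iff; right.
Qed.

Lemma typed_onth X Y ts i Z : typed X Y ts -> onth Y i = Some Z ->
  exists t, [/\ onth ts i = Some t, has_sort t Z & in_ctx X t].
Proof.
move=> /all2P_onth [sz h] Yi.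
have : onth ts i by rewrite onthTE sz -onthTE Yi.
case e: (onth ts i) => [t|//] _.
by exists t; case: (h _ _ _ e Yi).
Qed.

Lemma typed_comp X Y Z ts us : typed Y Z ts -> typed X Y us ->
  typed X Z (map (tsubst us) ts).
Proof.
move=> tst ust; elim: ts Z tst => [|t ts IH] [|W Z] //= [[tW tY] tsZ]; split; last exact: IH.
split.
  apply: subst_sort => // V x /tY /(typed_onth ust) [u [xu uV _]].
  by rewrite (@onth_nth _ _ _ _ _ xu).
move=> V x /tvars_subst [V' [x' [/tY Yx']]].
by have [u [xu _ uX]] := typed_onth ust Yx'; rewrite (@onth_nth _ _ _ _ _ xu) => /uX.
Qed.

Definition ctx_vars (X : seq S) : seq term :=
  [seq Var p.1 p.2 | p <- zip X (iota 0 (size X))].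

Lemma onth_ctx_vars X i Z : onth X i = Some Z -> onth (ctx_vars X) i = Some (Var Z i).
Proof.
have gen k : onth X i = Some Z ->
    onth [seq Var p.1 p.2 | p <- zip X (iota k (size X))] i = Some (Var Z (k + i)).
  elim: X k i => [|W X IH] k [|i] //=; first by move=> [->]; rewrite addn0.
  by move=> /(IH k.+1) ->; rewrite addSnnS.
exact: gen 0%N.
Qed.

Lemma size_ctx_vars X : size (ctx_vars X) = size X.
Proof. by rewrite size_map size_zip size_iota minnn. Qed.

Lemma typed_ctx_vars X : typed X X (ctx_vars X).
Proof.
apply/all2P_onth; split; first exact: size_ctx_vars.
move=> i t Z it iZ; move: it; rewrite (onth_ctx_vars iZ) => -[<-].
by split=> //= W x [[<- <-]|].
Qed.

Lemma onth_tnth X (i : 'I_(size X)) : onth X i = Some (tnth (in_tuple X) i) :> option S.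
Proof.
by case: X i => [[]//|Z X] i; rewrite (tnth_nth Z) onthE (nth_map Z).
Qed.

End Terms.

(* Renaming the context, each morphism X_1...X_n -> Y_1...Y_m of Syn(Sg, E)
   has a representative over the context x_0 : X_0, ..., x_(n-1) : X_(n-1) of in_ctx;
   two of them define the same morphism when they are componentwise related
   by conv E. *)
Section Syn.
Variables (S : Type) (Sg : signature S) (E : term Sg -> term Sg -> Prop).
Implicit Types X Y Z : seq S.

Definition tconv X Y (ts us : tuple_of Sg X Y) : Prop :=
  all2P (conv E) (sval ts) (sval us).

Lemma all2P_conv_refl ts : all2P (conv E) ts ts.
Proof. by elim: ts => //= t ts IH; split=> //; exact: conv_refl. Qed.

Lemma all2P_conv_sym ts us : all2P (conv E) ts us -> all2P (conv E) us ts.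
Proof.
elim: ts us => [|t ts IH] [|u us] //= [tu /IH].
by split=> //; exact: conv_sym.
Qed.

Lemma all2P_conv_trans ts us vs :
  all2P (conv E) ts us -> all2P (conv E) us vs -> all2P (conv E) ts vs.
Proof.
elim: ts us vs => [|t ts IH] [|u us] [|v vs] //= [tu tsus] [uv usvs].
by split; [exact: conv_trans uv | exact: IH usvs].
Qed.

Lemma tconv_equiv X Y : Equivalence (@tconv X Y).
Proof.
split=> [ts|ts us|ts us vs]; [exact: all2P_conv_refl | exact: all2P_conv_sym
  | exact: all2P_conv_trans].
Qed.

Definition syn_hom X Y : Type := quot (tconv_equiv X Y).

Definition scls X Y (ts : tuple_of Sg X Y) : syn_hom X Y := qclass (tconv_equiv X Y) ts.

Definition srep X Y (w : syn_hom X Y) : tuple_of Sg X Y := qrepr w.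

Lemma sclsP X Y (ts us : tuple_of Sg X Y) : scls ts = scls us <-> tconv ts us.
Proof. exact: qclassP. Qed.

Lemma srepK X Y (w : syn_hom X Y) : scls (srep w) = w.
Proof. exact: qreprK. Qed.

Lemma srep_cls X Y (ts : tuple_of Sg X Y) : tconv (srep (scls ts)) ts.
Proof. exact: qrepr_class. Qed.

Definition tuple_id X : tuple_of Sg X X := exist _ (ctx_vars Sg X) (typed_ctx_vars Sg X).

Definition tuple_comp X Y Z (ts : tuple_of Sg Y Z) (us : tuple_of Sg X Y) :
    tuple_of Sg X Z :=
  exist _ (map (tsubst (sval us)) (sval ts)) (typed_comp (svalP ts) (svalP us)).

Lemma typed_proj X (i : 'I_(size X)) :
  typed X [:: tnth (in_tuple X) i] [:: Var Sg (tnth (in_tuple X) i) i].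
Proof.
rewrite /typed /=; split=> //; split=> // Z x [[<- <-]|//].
exact: onth_tnth.
Qed.

Definition tuple_proj X (i : 'I_(size X)) : tuple_of Sg X [:: tnth (in_tuple X) i] :=
  exist _ [:: Var Sg (tnth (in_tuple X) i) i] (typed_proj i).

Lemma conv_App f ts us : all2P (conv E) ts us -> conv E (App f ts) (App f us).
Proof.
suff gen pf : all2P (conv E) ts us -> conv E (App f (pf ++ ts)) (App f (pf ++ us)).
  exact: (gen [::]).
elim: ts us pf => [|t ts IH] [|u us] pf //=; first by move=> _; exact: conv_refl.
move=> [tu /IH h]; apply: conv_trans (conv_ctx _ _ _ tu) _.
by rewrite -!cat_rcons; exact: h.
Qed.

Lemma conv_tsubst us us' t : all2P (conv E) us us' ->
  conv E (tsubst us t) (tsubst us' t).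
Proof.
move=> usus'; elim/term_ind': t => [X x|f ts IH].
  rewrite /tsubst /=; move: (Var _ _ _) => d.
  elim: us us' usus' x => [|u us IH] [|u' us'] //=.
    by move=> _ [|x]; exact: conv_refl.
  by move=> [uu' /IH h] [|x] //=; exact: h.
apply: conv_App; elim: ts IH => [//|t ts IHts] IH; split.
  by apply: IH; left.
by apply: IHts => u uts; apply: IH; right.
Qed.

Lemma tsubst_wsubst X Y us : typed (Sg := Sg) X Y us ->
  exists2 s, wsubst s & forall t, in_ctx Y t -> tsubst us t = subst s t.
Proof.
move=> ust; exists (fun (Z : S) x => if pselect (onth Y x = Some Z) then nth (Var Sg Z x) us x
                              else Var Sg Z x) => [Z x|t tY].
  case: pselect => [Yx|//].
  by have [u [xu uZ _]] := typed_onth ust Yx; rewrite (@onth_nth _ _ _ _ _ xu).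
by apply: subst_ext => Z x /tY Yx; case: pselect.
Qed.

Lemma tconv_comp X Y Z (ts ts' : tuple_of Sg Y Z) (us us' : tuple_of Sg X Y) :
  tconv ts ts' -> tconv us us' -> tconv (tuple_comp ts us) (tuple_comp ts' us').
Proof.
rewrite /tconv /= => tsts' usus'.
apply: (@all2P_conv_trans _ (map (tsubst (sval us')) (sval ts))).
  elim: (sval ts) => //= t s IH; split=> //; exact: conv_tsubst.
have [s ws hs] := tsubst_wsubst (svalP us').
case: ts ts' tsts' => [ts tst] [ts' tst'] /=.
elim: ts ts' Z tst tst' => [|t ts IH] [|t' ts'] [|W Z] //= [[_ tY] tsZ] [[_ tY'] tsZ'].
move=> [tt' /(IH _ _ tsZ tsZ') h]; split=> //.
by rewrite !hs //; exact: conv_subst.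
Qed.

Definition syn_comp X Y Z (g : syn_hom Y Z) (f : syn_hom X Y) : syn_hom X Z :=
  scls (tuple_comp (srep g) (srep f)).

Lemma syn_compE X Y Z (ts : tuple_of Sg Y Z) (us : tuple_of Sg X Y) :
  syn_comp (scls ts) (scls us) = scls (tuple_comp ts us).
Proof. by apply/sclsP; apply: tconv_comp; exact: srep_cls. Qed.

Lemma tuple_eq X Y (ts us : tuple_of Sg X Y) : sval ts = sval us -> ts = us.
Proof.
case: ts us => [ts h] [us h'] /= e; subst us.
by rewrite (Prop_irrelevance h h').
Qed.

Lemma syn_compA X Y Z W (h : syn_hom Z W) (g : syn_hom Y Z) (f : syn_hom X Y) :
  syn_comp h (syn_comp g f) = syn_comp (syn_comp h g) f.
Proof.
rewrite -[h]srepK -[g]srepK -[f]srepK !syn_compE; congr scls; apply: tuple_eq => /=.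
case: (srep h) (srep g) (srep f) => [ts tst] [us ust] [vs vst] /=.
rewrite -map_comp; elim: ts W h tst => [|t ts IH] [|V W] h //= [[_ tZ] tsW].
congr cons; last exact: (IH W (scls (exist _ ts tsW))).
rewrite /tsubst subst_subst; apply: subst_ext => V' x /tZ /(typed_onth ust) [u [xu _ _]].
have xvu : onth (map (tsubst vs) us) x = Some (tsubst vs u) by rewrite onth_map xu.
by rewrite (@onth_nth _ _ _ _ _ xu) (@onth_nth _ _ _ _ _ xvu).
Qed.

Lemma syn_comp1l X Y (f : syn_hom X Y) : syn_comp (scls (tuple_id Y)) f = f.
Proof.
rewrite -[f]srepK syn_compE; congr scls; apply: tuple_eq => /=.
case: (srep f) => [ts /=]; rewrite /ctx_vars => tst.
have gen k pf : size pf = k -> typed X Y ts ->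
    [seq tsubst (pf ++ ts) i | i <- [seq Var Sg p.1 p.2 | p <- zip Y (iota k (size Y))]]
    = ts.
  elim: ts Y k pf {f tst} => [|t ts IH] [|W Z] k pf //= pfk [_ tsZ].
  congr cons; first by rewrite /tsubst /= nth_cat pfk ltnn subnn.
  by rewrite -cat_rcons; apply: IH => //; rewrite size_rcons pfk.
exact: (gen 0%N [::]).
Qed.

Lemma syn_comp1r X Y (f : syn_hom X Y) : syn_comp f (scls (tuple_id X)) = f.
Proof.
rewrite -[f]srepK syn_compE; congr scls; apply: tuple_eq => /=.
case: (srep f) => [ts /=] {f}.
elim: ts Y => [|t ts IH] [|W Y] //= [[_ tX] tsY].
congr cons; last exact: IH tsY.
apply: subst_id => Z x /tX /(onth_ctx_vars Sg) xZ.
by rewrite (@onth_nth _ _ _ _ _ xZ).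
Qed.

Definition shead X (Y : S) (w : syn_hom X [:: Y]) : term Sg :=
  head (Var Sg Y 0) (sval (srep w)).

Lemma shead_typed X (Y : S) (w : syn_hom X [:: Y]) :
  sval (srep w) = [:: shead w] /\ has_sort (shead w) Y /\ in_ctx X (shead w).
Proof. by rewrite /shead; case: (srep w) => [[|t [|? ?]] //= [? []]]. Qed.

Lemma typed_pair Z X (w : forall i : 'I_(size X), syn_hom Z [:: tnth (in_tuple X) i]) :
  typed Z X [seq shead (w i) | i <- enum 'I_(size X)].
Proof.
apply/all2P_onth; rewrite size_map size_enum_ord; split=> // i t V.
rewrite onth_map => it iV.
have iX : (i < size X)%N by rewrite -onthTE iV.
have e : onth (enum 'I_(size X)) i = Some (Ordinal iX).
  rewrite onthE (nth_map (Ordinal iX)) ?size_enum_ord //; congr Some.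
  by apply: val_inj => /=; rewrite nth_enum_ord.
move: it; rewrite e /= => -[<-].
have := onth_tnth (Ordinal iX); rewrite /= iV => -[->].
by have [_ []] := shead_typed (w (Ordinal iX)).
Qed.

Lemma syn_prodP Z X (w : forall i : 'I_(size X), syn_hom Z [:: tnth (in_tuple X) i]) :
  exists! f : syn_hom Z X, forall i, syn_comp (scls (tuple_proj i)) f = w i.
Proof.
have sub (ts : tuple_of Sg Z X) i :
    (syn_comp (scls (tuple_proj i)) (scls ts) = w i) <->
    conv E (nth (Var Sg (tnth (in_tuple X) i) i) (sval ts) i) (shead (w i)).
  rewrite syn_compE -[w i]srepK; rewrite sclsP /tconv /= srepK.
  by have [-> _] := shead_typed (w i); split=> [[]|].
have nE (i : 'I_(size X)) d :
    nth d [seq shead (w i) | i <- enum 'I_(size X)] i = shead (w i).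
  by rewrite (nth_map i) ?size_enum_ord // nth_ord_enum.
exists (scls (exist _ _ (typed_pair w))); split=> [i|g].
  by apply/sub => /=; rewrite nE; exact: conv_refl.
rewrite -[g]srepK => gw; apply/sclsP; apply/all2P_onth => /=.
have sg : size (sval (srep g)) = size X by have /all2P_onth [] := svalP (srep g).
rewrite size_map size_enum_ord sg; split=> // i t u it iu.
have iX : (i < size X)%N by rewrite -sg -onthTE iu.
have /sub := gw (Ordinal iX).
rewrite /= (@onth_nth _ _ _ _ _ iu) => /conv_sym.
by rewrite -(nE (Ordinal iX) t) /= (@onth_nth _ _ _ _ _ it).
Qed.

Definition Syn : lawvere S :=
  Lawvere syn_compA syn_comp1l syn_comp1r syn_prodP.

End Syn.

Arguments Syn {S Sg} E.

Section Rewriting.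
Variables (S : Type) (Sg : signature S) (R : term Sg -> term Sg -> Prop).

Definition is_trs : Prop := forall l r, R l r ->
  (exists Y, has_sort l Y /\ has_sort r Y) /\
  forall v, In v (tvars r) -> In v (tvars l).

Inductive step (Q : term Sg -> term Sg -> Prop) : term Sg -> term Sg -> Prop :=
| step_root l r s : Q l r -> wsubst s -> step Q (subst s l) (subst s r)
| step_ctx f ts1 ts2 t u : step Q t u ->
    step Q (App f (ts1 ++ t :: ts2)) (App f (ts1 ++ u :: ts2)).

Definition well_sorted (t : term Sg) : Prop := exists Y, has_sort t Y.

Definition terminating : Prop :=
  ~ exists u : nat -> term Sg, well_sorted (u 0) /\ forall i, step R (u i) (u i.+1).

Definition church_rosser : Prop := forall a b,
  well_sorted a -> well_sorted b -> clos_refl_sym_trans _ (step R) a b ->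
  exists d, clos_refl_trans _ (step R) a d /\ clos_refl_trans _ (step R) b d.

Definition complete : Prop := terminating /\ church_rosser.

Definition irreducible (Q : term Sg -> term Sg -> Prop) (t : term Sg) : Prop :=
  ~ exists u, step Q t u.

Definition reduced : Prop := forall l r, R l r ->
  irreducible (fun l' r' => R l' r' /\ (l', r') <> (l, r)) l /\ irreducible R r.

Definition lhs (l : term Sg) : Prop := exists r, R l r.

Record lhs_order (lt : term Sg -> term Sg -> Prop) : Prop := LhsOrder {
  lo_irr : forall l, lhs l -> ~ lt l l;
  lo_trans : forall l1 l2 l3, lhs l1 -> lhs l2 -> lhs l3 ->
    lt l1 l2 -> lt l2 l3 -> lt l1 l3;
  lo_total : forall l1 l2, lhs l1 -> lhs l2 -> lt l1 l2 \/ l1 = l2 \/ lt l2 l1;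
  lo_noinc : ~ exists u : nat -> term Sg,
    (forall i, lhs (u i)) /\ forall i, lt (u i) (u i.+1) }.

End Rewriting.

Section Chains.
Variables (S : Type) (Sg : signature S) (R : term Sg -> term Sg -> Prop).
Variable lt : term Sg -> term Sg -> Prop.

Definition no_eq : term Sg -> term Sg -> Prop := fun _ _ => False.

Let F : lawvere S := Syn no_eq.
Let L : lawvere S := Syn R.

Variable cF : representatives F.

(* If t|_p omits a variable of t, then t|_p s is never efficient, so that no most
   general unifier in the sense of is_mgu exists; for instance, the rule
   m(m(x,y),z) -> m(x,m(y,z)) has no 3-chains. With strict = true the clause that t|_p s
   is essential is imposed, with strict = false it is dropped; in both cases the
   first component of the unifier is an entry of a cell, hence essential. *)
Variable strict : bool.

(* The R-irreducible tuple representing a morphism of L. *)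
Definition is_nf X Y (w : lhom L X Y) (ts : tuple_of Sg X Y) : Prop :=
  (forall t, In t (sval ts) -> irreducible R t) /\ scls R ts = w.

Definition nf X Y (w : lhom L X Y) : tuple_of Sg X Y :=
  if pselect (exists ts, is_nf w ts) is left h then projT1 (cid h) else srep w.

Definition nf_mor X Y (w : lhom L X Y) : lhom F X Y := scls no_eq (nf w).

(* t_1 t_2 ... t_n, composed in Syn(Sg). *)
Fixpoint juxt X Y (t : tup L X Y) : lhom F X Y :=
  match t with
  | tnil => lid X
  | tcons _ _ w t' => nf_mor w \oL juxt t'
  end.

Definition the_term X (Y : S) (w : lhom F X [:: Y]) : term Sg := shead w.

Definition rpos : Type := seq nat * term Sg.

Definition in_P (t : term Sg) (b : rpos) : Prop :=
  lhs R b.2 /\ exists s, wsubst s /\ subterm b.1 t = Some (subst s b.2).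

Definition rpos_lt (b b' : rpos) : Prop :=
  (b.1 < b'.1 :> seqlexi nat)%O \/ b.1 = b'.1 /\ lt b.2 b'.2.

(* is_max t b says that b is the maximum of P(t), None being -oo. *)
Definition is_max (t : term Sg) (b : option rpos) : Prop :=
  if b is Some b0 then in_P t b0 /\ forall b', in_P t b' -> b' = b0 \/ rpos_lt b' b0
  else forall b', ~ in_P t b'.

Definition omax_lt (b b' : option rpos) : Prop :=
  match b, b' with
  | _, None => False
  | None, Some _ => True
  | Some b0, Some b0' => rpos_lt b0 b0'
  end.

(* There is s' such that (s, s') is the most general unifier of (t|_p, l), where t|_p is
   taken in the context of t and l in a context listing its variables. *)
Definition mgu_at X (Y : S) Z (t : lhom F X [:: Y]) (p : seq nat) (l : term Sg)
    (s : lhom F Z X) : Prop :=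
  exists (V : S) (m : lhom F X [:: V]) (G : seq (var S)) (ml : lhom F (unzip1 G) [:: V])
         (s' : lhom F Z (unzip1 G)),
    [/\ subterm p (the_term t) = Some (the_term m),
        NoDup G /\ (forall v, In v G <-> In v (tvars l)),
        tsubst [seq Var Sg v.1 v.2 | v <- G] (the_term ml) = l &
        if strict then is_mgu cF m ml s s' else is_universal_unifier m ml s s'].

(* Only the order of the variables in the context of f(x_1, ..., x_n) is left open. *)
Definition in_signature X (Y : S) (w : lhom L X [:: Y]) : Prop :=
  exists (f : op Sg) (xs : seq (var S)), NoDup xs /\
    the_term (nf_mor w) = App f [seq Var Sg v.1 v.2 | v <- xs].

(* Applied to prefixes of cells only, which are again cells. *)
Inductive is_chain (Y : S) : forall X, tup L X [:: Y] -> Prop :=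
| chain0 : is_chain (@tnil S L [:: Y])
| chain1 X (w : lhom L X [:: Y]) : in_signature w -> is_chain (tone w)
| chainS X Z (t : tup L Z [:: Y]) (w : lhom L X Z) b p l :
    (0 < tsize t)%N -> is_chain t ->
    is_max (the_term (juxt t)) b ->
    is_max (the_term (juxt (tcat t (tone w)))) (Some (p, l)) ->
    omax_lt b (Some (p, l)) ->
    mgu_at (juxt t) p l (nf_mor w) ->
    is_chain (tcat t (tone w)).

Definition prefix_chain (t : utup L) (k : nat) : Prop :=
  exists Z (t1 : tup L Z [:: ucod t]) (t2 : tup L (udom t) Z),
    [/\ uval t = tcat t1 t2, tsize t1 = k & is_chain t1].

Definition is_ell (t : utup L) (k : nat) : Prop :=
  [/\ (0 < k <= usize t)%N, prefix_chain t k.-1 &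
      forall k', (k < k' <= usize t)%N -> ~ prefix_chain t k'.-1].

Inductive matching_pair : utup L -> utup L -> Prop :=
| mp_first X Y Z Z' (w : lhom L Z [:: Y]) (w' : lhom L Z' [:: Y]) (w'' : lhom L Z Z')
    (t2 : tup L X Z) :
    is_ell (UTup (tcons w t2)) 1 ->
    nf_mor w = nf_mor w' \oL nf_mor w'' ->
    in_signature w' ->
    matching_pair (UTup (tcons w' (tcons w'' t2))) (UTup (tcons w t2))
| mp_later X Y W Z Z' (t1 : tup L W [:: Y]) (w : lhom L Z W) (w' : lhom L Z' W)
    (w'' : lhom L Z Z') (t2 : tup L X Z) p l :
    (0 < tsize t1)%N ->
    is_ell (UTup (tcat t1 (tcons w t2))) (tsize t1).+1 ->
    nf_mor w = nf_mor w' \oL nf_mor w'' ->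
    is_max (the_term (juxt (tcat t1 (tone w)))) (Some (p, l)) ->
    mgu_at (juxt t1) p l (nf_mor w') ->
    matching_pair (UTup (tcat t1 (tcons w' (tcons w'' t2)))) (UTup (tcat t1 (tcons w t2))).

Definition matching (cL : representatives L) (a b : cell cL) : Prop :=
  matching_pair (sval a) (sval b).

End Chains.

Arguments no_eq {S} Sg _ _.
Arguments matching {S Sg R} lt cF strict cL a b.

(* Main.v *)
(* Along an edge g -> b of G, compare the composites T(g) and T(b) of the entries, taken
   in Syn(Sigma). The face d_0 yields a proper subterm of T(g), the last face a proper
   generalization of it, and an inner face d_j either rewrites T(g) or leaves it unchanged
   up to renaming, in which case t_j t_(j+1) is irreducible. As rewriting together with
   encompassment is well founded, only inner faces of the last kind remain from some point
   on along an infinite path. On these the maxima p(t_1 ... t_i), for i up to the length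
   of the chain prefix, control the path: a face d_j to the left of the matched
   position raises p(t_1 ... t_j) and keeps the earlier maxima, a face to the right of it
   keeps all of them and makes the chain prefix longer. All these maxima belong to the
   set P of one term, which has no infinite increasing sequence. The same comparison shows
   that a face other than the matched one does not contribute to the incidence along a
   matching edge.

   Most general unifiers are only used through the universal property of their first
   component, for which the essential representative is unique. *)

Require Import Defs.
From Stdlib Require Import Relation_Operators List.
From mathcomp Require Import all_boot all_order all_algebra.
From mathcomp Require Import boolp classical_sets functions cardinality fsbigop.
From mathcomp Require Import zify.
Import Defs.

Set Implicit Arguments.
Unset Strict Implicit.
Unset Printing Implicit Defensive.

Import Order.TTheory GRing.Theory.
Local Open Scope quotient_scope.
Local Open Scope ring_scope.

(** * The ringoid and its free modules *)

(** The boundary is never computed in full. For each kind of face one determines only which cells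
    can have a nonzero coefficient in it, since a ringoid scalar can kill a coefficient but not
    create one; an exact value is needed only for the matched inner face, where [Phi] is the
    identity. What is kept of [Phi] is the relation [pushed].

    Equalities between entries are extracted from equalities of composites by left cancellation:
    efficiency forces every context variable to occur, which makes the normal forms of essential
    morphisms monic in Syn(Sigma). The same fact bounds the length of a context by the size of the
    term. This settles the last face when it merely undoes an identification of variables: the term
    keeps its size, but its context grows.

    The obstacle to a direct descent is that the chain prefix may become shorter along a path. Hence
    an induction on n: from some point on, both [ell] and the index of the face are at least n. As
    [ell] is at most the dimension, which is constant along the path, this is absurd. *)

Lemma dsum_addE I (V : I -> zmodType) (f g : dsum V) i : (f + g) i = f i + g i.
Proof. by []. Qed.

Section DirectSumTheory.
Variables (I : Type) (V : I -> zmodType) (W : zmodType).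
Implicit Types (f g : dsum V) (F G : forall i, V i -> W).

(** Sums with different supports can be compared only over a common finite index set; this allows
    the support of [f] to be enlarged to one. *)
Lemma dlift_sub (A : set {classic I}) F f : (forall i, F i 0 = 0) -> finite_set A ->
  (forall i, f i <> 0 -> A i) -> dlift F f = \sum_(i \in A) F i (f i).
Proof.
move=> F0 finA fA; rewrite /dlift; symmetry; apply: fsbig_widen => // i [_ /=] nAi.
by have [->|/fA//] := pselect (f i = 0).
Qed.

Lemma dlift0 F : (forall i, F i 0 = 0) -> dlift F 0 = 0.
Proof.
by move=> F0; rewrite (@dlift_sub set0) //= ?fsbig_set0 //; exact: finite_set0.
Qed.

Lemma dliftD F f g : (forall i, {morph F i : x y / x + y}) ->
  dlift F (f + g) = dlift F f + dlift F g.
Proof.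
move=> FD; have F0 i : F i 0 = 0.
  by apply: (addrI (F i 0)); rewrite -FD !addr0.
pose A : set {classic I} := ([set i | f i <> 0] `|` [set i | g i <> 0])%classic.
have finA : finite_set A by rewrite finite_setU; split; exact: dcoef_fin.
rewrite !(@dlift_sub A) //; first by rewrite -fsbig_split //; apply: eq_fsbigr => i _; exact: FD.
- by right.
- by left.
- move=> i; rewrite /A /=.
  have [fi|] := pselect (f i = 0); last by left.
  by right=> gi; apply: H; rewrite /= fi gi addr0.
Qed.

Lemma dliftDl F G f : (forall i, F i 0 = 0) -> (forall i, G i 0 = 0) ->
  dlift (fun i x => F i x + G i x) f = dlift F f + dlift G f.
Proof.
move=> F0 G0; rewrite !(@dlift_sub [set i | f i <> 0]%classic) //; try exact: dcoef_fin.
  by rewrite -fsbig_split //; exact: dcoef_fin.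
by move=> i; rewrite F0 G0 addr0.
Qed.

Lemma dlift_eq F G f : (forall i x, F i x = G i x) -> dlift F f = dlift G f.
Proof. by move=> FG; apply: eq_fsbigr => i _; exact: FG. Qed.

Lemma dinjE i (v : V i) : dinj v i = v.
Proof.
rewrite /= /dinj_fun; case: pselect => // e.
by rewrite (Prop_irrelevance e erefl).
Qed.

Lemma dinj_neq i (v : V i) j : i <> j -> dinj v j = 0.
Proof. by rewrite /= /dinj_fun; case: pselect. Qed.

Lemma dinj0 i : dinj (0 : V i) = 0.
Proof.
apply: dsumP => j; have [ij|ij] := pselect (i = j); last exact: dinj_neq.
by subst j; rewrite dinjE.
Qed.

Lemma dinjD i : {morph (@dinj I V i) : x y / x + y}.
Proof.
move=> x y; apply: dsumP => j; have [ij|ij] := pselect (i = j).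
  by subst j; rewrite dsum_addE !dinjE.
by rewrite dsum_addE !dinj_neq // addr0.
Qed.

Lemma dlift_inj F i (v : V i) : (forall i, F i 0 = 0) -> dlift F (dinj v) = F i v.
Proof.
move=> F0; rewrite (@dlift_sub [set i]%classic) //.
- by rewrite fsbig_set1 dinjE.
- by move=> j; have [<-//|ij] := pselect (i = j); rewrite dinj_neq.
Qed.

End DirectSumTheory.

(** Makes the action of the ringoid on a free module coefficientwise ([fact_mod_coef]), so that a
    nonzero coefficient can be traced back through it. *)
Lemma dlift_coef I (V U : I -> zmodType) (G : forall i, V i -> U i) (f : dsum V) i :
  (forall i, G i 0 = 0) -> dlift (fun i x => dinj (G i x)) f i = G i (f i).
Proof.
move=> G0; pose A : set {classic I} := ([set i | f i <> 0] `|` [set i])%classic.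
have finA : finite_set A by rewrite finite_setU; split; [exact: dcoef_fin | exact: finite_set1].
rewrite (@dlift_sub _ _ _ A) //; last by left.
  rewrite fsbig_finite // (@big_morph _ _ (fun h : dsum U => h i) 0 +%R) // -fsbig_finite //.
  rewrite -(@fsbig_widen {classic I} _ _ _ [set i]%classic) ?fsbig_set1 ?dinjE //; first by right.
  by move=> j [_ ji]; apply: dinj_neq => ij; apply: ji; rewrite ij.
by move=> j; rewrite G0 dinj0.
Qed.

Section RingoidTheory.
Variables (S : Type) (L : lawvere S).

Section Slice.
Variable X : seq S.
Implicit Types a b c : mor_from L X.

Lemma rcls_add a b (f g : rexp a b) : rcls (RAdd f g) = rcls f + rcls g.
Proof. by apply/rclsP; apply: rr_add; apply: rr_sym; exact: rrep_cls. Qed.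

Lemma rcls_comp a b c (g : rexp b c) (f : rexp a b) :
  rcls (RComp g f) = rcomp (rcls g) (rcls f).
Proof. by apply/rclsP; apply: rr_comp; apply: rr_sym; exact: rrep_cls. Qed.

Lemma rcompDl a b c (f : rhom a b) : {morph (fun g : rhom b c => rcomp g f) : x y / x + y}.
Proof.
move=> x y; rewrite -[x]rrepK -[y]rrepK -[f]rrepK -rcls_add -!rcls_comp -rcls_add.
by apply/rclsP; exact: rr_compDl.
Qed.

Lemma rcompDr a b c (g : rhom b c) : {morph (@rcomp S L X a b c g) : x y / x + y}.
Proof.
move=> x y; rewrite -[x]rrepK -[y]rrepK -[g]rrepK -rcls_add -!rcls_comp -rcls_add.
by apply/rclsP; exact: rr_compDr.
Qed.

Lemma rcomp0l a b c (f : rhom a b) : rcomp (0 : rhom b c) f = 0.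
Proof. by apply: (addrI (rcomp 0 f)); rewrite -rcompDl !addr0. Qed.

Lemma rcomp0r a b c (g : rhom b c) : rcomp g (0 : rhom a b) = 0.
Proof. by apply: (addrI (rcomp g 0)); rewrite -rcompDr !addr0. Qed.

Lemma rcomp_rone a b c (e : b = c) (e' : a = b) : rcomp (rone e) (rone e') = rone (etrans e' e).
Proof. by subst c b; rewrite -rcls_comp; apply/rclsP; exact: rr_comp1l. Qed.

End Slice.

Section Restriction.
Variables (X X' : seq S) (al : lhom L X X').

Lemma rmap_cls a b (f : rexp a b) : rmap al (rcls f) = rcls (emap al f).
Proof. by apply/rclsP; apply: emap_rrel; exact: rrep_cls. Qed.

Lemma rmapD a b : {morph (@rmap S L X X' al a b) : x y / x + y}.
Proof.
by move=> x y; rewrite -[x]rrepK -[y]rrepK -rcls_add !rmap_cls -rcls_add.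
Qed.

Lemma rmap0 a b : rmap al (0 : rhom a b) = 0.
Proof. by apply: (addrI (rmap al 0)); rewrite -rmapD !addr0. Qed.

End Restriction.

Lemma ucompDl (f g h : uobj L) (r : uhom f g) :
  {morph (fun r' : uhom g h => ucomp r' r) : x y / x + y}.
Proof.
move=> x y; rewrite /ucomp dliftD // => al' {}x {}y.
rewrite -dliftDl; first apply: dlift_eq => al z.
- by rewrite -dinjD !rcompDl.
- by move=> al; rewrite rmap0 rcomp0r rcomp0l dinj0.
- by move=> al; rewrite rmap0 rcomp0r rcomp0l dinj0.
Qed.

Lemma ucomp0l (f g h : uobj L) (r : uhom f g) : ucomp (0 : uhom g h) r = 0.
Proof. by apply: (addrI (ucomp 0 r)); rewrite -ucompDl !addr0. Qed.

Lemma ucomp0r (f g h : uobj L) (r : uhom g h) : ucomp r (0 : uhom f g) = 0.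
Proof.
rewrite /ucomp; transitivity (dlift (fun _ _ => 0 : uhom f h) r).
  apply: dlift_eq => al' x; apply: dlift0 => al.
  by rewrite rmap0 rcomp0r rcomp0l dinj0.
by apply: fsbig1.
Qed.

Lemma ucomp_upull (f g h : uobj L) (al : lhom L (tag g) (tag f)) (al' : lhom L (tag h) (tag g))
    (e : pre (tagged f) al = tagged g) (e' : pre (tagged g) al' = tagged h) e'' :
  ucomp (upull al' e') (upull al e) = upull (f := f) (g := h) (al \oL al') e''.
Proof.
rewrite /ucomp /upull dlift_inj; last first.
  move=> be; transitivity (dlift (fun _ _ => 0 : uhom f h) (upull al e)).
    by apply: dlift_eq => ga x; rewrite !rcomp0l dinj0.
  by apply: fsbig1.
rewrite dlift_inj; last by move=> be; rewrite rmap0 rcomp0r rcomp0l dinj0.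
congr dinj; rewrite rmap_cls /= -/(rone _) !rcomp_rone; congr rone; exact: Prop_irrelevance.
Qed.

Lemma upull_eq (f g : uobj L) (al be : lhom L (tag g) (tag f)) e e' : al = be ->
  upull (f := f) (g := g) al e = upull be e'.
Proof. by move=> ab; subst be; congr upull; exact: Prop_irrelevance. Qed.

Lemma ucomp_uone (f g : uobj L) (al : lhom L (tag g) (tag f)) (e : pre (tagged f) al = tagged g) :
  ucomp (upull al e) (uone f) = upull al e.
Proof.
rewrite (@ucomp_upull f f g _ _ (pre_id _) e); first by rewrite lcomp1l.
move=> e''; apply: upull_eq; exact: lcomp1l.
Qed.

Lemma upull_id (X : seq S) (a b : mor_from L X) (e : pre a (lid X) = b)
    (e' : mk_uobj a = mk_uobj b) :
  upull (f := mk_uobj a) (g := mk_uobj b) (lid X) e = uone_eq e'.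
Proof.
have ab : a = b by rewrite -e pre_id.
case: b / ab e e' => e e'; rewrite (Prop_irrelevance e' erefl); exact: upull_eq.
Qed.

Lemma uone_eq_neq0 (f g : uobj L) (e : f = g) : uone g <> 0 -> uone_eq e <> 0.
Proof. by case: _ / e. Qed.

Section Modules.
Variables (T : Type) (pl : T -> uobj L).

Lemma fgen0 (t : T) x : fgen (0 : uhom (pl t) x) = 0.
Proof. exact: dinj0. Qed.

Lemma fact_mod_coef x y (r : uhom x y) (b : free_mod pl x) t :
  fact_mod r b t = ucomp r (b t).
Proof. by apply: dlift_coef => i; exact: ucomp0r. Qed.

Lemma fact_mod0 x y (b : free_mod pl x) : fact_mod (0 : uhom x y) b = 0.
Proof. by apply: dsumP => t; rewrite fact_mod_coef ucomp0l. Qed.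

Lemma fact_modDl x y (b : free_mod pl x) :
  {morph (fun r : uhom x y => fact_mod r b) : r r' / r + r'}.
Proof. by move=> r r'; apply: dsumP => t; rewrite dsum_addE !fact_mod_coef ucompDl. Qed.

Lemma fact_mod_gen x y (r : uhom x y) t (v : uhom (pl t) x) :
  fact_mod r (fgen v) = fgen (ucomp r v).
Proof. by apply: dlift_inj => i; rewrite ucomp0r fgen0. Qed.

End Modules.

End RingoidTheory.

(** * Coefficients of the linear extension of Phi *)

Section BarTheory.
Variables (S : Type) (L : lawvere S) (c : representatives L).

Lemma Phi_linD x : {morph (@Phi_lin S L c x) : b b' / b + b'}.
Proof. by move=> b b'; apply: dliftD => t; exact: fact_modDl. Qed.

Lemma Phi_lin0 x : Phi_lin c (0 : Bu x) = 0.
Proof. by apply: (addrI (Phi_lin c 0)); rewrite -Phi_linD !addr0. Qed.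

Lemma Phi_lin_gen x t (r : uhom (place t) x) :
  Phi_lin c (fgen r) = fact_mod r (Phi c t).
Proof. by apply: dlift_inj => i; rewrite fact_mod0. Qed.

Lemma Phi_cell t (h : is_cell c t) :
  Phi c t = fgen (pl := @cplace S L c) (t := exist _ t h) (uone (place t)).
Proof.
rewrite /Phi; case: (usize t) => [|n] /=; case: pselect => // h';
by rewrite (Prop_irrelevance h' h).
Qed.

Lemma Phi_lin_sum_coef x I (r : seq I) (P : pred I) (f : I -> Bu x) (b : cell c) :
  Phi_lin c (\sum_(i <- r | P i) f i) b = \sum_(i <- r | P i) Phi_lin c (f i) b.
Proof.
rewrite (big_morph (Phi_lin c (x := x)) (@Phi_linD x) (Phi_lin0 x)).
by rewrite (@big_morph _ _ (fun h : Bbar c x => h b) 0 +%R).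
Qed.

Lemma sumr_neq0 (V : zmodType) I (r : seq I) (P : pred I) (f : I -> V) :
  \sum_(i <- r | P i) f i <> 0 -> exists2 i, P i & f i <> 0.
Proof.
move=> ne; apply: contrapT => h; apply: ne; apply: big1 => i Pi.
by apply: contrapT => fi; apply: h; exists i.
Qed.

(** The scalar [r] acts on the coefficient of [b] by composition, and composition with 0 is 0. Hence
    the cells occurring in a face are found from its underlying string alone. *)
Lemma Phi_lin_gen_coef x t (r : uhom (place t) x) (b : cell c) :
  Phi_lin c (fgen r) b <> 0 -> Phi c t b <> 0.
Proof. by rewrite Phi_lin_gen fact_mod_coef => ne e; apply: ne; rewrite e ucomp0r. Qed.

Lemma d_mid_coef j (u : utup L) (b : cell c) : Phi_lin c (d_mid j u) b <> 0 ->
  Phi c (UTup (tmerge j.-1 (uval u))) b <> 0.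
Proof. exact: Phi_lin_gen_coef. Qed.

Lemma d_last_coef (u : utup L) (b : cell c) : Phi_lin c (d_last u) b <> 0 ->
  Phi c (UTup (sm_tup (tinit (uval u)))) b <> 0.
Proof. exact: Phi_lin_gen_coef. Qed.

End BarTheory.

(** * Well-foundedness and sequences *)

(** An element that is not accessible has a successor that is not accessible either; choice strings
    such successors into an infinite sequence. *)
Lemma no_seq_Acc (A : Type) (r : A -> A -> Prop) (P : A -> Prop) (a : A) :
  ~ (exists u : nat -> A, P (u 0) /\ forall i, r (u i) (u i.+1)) -> P a ->
  Acc (fun y x => r x y) a.
Proof.
move=> noseq Pa; apply: contrapT => nA; apply: noseq.
pose T := {x : A | ~ Acc (fun y x => r x y) x}.
have next (x : T) : exists y : T, r (sval x) (sval y).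
  apply: contrapT => nx; apply: (svalP x); constructor=> y xy.
  by apply: contrapT => nAy; apply: nx; exists (exist _ y nAy).
have [f fP] := choice next.
exists (fun i => sval (iter i f (exist _ a nA))); split=> // i /=; exact: fP.
Qed.

(** Weak steps are absorbed by the next strict one, so infinitely many strict steps would give an
    infinite [r]-descent from [u N]. *)
Lemma eventually_stop (A : Type) (r w : A -> A -> Prop) (u : nat -> A) (N : nat) :
  (forall x y z, w x y -> r y z -> r x z) -> Acc (fun y x => r x y) (u N) ->
  (forall i, (N <= i)%N -> r (u i) (u i.+1) \/ w (u i) (u i.+1)) ->
  exists2 M, (N <= M)%N & forall i, (M <= i)%N -> ~ r (u i) (u i.+1).
Proof.
move=> wr; move e : (u N) => x Ax; elim: Ax N e => {}x _ IH N e step.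
have [stop|] := pselect (forall i, (N <= i)%N -> ~ r (u i) (u i.+1)); first by exists N.
move=> /existsNP [m] /not_implyP [Nm /contrapT rm].
(* The strict step at m is moved back to n through the weak steps between them, which gives a
   genuine descent from [u n]. *)
have jump k n : (n + k)%N = m -> (N <= n)%N -> exists2 M, (n < M)%N & r (u n) (u M).
  elim: k n => [|k IHk] n nm Nn; first by exists m.+1; rewrite -nm addn0 // -nm addn0 in rm *.
  have [rn|wn] := step n Nn; first by exists n.+1.
  have [||M nM rM] := IHk n.+1; [lia | lia | exists M; [lia | exact: wr rM]].
have [||M NM] := jump (m - N)%N N; [lia | lia |].
rewrite e => /IH - /(_ M erefl) [i Mi|K MK stop]; first by apply: step; lia.
by exists K => //; lia.
Qed.

Lemma eventually_const (f : nat -> nat) (N : nat) :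
  (forall i, (N <= i)%N -> (f i.+1 <= f i)%N) ->
  exists2 M, (N <= M)%N & forall i, (M <= i)%N -> f i.+1 = f i.
Proof.
move=> fle; have [||i Ni|M NM stop] := @eventually_stop nat (fun x y => y < x)%N
    (fun x y => y <= x)%N f N.
- by move=> x y z /= yx zy; exact: leq_trans zy yx.
- by elim/ltn_ind: (f N) => n IH; constructor=> m mn; exact: IH.
- by right; exact: fle.
by exists M => // i Mi; apply/eqP; rewrite eqn_leq fle ?(leq_trans NM) //= leqNgt; apply/negP/stop.
Qed.

Section ListTheory.
Variables (A B : Type).

Lemma all2P_In (P : A -> B -> Prop) s t x : all2P P s t -> In x s -> exists2 y, In y t & P x y.
Proof.
elim: s t => [//|x' s IH] [|y t] //= [Pxy st] [<-|/(IH _ st) [z zt Pxz]].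
  by exists y => //; left.
by exists z => //; right.
Qed.

Lemma onth_In (s : seq A) i x : onth s i = Some x -> In x s.
Proof. by elim: s i => [[]//|y s IH] [|i] /=; [case=> ->; left | move=> /IH; right]. Qed.

Lemma In_onth (s : seq A) x : In x s -> exists i, onth s i = Some x.
Proof.
by elim: s => [//|y s IH] /= [->|/IH [i ix]]; [exists 0 | exists i.+1].
Qed.

Lemma In_flatten (ss : seq (seq A)) x : In x (flatten ss) <-> exists2 s, In s ss & In x s.
Proof.
elim: ss => [|s ss IH] /=; first by split=> // -[].
rewrite in_app_iff IH; split=> [[xs|[s' ? ?]]|[s' [<-|s'ss] xs']].
- by exists s => //; left.
- by exists s' => //; right.
- by left.
- by right; exists s'.
Qed.

Lemma In_map (f : A -> B) s y : In y (map f s) <-> exists2 x, In x s & y = f x.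
Proof.
elim: s => [|x s IH] /=; first by split=> // -[].
rewrite IH; split=> [[<-|[x' ? ->]]|[x' [->|x's] ->]].
- by exists x => //; left.
- by exists x' => //; right.
- by left.
- by right; exists x'.
Qed.

Lemma eq_map_In (f g : A -> B) s : (forall x, In x s -> f x = g x) -> map f s = map g s.
Proof.
elim: s => [//|x s IH] fg /=; rewrite fg; last by left.
by rewrite IH // => y ys; apply: fg; right.
Qed.

Lemma map_eq_In (f g : A -> B) s : map f s = map g s -> forall x, In x s -> f x = g x.
Proof. by elim: s => [//|y s IH] /= [fgy /IH h] x [<-//|/h]. Qed.

End ListTheory.

(** * Terms and rewriting *)

Section TermTheory.
Variables (S : Type) (Sg : signature S).
Implicit Types (t u : term Sg) (s : S -> nat -> term Sg).

Lemma has_sort_uniq t (Y Y' : S) : has_sort t Y -> has_sort t Y' -> Y = Y'.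
Proof. by case: t => [X x|f ts] /= => [->|[<- _] [<- _]]. Qed.

Lemma In_tvars_App f (ts : seq (term Sg)) v :
  In v (tvars (App f ts)) <-> exists2 t, In t ts & In v (tvars t).
Proof.
rewrite /= In_flatten; split=> [[vs /In_map [t tts ->] vt]|[t tts vt]]; first by exists t.
by exists (tvars t) => //; apply/In_map; exists t.
Qed.

Lemma In_tvars_subst s t Z x v :
  In (Z, x) (tvars t) -> In v (tvars (s Z x)) -> In v (tvars (subst s t)).
Proof.
elim/term_ind': t => [Z' x'|f ts IH]; first by move=> /= [[-> ->]|].
move=> /In_tvars_App [t tts Zxt] vs; apply/In_tvars_App.
by exists (subst s t); [apply/In_map; exists t | exact: IH].
Qed.

Lemma subst_inj_on s s' t : subst s t = subst s' t ->
  forall Z x, In (Z, x) (tvars t) -> s Z x = s' Z x.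
Proof.
elim/term_ind': t => [X x|f ts IH]; first by move=> ? Z y [[<- <-]|].
move=> [e] Z x /In_tvars_App [t tts Zx]; apply: (IH t) => //.
exact: (map_eq_In e).
Qed.

Lemma wsubst_Var : wsubst (fun X x => Var Sg X x).
Proof. by []. Qed.

Lemma wsubst_comp s s' : wsubst s -> wsubst s' -> wsubst (fun X x => subst s (s' X x)).
Proof. by move=> ws ws' X x; apply: subst_sort => // Y y _; exact: ws. Qed.

Lemma subst_Var t : subst (fun X x => Var Sg X x) t = t.
Proof. exact: subst_id. Qed.

Lemma subst_wsort s t (Y : S) : wsubst s -> has_sort (subst s t) Y -> has_sort t Y.
Proof.
move=> ws; elim/term_ind': t Y => [X x|f ts IH] Y /=.
  by move=> h; apply: has_sort_uniq h; exact: ws.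
move=> [-> tsf]; split=> //; move: (op_dom f) tsf.
elim: ts IH => [|t ts IHts] IH [|Z Zs] //= [tZ tsZs]; split; first by apply: IH => //; left.
by apply: IHts => // u uts; apply: IH; right.
Qed.

(** An application adds two, so that even a constant has size 2 and size 1 characterizes
    variables. *)
Fixpoint tmsize t : nat :=
  match t with
  | Var _ _ => 1
  | App _ ts => (sumn (map tmsize ts)).+2
  end.

Lemma tmsize_gt0 t : (0 < tmsize t)%N.
Proof. by case: t. Qed.

Lemma tmsize1 t : tmsize t = 1%N -> exists X x, t = Var Sg X x.
Proof. by case: t => // X x _; exists X, x. Qed.

(** The case of equality recognizes substitutions that only rename or identify variables; it is what
    remains to be treated for the last face. *)
Lemma tmsize_subst s t : (tmsize t <= tmsize (subst s t))%N /\
  (tmsize (subst s t) = tmsize t -> forall Z x, In (Z, x) (tvars t) -> tmsize (s Z x) = 1%N).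
Proof.
elim/term_ind': t => [X x|f ts IH].
  by split=> [|/= e Z y [[<- <-]|]] //; exact: tmsize_gt0.
suff [le eq] : (sumn (map tmsize ts) <= sumn (map tmsize (map (subst s) ts)))%N /\
    (sumn (map tmsize (map (subst s) ts)) = sumn (map tmsize ts) -> forall t, In t ts ->
     tmsize (subst s t) = tmsize t).
  split; first by rewrite /= !ltnS.
  move=> [/eq h] Z x /In_tvars_App [t tts Zx].
  by have [_] := IH t tts; apply=> //; exact: h.
elim: ts IH => [|t ts IHts] IH /=; first by split.
have [le1 eqt] := IH t (or_introl erefl).
have [le2 eqts] := IHts (fun u uts => IH u (or_intror uts)).
split; first exact: leq_add.
move=> e; have [e1 e2] : tmsize (subst s t) = tmsize t /\
  sumn (map tmsize (map (subst s) ts)) = sumn (map tmsize ts) by lia.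
by move=> u [<-//|]; exact: eqts.
Qed.

Lemma size_tvars t : (size (tvars t) <= tmsize t)%N.
Proof.
elim/term_ind': t => [//|f ts IH] /=; apply: leqW; apply: leqW.
elim: ts IH => [//|t ts IHts] IH /=; rewrite size_cat; apply: leq_add.
  by apply: IH; left.
by apply: IHts => u uts; apply: IH; right.
Qed.

Lemma subterm_cat p q t : subterm (p ++ q) t = obind (subterm q) (subterm p t).
Proof.
elim: p t => [//|[|i] p IH] [X x|f ts] //=.
by case: (onth ts i) => //= t; exact: IH.
Qed.

Lemma subterm_subst p s t u : subterm p t = Some u -> subterm p (subst s t) = Some (subst s u).
Proof.
elim: p t => [t [->]//|[|i] p IH] [X x|f ts] //=.
by rewrite onth_map; case: (onth ts i) => //= t; exact: IH.
Qed.

Lemma subterm_subst_inv p s t u :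
  (forall Z x, In (Z, x) (tvars t) -> exists Z' x', s Z x = Var Sg Z' x') ->
  subterm p (subst s t) = Some u -> exists2 v, subterm p t = Some v & u = subst s v.
Proof.
elim: p t => [t _ [<-]|i p IH]; first by exists t.
case=> [X x|f ts] sv.
  have [|Z' [x' /= ->]] := sv X x; first by left.
  by case: i.
case: i => [//|i] /=; rewrite onth_map; case e: (onth ts i) => [t|] //=; apply: IH.
move=> Z x Zx; apply: sv; apply/In_tvars_App; exists t => //; exact: onth_In e.
Qed.

Lemma subterm_vars p t u v : subterm p t = Some u -> In v (tvars u) -> In v (tvars t).
Proof.
elim: p t => [t [->]//|[|i] p IH] [X x|f ts] //=.
case e: (onth ts i) => [t|] //= ptu vu; apply/(In_tvars_App f); exists t; first exact: onth_In e.
exact: IH vu.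
Qed.

Lemma subterm_var t Z x : In (Z, x) (tvars t) -> exists p, subterm p t = Some (Var Sg Z x).
Proof.
elim/term_ind': t => [X y|f ts IH]; first by move=> /= [[-> ->]|//]; exists [::].
move=> /In_tvars_App [t tts /(IH t tts) [p ptx]].
by have [i it] := In_onth tts; exists (i.+1 :: p); rewrite /= it.
Qed.

Lemma tmsize_In t ts : In t ts -> (tmsize t <= sumn (map tmsize ts))%N.
Proof.
elim: ts => [//|u ts IH] /= [->|/IH h]; first exact: leq_addr.
by apply: leq_trans h _; exact: leq_addl.
Qed.

Lemma subterm_size p t u : subterm p t = Some u ->
  (tmsize u <= tmsize t)%N /\ (p <> [::] -> (tmsize u < tmsize t)%N).
Proof.
elim: p t => [t [->]//|[|i] p IH] [X x|f ts] //=.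
case e: (onth ts i) => [t|] //= /IH [h _].
by have := tmsize_In (onth_In e); split; lia.
Qed.

Lemma finite_positions t : exists l : seq (seq nat), forall p u, subterm p t = Some u -> p \in l.
Proof.
elim/term_ind': t => [X x|f ts IH].
  by exists [:: [::]] => -[|[|i] p] u.
suff [l lP] : exists l : seq (seq nat), forall i p u,
    obind (subterm p) (onth ts i) = Some u -> (i.+1 :: p) \in l.
  exists ([::] :: l) => -[//|[//|i] p] u /= /lP.
  by rewrite inE.
elim: ts IH => [_|t ts IHts IH]; first by exists [::] => i p u; rewrite onth0n.
have [l1 l1P] := IH t (or_introl erefl).
have [l2 l2P] := IHts (fun u uts => IH u (or_intror uts)).
exists (map (cons 1%N) l1 ++ map (fun p => if p is i :: p' then i.+1 :: p' else p) l2).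
move=> [|i] p u /= h; rewrite mem_cat; apply/orP.
  by left; apply/mapP; exists p => //; exact: l1P h.
by right; apply/mapP; exists (i.+1 :: p) => //; exact: l2P h.
Qed.

Lemma step_subst Q s t u : wsubst s -> step Q t u -> step Q (subst s t) (subst s u).
Proof.
move=> ws; elim=> [l r s' lr ws'|f ts1 ts2 {}t {}u _ IH].
  by rewrite !subst_subst; apply: step_root => //; exact: wsubst_comp.
by rewrite /= !map_cat /=; exact: step_ctx.
Qed.

Lemma step_subterm Q p t u u' : subterm p t = Some u -> step Q u u' ->
  exists2 t', step Q t t' & subterm p t' = Some u'.
Proof.
elim: p t => [t [->] uu'|[|i] p IH [X x|f ts]] //=; first by exists u'.
case e: (onth ts i) => [t|] //= ptu /(IH _ ptu) [t' tt' pt'u'].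
have [ts1 [ts2 [-> sz]]] : exists ts1 ts2, ts = ts1 ++ t :: ts2 /\ size ts1 = i.
  elim: ts i e => [i|t0 ts IHts [|i]]; first by rewrite onth0n.
    by move=> [->]; exists [::], ts.
  by move=> /IHts [ts1 [ts2 [-> <-]]]; exists (t0 :: ts1), ts2.
exists (App f (ts1 ++ t' :: ts2)); first exact: step_ctx.
suff -> : onth (ts1 ++ t' :: ts2) i = Some t' by [].
by elim: ts1 i sz {e} => [[]//|t0 ts1 IHts [//|i]] /= [/IHts].
Qed.

End TermTheory.

Section RewritingTheory.
Variables (S : Type) (Sg : signature S) (R : term Sg -> term Sg -> Prop).
Hypothesis trsR : is_trs R.
Implicit Types (t u : term Sg).

Lemma rule_sort l r (Y : S) : R l r -> has_sort l Y -> has_sort r Y.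
Proof. by move=> /trsR [[Z [lZ rZ]] _] lY; rewrite (has_sort_uniq lY lZ). Qed.

Lemma all2P_replace (A B : Type) (P : A -> B -> Prop) s1 s2 x y zs :
  (forall z, P x z -> P y z) -> all2P P (s1 ++ x :: s2) zs -> all2P P (s1 ++ y :: s2) zs.
Proof.
move=> Pxy; elim: s1 zs => [|z s1 IH] [|w zs] //= [Pz h]; split=> //; first exact: Pxy.
exact: IH.
Qed.

Lemma step_sort t u (Y : S) : step R t u -> has_sort t Y -> has_sort u Y.
Proof.
move=> tu; elim: tu Y => [l r s lr ws|f ts1 ts2 {}t {}u _ IH] Y.
  move=> /(subst_wsort ws) /(rule_sort lr) h.
  by apply: subst_sort => // Z x _; exact: ws.
by move=> /= [-> h]; split=> //; exact: all2P_replace h.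
Qed.

Lemma step_vars t u v : step R t u -> In v (tvars u) -> In v (tvars t).
Proof.
elim=> [l r s lr ws|f ts1 ts2 {}t {}u _ IH].
  move=> /tvars_subst [Z [x [Zx vs]]]; apply: (In_tvars_subst _ vs).
  by have [_] := trsR lr; exact.
move=> /(In_tvars_App f) [w] /in_app_iff w12 vw; apply/(In_tvars_App f).
case: w12 => [w1|[uw|w2]].
- by exists w => //; apply/in_app_iff; left.
- by exists t; [apply/in_app_iff; right; left | apply: IH; rewrite uw].
- by exists w => //; apply/in_app_iff; right; right.
Qed.

Hypothesis termR : terminating R.

Lemma Acc_step t : well_sorted t -> Acc (fun u t => step R t u) t.
Proof. exact: no_seq_Acc termR. Qed.

(** A rule with a variable of sort Z on the left applies to every term t of sort Z, so replacing t
    by [subst (s t) r] could be repeated forever. *)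
Lemma lhs_not_Var l (Z : S) x : lhs R l -> l <> Var Sg Z x.
Proof.
move=> [r lr] lx; subst l; apply: termR.
have rZ : has_sort r Z by apply: rule_sort lr _.
pose s t (W : S) (y : nat) := if pselect (W = Z) then t else Var Sg W y.
have ws t : has_sort t Z -> wsubst (s t) by move=> tZ W y; rewrite /s; case: pselect => // ?; subst W.
exists (fun i => iter i (fun t => subst (s t) r) (Var Sg Z x)).
have sortZ i : has_sort (iter i (fun t => subst (s t) r) (Var Sg Z x)) Z.
  elim: i => [//|i IH] /=; apply: subst_sort => // W y _; exact: ws.
split=> [|i]; first by exists Z.
have := step_root lr (ws _ (sortZ i)).
by rewrite [subst _ (Var _ _ _)]/= {1}/s; case: pselect.
Qed.

Lemma irreducible_Var (Z : S) x : irreducible R (Var Sg Z x).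
Proof.
move=> [u]; move e : (Var Sg Z x) => t tu; case: tu e => [l r s lr _|//].
case: l lr => [W y lr _|//]; apply: (@lhs_not_Var (Var Sg W y) W y) => //.
by exists r.
Qed.

Lemma normalizes t : well_sorted t ->
  exists2 u, clos_refl_trans _ (step R) t u & irreducible R u.
Proof.
move=> wt; have At := Acc_step wt; elim: At wt => {}t _ IH wt.
have [it|] := pselect (irreducible R t); first by exists t => //; exact: rt_refl.
move=> /contrapT [u tu]; have [|v uv iv] := IH u tu.
  by have [Y tY] := wt; exists Y; exact: step_sort tY.
by exists v => //; apply: rt_trans uv; exact: rt_step.
Qed.

(** Connects the classes of [conv], which are the morphisms of [Syn], with the equivalence closure
    of [step], for which the Church-Rosser property is stated. *)
Lemma conv_crst t u : conv R t u -> clos_refl_sym_trans _ (step R) t u.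
Proof.
elim=> [l r lr|{}t|{}t {}u _|{}t {}u v _ tu _ uv|s {}t {}u ws _ IH|f ts1 ts2 {}t {}u _ IH].
- by apply: rst_step; rewrite -(subst_Var l) -(subst_Var r); apply: step_root lr _; exact: wsubst_Var.
- exact: rst_refl.
- exact: rst_sym.
- exact: rst_trans uv.
- elim: IH => {t u} [t u tu|t|t u _|t u v _ tu _ uv];
    [by apply: rst_step; exact: step_subst | exact: rst_refl | exact: rst_sym | exact: rst_trans uv].
- elim: IH => {t u} [t u tu|t|t u _|t u v _ tu _ uv];
    [by apply: rst_step; exact: step_ctx | exact: rst_refl | exact: rst_sym | exact: rst_trans uv].
Qed.

Lemma step_conv t u : step R t u -> conv R t u.
Proof.
elim=> [l r s lr ws|f ts1 ts2 {}t {}u _]; last exact: conv_ctx.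
by apply: conv_subst => //; exact: conv_ax.
Qed.

Lemma steps_conv t u : clos_refl_trans _ (step R) t u -> conv R t u.
Proof.
by elim=> [{}t {}u /step_conv|{}t|{}t {}u v _ ? _]; [|exact: conv_refl|exact: conv_trans].
Qed.

Lemma steps_irreducible t u : irreducible R t -> clos_refl_trans _ (step R) t u -> t = u.
Proof.
move=> it /Operators_Properties.clos_rt_rt1n_iff; case=> // v w tv _.
by case: it; exists v.
Qed.

Lemma steps_sort t u (Y : S) : clos_refl_trans _ (step R) t u -> has_sort t Y -> has_sort u Y.
Proof. by elim=> [? ?|//|? ? ? _ h _ h'] => [/step_sort h /h //|/h/h']. Qed.

Lemma steps_vars t u v : clos_refl_trans _ (step R) t u -> In v (tvars u) -> In v (tvars t).
Proof. by elim=> [? ?|//|? ? ? _ h _ h'] => [/step_vars h /h //|/h'/h]. Qed.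

Definition steps1 := clos_trans _ (step R).

Lemma steps_steps1 t u : clos_refl_trans _ (step R) t u -> t = u \/ steps1 t u.
Proof.
elim=> [{}t {}u tu|{}t|{}t {}u v _ h _ h']; [by right; exact: t_step | by left |].
case: h => [->//|tu]; case: h' => [<-|uv]; first by right.
by right; exact: t_trans uv.
Qed.

Lemma steps1_subst s t u : wsubst s -> steps1 t u -> steps1 (subst s t) (subst s u).
Proof.
move=> ws; elim=> [{}t {}u tu|{}t {}u v _ h _]; last exact: t_trans.
by apply: t_step; exact: step_subst.
Qed.

Lemma steps1_subterm p t u u' : subterm p t = Some u -> steps1 u u' ->
  exists2 t', steps1 t t' & subterm p t' = Some u'.
Proof.
move=> ptu uu'; elim: uu' t ptu => [{}u {}u' uu' t ptu|{}u {}u' u'' _ IH1 _ IH2 t ptu].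
  by have [t' tt' h] := step_subterm ptu uu'; exists t' => //; exact: t_step.
have [t' tt' /IH2 [t'' tt'' h]] := IH1 _ ptu.
by exists t'' => //; exact: t_trans tt''.
Qed.

(* Encompassment. *)
Definition emb (a b : term Sg) : Prop :=
  exists p s, wsubst s /\ subterm p a = Some (subst s b).

(** This is the effect on the composite term of an inner face that rewrites: the term is first
    reduced, and [Phi] may then strip a partial permutation. *)
Definition gtR (a b : term Sg) : Prop := exists2 a', steps1 a a' & emb a' b.

Lemma emb_refl t : emb t t.
Proof. by exists [::], (fun Z x => Var Sg Z x); split=> //=; rewrite subst_Var. Qed.

Lemma emb_trans a b c : emb a b -> emb b c -> emb a c.
Proof.
move=> [p [s [ws pa]]] [q [s' [ws' qb]]].
exists (p ++ q), (fun Z x => subst s (s' Z x)); split; first exact: wsubst_comp.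
by rewrite subterm_cat pa /= (subterm_subst s qb) subst_subst.
Qed.

Lemma emb_subst s t : wsubst s -> emb (subst s t) t.
Proof. by move=> ws; exists [::], s. Qed.

Lemma emb_subterm p t u : subterm p t = Some u -> emb t u.
Proof. by move=> ptu; exists p, (fun Z x => Var Sg Z x); split=> //; rewrite subst_Var. Qed.

(** Rewriting is stable under substitution and contexts, so it lifts from [b] to [a]. In a descent,
    all encompassments can therefore be postponed. *)
Lemma emb_steps1 a b b' : emb a b -> steps1 b b' -> exists2 a', steps1 a a' & emb a' b'.
Proof.
move=> [p [s [ws pa]]] /(steps1_subst ws) /(steps1_subterm pa) [a' aa' pa'].
by exists a' => //; exists p, s.
Qed.

Lemma emb_gtR a b c : emb a b -> gtR b c -> gtR a c.
Proof.
move=> ab [b' bb' b'c]; have [a' aa' a'b'] := emb_steps1 ab bb'.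
by exists a' => //; exact: emb_trans b'c.
Qed.

(** Encompassment alone is not well founded, because of renamings. The induction runs on a term [t]
    accessible for rewriting and treats at once all [b] encompassed by [t], each rewriting of [b]
    being lifted to [t]. *)
Lemma Acc_gtR t : well_sorted t -> Acc (fun u t => gtR t u) t.
Proof.
move=> /Acc_step At; have {}At : Acc (fun u t => steps1 t u) t.
  elim: At => {}t _ IH; constructor=> u tu.
  have /Operators_Properties.clos_trans_t1n_iff [v tv|v w tv vw] := tu; first exact: IH.
  have := IH _ tv; case=> h; apply: h; exact/Operators_Properties.clos_trans_t1n_iff.
suff main b : emb t b -> Acc (fun u t => gtR t u) b by apply: main; exact: emb_refl.
elim: At b => {}t _ IH b tb; constructor=> c [b' bb' b'c].
by have [t' tt' t'b'] := emb_steps1 tb bb'; apply: IH tt' _ _; exact: emb_trans b'c.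
Qed.

Lemma gtR_irr t : well_sorted t -> ~ gtR t t.
Proof. by move=> /Acc_gtR; elim=> {}t _ IH ht; exact: (IH _ ht ht). Qed.

Hypothesis crR : church_rosser R.

Lemma irreducible_uniq t u : well_sorted t -> well_sorted u -> irreducible R t -> irreducible R u ->
  conv R t u -> t = u.
Proof.
move=> wt wu it iu /conv_crst /(crR wt wu) [d [td ud]].
by rewrite (steps_irreducible it td) (steps_irreducible iu ud).
Qed.

End RewritingTheory.

(** * Normal forms of morphisms *)

Section LawvereTheory.
Variables (S : Type) (L : lawvere S).
Implicit Types X Y Z : seq S.

Lemma partial_perm_lid X : partial_perm (lid X : lhom L X X).
Proof. by exists id; split=> // i; rewrite lcomp1r. Qed.

Lemma partial_perm_comp X Y Z (q : lhom L Y Z) (p : lhom L X Y) :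
  partial_perm q -> partial_perm p -> partial_perm (q \oL p).
Proof.
move=> [u [uinj uE]] [v [vinj vE]]; exists (v \o u); split; first exact: inj_comp.
by move=> i; rewrite lcompA -vE; exact: (congr1 (fun a => pre a p) (uE i)).
Qed.

(** Written as an identity after [w], the morphism is a permutation by efficiency. It then lies in
    the class of the identity, whose chosen representative is the identity itself. *)
Lemma essential_partial_perm c X Y (w : lhom L X Y) :
  essential c w -> partial_perm w -> is_identity w.
Proof.
move=> [eff repw] ppw; have pw : permutation w by apply: (eff _ (lid Y)); rewrite ?lcomp1l.
rewrite /is_identity -repw -(rep_id c); apply: rep_eq.
by exists w; split=> //=; rewrite lcomp1l.
Qed.

End LawvereTheory.

Section SynTheory.
Variables (S : Type) (Sg : signature S).
Implicit Types (X Y : seq S) (t u : term Sg).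

Notation F := (Syn (no_eq Sg)).

Lemma conv_no_eq t u : conv (no_eq Sg) t u -> t = u.
Proof. by elim=> // [*|*|*]; congruence. Qed.

(** Without equations each class contains exactly one tuple, so the chosen representative is the
    morphism itself. *)
Definition raw X Y (f : lhom F X Y) : seq (term Sg) := sval (srep f).

Lemma raw_typed X Y (f : lhom F X Y) : typed X Y (raw f).
Proof. exact: svalP. Qed.

Lemma raw_scls X Y (ts : tuple_of Sg X Y) : raw (scls (no_eq Sg) ts : lhom F X Y) = sval ts.
Proof.
have := srep_cls (no_eq Sg) ts; rewrite /tconv /raw.
elim: (sval (srep _)) (sval ts) => [|t us IH] [|t' us'] //= [/conv_no_eq -> h].
by rewrite (IH _ h).
Qed.

Lemma raw_inj X Y (f g : lhom F X Y) : raw f = raw g -> f = g.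
Proof. by move=> e; rewrite -[f]srepK -[g]srepK; congr scls; exact: tuple_eq. Qed.

Lemma raw_comp X Y Z (f : lhom F Y Z) (g : lhom F X Y) :
  raw (f \oL g) = map (tsubst (raw g)) (raw f).
Proof. exact: raw_scls. Qed.

Lemma raw_lid X : raw (lid X : lhom F X X) = ctx_vars Sg X.
Proof. exact: raw_scls. Qed.

Lemma raw_the_term X (Y : S) (f : lhom F X [:: Y]) : raw f = [:: the_term f].
Proof. exact: (shead_typed f).1. Qed.

Lemma the_term_typed X (Y : S) (f : lhom F X [:: Y]) :
  has_sort (the_term f) Y /\ in_ctx X (the_term f).
Proof. exact: (shead_typed f).2. Qed.

Lemma the_term_comp X Z (Y : S) (f : lhom F Z [:: Y]) (g : lhom F X Z) :
  the_term (f \oL g) = tsubst (raw g) (the_term f).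
Proof. by have := raw_comp f g; rewrite !raw_the_term => -[]. Qed.

Lemma typed_In X Y ts t : typed (Sg := Sg) X Y ts -> In t ts ->
  in_ctx X t /\ well_sorted t.
Proof. by move=> ty /(all2P_In ty) [Z _ [tZ tX]]; split=> //; exists Z. Qed.

Lemma onth_raw X Y (f : lhom F X Y) i (Z : S) : onth Y i = Some Z ->
  exists t, [/\ onth (raw f) i = Some t, has_sort t Z & in_ctx X t].
Proof. exact: typed_onth (raw_typed f). Qed.

Lemma size_raw X Y (f : lhom F X Y) : size (raw f) = size Y.
Proof. by have /all2P_onth [] := raw_typed f. Qed.

Lemma onth_raw_inv X Y (f : lhom F X Y) i t : onth (raw f) i = Some t ->
  exists Z, onth Y i = Some Z.
Proof.
move=> it; have : onth Y i by rewrite onthTE -(size_raw f) -onthTE it.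
by case: (onth Y i) => // Z; exists Z.
Qed.

(** The consequence of efficiency on which cancellation and the counting of variables rest; unlike
    efficiency, it is evidently stable under composition. *)
Definition covers X (ts : seq (term Sg)) : Prop :=
  forall i Z, onth X i = Some Z -> exists2 t, In t ts & In (Z, i) (tvars t).

Lemma tvars_tsubst us t (Z : S) i u v :
  In (Z, i) (tvars t) -> onth us i = Some u -> In v (tvars u) -> In v (tvars (tsubst us t)).
Proof.
move=> Zi iu vu; apply: (In_tvars_subst Zi); by rewrite (@onth_nth _ _ _ _ _ iu).
Qed.

Lemma covers_comp X Y Z (f : lhom F Y Z) (g : lhom F X Y) :
  covers Y (raw f) -> covers X (raw g) -> covers X (raw (f \oL g)).
Proof.
move=> cf cg i V /cg [u ug Viu]; have [j ju] := In_onth ug.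
have [W jW] := onth_raw_inv ju; have [t tf Wjt] := cf _ _ jW.
by exists (tsubst (raw g) t); [rewrite raw_comp; apply/In_map; exists t | exact: (tvars_tsubst Wjt ju Viu)].
Qed.

Lemma covers_lid X : covers X (raw (lid X : lhom F X X)).
Proof.
move=> i Z iZ; exists (Var Sg Z i); last by left.
by rewrite raw_lid; apply: onth_In; exact: onth_ctx_vars.
Qed.

(** The result of a substitution in a term determines the substitution on the variables of that
    term, here on all variables of the context [Y]. *)
Lemma comp_mono X Y Z (f : lhom F Y Z) (g h : lhom F X Y) :
  covers Y (raw f) -> f \oL g = f \oL h -> g = h.
Proof.
move=> cf e; apply: raw_inj; apply: eq_from_onth => i.
case eY: (onth Y i) => [V|]; last first.
  by rewrite !onth_default ?size_raw //; rewrite leqNgt -onthTE eY.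
have [t tf Vi] := cf _ _ eY; have := congr1 (@raw _ _) e.
rewrite !raw_comp => /map_eq_In /(_ t tf) /subst_inj_on /(_ V i Vi).
have [u [iu _ _]] := onth_raw g eY; have [u' [iu' _ _]] := onth_raw h eY.
by rewrite (@onth_nth _ _ _ _ _ iu) (@onth_nth _ _ _ _ _ iu') iu iu' => ->.
Qed.

Definition ppvars Y (ts : seq (term Sg)) : Prop :=
  exists u : nat -> nat,
    (forall i Z, onth Y i = Some Z -> onth ts i = Some (Var Sg Z (u i))) /\
    (forall i j, (i < size Y)%N -> (j < size Y)%N -> u i = u j -> i = j).

(** The injection of indices is inverted on its image and extended by the identity elsewhere. The
    result need not be injective, but it is well sorted and undoes the renaming. *)
Lemma ppvars_inverse Y ts : ppvars Y ts -> exists2 s, wsubst s &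
  forall t, in_ctx Y t -> subst s (tsubst ts t) = t.
Proof.
move=> [u [uE uinj]].
pose P Z k i := onth Y i = Some Z /\ u i = k.
exists (fun Z k => Var Sg Z (if pselect (exists i, P Z k i) is left h then projT1 (cid h) else k)).
  by move=> Z k; case: pselect.
move=> t tY; rewrite /tsubst subst_subst; apply: subst_id => Z i /tY iZ.
rewrite (@onth_nth _ _ _ _ _ (uE _ _ iZ)) /=; case: pselect => [h|[]]; last by exists i.
case: (cid h) => j [jZ uji] /=; congr Var; apply: uinj => //.
  by rewrite -onthTE jZ.
by rewrite -onthTE iZ.
Qed.

Lemma ppvars_Var Y ts t : ppvars Y ts -> in_ctx Y t -> forall Z x, In (Z, x) (tvars t) ->
  exists Z' x', nth (Var Sg Z x) ts x = Var Sg Z' x'.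
Proof.
move=> [u [uE _]] tY Z x /tY /uE xZ; exists Z, (u x).
exact: (@onth_nth _ _ _ _ _ xZ).
Qed.

Section NormalForms.
Variable R : term Sg -> term Sg -> Prop.
Hypotheses (trsR : is_trs R) (termR : terminating R) (crR : church_rosser R).

Notation L := (Syn R).

Lemma nf_exists X Y (w : lhom L X Y) : exists ts, is_nf w ts.
Proof.
suff [us [tyus redus irrus]] : exists us, [/\ typed X Y us, all2P (conv R) (sval (srep w)) us &
    forall t, In t us -> irreducible R t].
  exists (exist _ us tyus); split=> //; rewrite -[RHS](srepK w); apply/sclsP.
  exact: (all2P_conv_sym redus).
case: (srep w) => ts /=; elim: ts Y {w} => [|t ts IH] [|V Y] //=.
  by exists [::].
move=> [[tV tX] /IH [us [tyus redus irrus]]].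
have [|u tu iu] := @normalizes _ _ _ trsR termR t; first by exists V.
exists (u :: us); split=> //=; [split=> //| |].
- split; first exact: (steps_sort trsR _ tV).
  by move=> Z x Zx; apply: tX; exact: (steps_vars trsR tu Zx).
- by split=> //; exact: steps_conv.
- by move=> v [<-|/irrus].
Qed.

Lemma nfP X Y (w : lhom L X Y) : is_nf w (nf w).
Proof.
by rewrite /nf; case: pselect => [h|/(_ (nf_exists w))//]; case: (cid h).
Qed.

Lemma nf_uniq X Y (w : lhom L X Y) ts : is_nf w ts -> nf w = ts.
Proof.
have [irr1 cls1] := nfP w; move=> [irr2 cls2]; apply: tuple_eq.
have /sclsP : scls R (nf w) = scls R ts by rewrite cls1.
rewrite /tconv; move: (nf w) ts irr1 irr2 {cls1 cls2} => [ts1 ty1] [ts2 ty2] /=.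
elim: ts1 ts2 Y {w} ty1 ty2 => [|t ts1 IH] [|u ts2] [|V Y] //= [[tV _] ty1] [[uV _] ty2].
move=> irr1 irr2 [tu h]; congr cons.
  apply: (irreducible_uniq crR) tu; [by exists V | by exists V | by apply: irr1; left |].
  by apply: irr2; left.
by apply: IH ty1 ty2 _ _ h => v vs; [apply: irr1 | apply: irr2]; right.
Qed.

Lemma raw_nf X Y (w : lhom L X Y) : raw (nf_mor w) = sval (nf w).
Proof. exact: raw_scls. Qed.

Lemma raw_nf_irr X Y (w : lhom L X Y) t : In t (raw (nf_mor w)) -> irreducible R t.
Proof. by rewrite raw_nf; have [h _] := nfP w; exact: h. Qed.

Lemma nf_mor_inj X Y (w w' : lhom L X Y) : nf_mor w = nf_mor w' -> w = w'.
Proof.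
move=> /(congr1 (@raw _ _)); rewrite !raw_nf => /tuple_eq e.
by have [_ <-] := nfP w; have [_ <-] := nfP w'; rewrite e.
Qed.

Lemma nf_mor_cls X Y (w : lhom L X Y) ts : (forall t, In t (sval ts) -> irreducible R t) ->
  scls R ts = w -> nf_mor w = scls (no_eq Sg) ts.
Proof. by move=> irr cls; rewrite /nf_mor (@nf_uniq _ _ w ts). Qed.

Lemma comp_cls X Y Z (w : lhom L Y Z) (w' : lhom L X Y) :
  w \oL w' = scls R (tuple_comp (nf w) (nf w')).
Proof.
by have [_ {1}<-] := nfP w; have [_ {1}<-] := nfP w'; exact: syn_compE.
Qed.

Lemma nf_mor_comp X Y Z (w : lhom L Y Z) (w' : lhom L X Y) :
  (forall t, In t (raw (nf_mor w \oL nf_mor w')) -> irreducible R t) ->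
  nf_mor (w \oL w') = nf_mor w \oL nf_mor w'.
Proof.
move=> irr; rewrite comp_cls (@nf_mor_cls _ _ _ (tuple_comp (nf w) (nf w'))) //.
  by apply: raw_inj; rewrite raw_comp raw_scls !raw_nf.
by move: irr; rewrite raw_comp !raw_nf.
Qed.

(** Normalizing the syntactic composite componentwise gives an irreducible tuple in the class of
    [w \oL w']; by uniqueness of normal forms it is the normal form of that composite. *)
Lemma nf_mor_comp_steps X Y Z (w : lhom L Y Z) (w' : lhom L X Y) :
  all2P (clos_refl_trans _ (step R)) (raw (nf_mor w \oL nf_mor w')) (raw (nf_mor (w \oL w'))).
Proof.
apply/all2P_onth; split=> [|i t u it iu]; first by rewrite !size_raw.
have [V iV] := onth_raw_inv it.
have [t' [it' tV _]] := onth_raw (nf_mor w \oL nf_mor w') iV.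
have [u' [iu' uV _]] := onth_raw (nf_mor (w \oL w')) iV.
move: it' iu'; rewrite it iu => -[?] [?]; subst t' u'.
have [|v tv iv] := @normalizes _ _ _ trsR termR t; first by exists V.
suff -> : u = v by [].
apply: (irreducible_uniq crR) iv _; first by exists V.
- by exists V; exact: (steps_sort trsR _ tV).
- by apply: raw_nf_irr; exact: onth_In iu.
apply: conv_trans (steps_conv tv); apply: conv_sym.
have : tconv R (tuple_comp (nf w) (nf w')) (nf (w \oL w')).
  by apply/sclsP; rewrite -comp_cls; have [_ ->] := nfP (w \oL w').
rewrite /tconv -raw_nf /= => /all2P_onth [_]; apply; last exact: iu.
by rewrite -it raw_comp !raw_nf.
Qed.

Lemma nf_mor_lid X : nf_mor (lid X : lhom L X X) = lid X.
Proof.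
suff h : forall t, In t (sval (tuple_id Sg X)) -> irreducible R t by exact: (nf_mor_cls h).
move=> t tin; have [i it] := In_onth tin; rewrite /= in it.
have iX : (i < size X)%N by rewrite -(size_ctx_vars Sg) -onthTE it.
case e: (onth X i) => [Z|]; last by move: iX; rewrite -onthTE e.
by move: it; rewrite (onth_ctx_vars Sg e) => -[<-]; exact: irreducible_Var.
Qed.

End NormalForms.

End SynTheory.

(** * Partial permutations and efficiency in terms of variables *)

Section SynPartialPerm.
Variables (S : Type) (Sg : signature S) (R : term Sg -> term Sg -> Prop).
Hypotheses (trsR : is_trs R) (termR : terminating R) (crR : church_rosser R).
Implicit Types (X Y : seq S) (t u : term Sg).

Notation L := (Syn R).

Lemma raw_nf_proj_comp X Y (i : 'I_(size Y)) (w : lhom L X Y) t :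
  onth (raw (nf_mor w)) i = Some t -> raw (nf_mor (lproj Y i \oL w)) = [:: t].
Proof.
move=> it; have iY := onth_tnth i.
have [t' [it' tV tX]] := onth_raw (nf_mor w) iY.
move: it'; rewrite it => -[?]; subst t'.
have ty : typed X [:: tnth (in_tuple Y) i] [:: t] by split.
rewrite (@nf_mor_cls _ _ _ trsR termR crR _ _ _ (exist _ _ ty)) ?raw_scls //=.
  by move=> u [<-|//]; apply: (raw_nf_irr trsR termR); exact: onth_In it.
have [_ {1}<-] := nfP trsR termR w; rewrite /= syn_compE; congr scls.
by apply: tuple_eq; rewrite /= -raw_nf /tsubst /= (@onth_nth _ _ _ _ _ it).
Qed.

Lemma raw_nf_proj Y (i : 'I_(size Y)) :
  raw (nf_mor (lproj Y i : lhom L _ _)) = [:: Var Sg (tnth (in_tuple Y) i) i].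
Proof.
rewrite -[lproj Y i]lcomp1r; apply: raw_nf_proj_comp.
by rewrite nf_mor_lid // raw_lid; apply: onth_ctx_vars; exact: onth_tnth.
Qed.

Lemma mk_from_raw X (Y Y' : S) (f : lhom L X [:: Y]) (g : lhom L X [:: Y']) :
  mk_from f = mk_from g -> raw (nf_mor f) = raw (nf_mor g).
Proof. by move=> /(congr1 (fun a : mor_from L X => raw (nf_mor (tagged a)))). Qed.

(** A term has at most one sort, so the codomain can be recovered from the normal form. *)
Lemma raw_mk_from X (Y Y' : S) (f : lhom L X [:: Y]) (g : lhom L X [:: Y']) :
  raw (nf_mor f) = raw (nf_mor g) -> mk_from f = mk_from g.
Proof.
move=> e; have YY' : Y = Y'.
  have [fY _] := the_term_typed (nf_mor f); have [gY' _] := the_term_typed (nf_mor g).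
  by move: e fY; rewrite !raw_the_term => -[->] fY; exact: has_sort_uniq gY'.
by subst Y'; congr mk_from; apply: (nf_mor_inj trsR termR); exact: raw_inj.
Qed.

Lemma partial_perm_ppvars X Y (p : lhom L X Y) : partial_perm p -> ppvars Y (raw (nf_mor p)).
Proof.
move=> [u [uinj uE]].
exists (fun i => if pselect (i < size Y)%N is left h then u (Ordinal h) : nat else 0%N); split.
  move=> i Z iZ; have iY : (i < size Y)%N by rewrite -onthTE iZ.
  case: pselect => [h|//]; rewrite (Prop_irrelevance h iY).
  have [t [it tZ _]] := onth_raw (nf_mor p) iZ.
  have := uE (Ordinal iY); move=> /mk_from_raw; rewrite raw_nf_proj (@raw_nf_proj_comp _ _ (Ordinal iY) _ t) //.
  case=> e; rewrite it e; congr (Some (Var _ _ _)).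
  by move: tZ; rewrite e.
move=> i j iY jY; case: pselect => // hi; case: pselect => // hj.
by move=> /val_inj /uinj [].
Qed.

Lemma ppvars_partial_perm X Y (p : lhom L X Y) : ppvars Y (raw (nf_mor p)) -> partial_perm p.
Proof.
move=> [u [uE uinj]].
have uX (i : 'I_(size Y)) : (u i < size X)%N.
  have iY := onth_tnth i; have [t [it _ tX]] := onth_raw (nf_mor p) iY.
  move: it; rewrite (uE _ _ iY) => -[e]; rewrite -onthTE (tX (tnth (in_tuple Y) i)) //.
  by rewrite -e; left.
exists (fun i => Ordinal (uX i)); split=> [i j [e]|i].
  exact: val_inj (uinj _ _ (ltn_ord i) (ltn_ord j) e).
apply: raw_mk_from; have iY := onth_tnth i.
rewrite raw_nf_proj (raw_nf_proj_comp (uE _ _ iY)) /=; congr [:: Var _ _ _].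
have [t [it _ tX]] := onth_raw (nf_mor p) iY; move: it; rewrite (uE _ _ iY) => -[e].
have := tX (tnth (in_tuple Y) i) (u i); rewrite -e => /(_ (or_introl erefl)).
by rewrite -[u i]/(val (Ordinal (uX i))) onth_tnth => -[].
Qed.

(** An injective renaming preserves irreducibility: a rewriting of the renamed term, with the
    renaming undone, would be a rewriting of the original one. *)
Lemma nf_mor_comp_pp X Y Z (w : lhom L Y Z) (p : lhom L X Y) :
  partial_perm p -> nf_mor (w \oL p) = nf_mor w \oL nf_mor p.
Proof.
move=> /partial_perm_ppvars /ppvars_inverse [s ws sE]; apply: nf_mor_comp => //.
move=> t; rewrite raw_comp => /In_map [u uw ->] [v uv].
apply: (raw_nf_irr trsR termR uw); exists (subst s v).
have [uY _] := typed_In (raw_typed (nf_mor w)) uw.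
by rewrite -(sE u uY); exact: step_subst.
Qed.

Lemma nf_mor_pp_comp X Y Z (p : lhom L Y Z) (w : lhom L X Y) :
  partial_perm p -> nf_mor (p \oL w) = nf_mor p \oL nf_mor w.
Proof.
move=> /partial_perm_ppvars [u [uE _]]; apply: nf_mor_comp => //.
move=> t; rewrite raw_comp => /In_map [v vp ->]; have [i iv] := In_onth vp.
have [V iV] := onth_raw_inv iv; have [v' [iv' _ v'Y]] := onth_raw (nf_mor p) iV.
move: iv'; rewrite iv => -[?]; subst v'.
move: iv; rewrite (uE _ _ iV) => -[?]; subst v.
have [|z [iz _ _]] := onth_raw (nf_mor w) (v'Y V (u i) _); first by left.
rewrite /tsubst /= (@onth_nth _ _ _ _ _ iz); apply: (raw_nf_irr trsR termR); exact: onth_In iz.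
Qed.

(** If variable i did not occur, [w] would factor through the projection that forgets it. This is a
    partial permutation between contexts of different lengths, against efficiency. *)
Lemma efficient_covers X Y (w : lhom L X Y) : efficient w -> covers X (raw (nf_mor w)).
Proof.
move=> eff i Z iZ; apply: contrapT => nocover.
have iX : (i < size X)%N by rewrite -onthTE iZ.
(* The context without its entry i; [bump i] sends its indices to those of X, and [unbump i] renames
   the terms of [w] back. *)
pose X' := take i X ++ drop i.+1 X.
have szX' : size X = (size X').+1 by rewrite size_cat size_take size_drop iX; lia.
have onthX' k : onth X' k = onth X (bump i k).
  rewrite /X' onth_cat size_take iX /bump; case: (ltnP k i) => ki.
    by rewrite !onthE map_take nth_take.
  by rewrite !onthE map_drop nth_drop; congr nth; lia.
have typ : typed X X' [seq Var Sg p.1 (bump i p.2) | p <- zip X' (iota 0 (size X'))].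
  apply/all2P_onth; rewrite size_map size_zip size_iota minnn; split=> // k t V.
  rewrite onth_map => kt kV.
  have := onth_ctx_vars Sg kV; rewrite onth_map; move: kt.
  case: (onth _ _) => [[V' k']|] //= [<-] [-> ->]; split=> // W x [[<- <-]|//].
  by rewrite -onthX'.
pose p : lhom L X X' := scls R (exist _ _ typ).
pose s (V : S) k := Var Sg V (unbump i k).
have sX t : In t (raw (nf_mor w)) -> in_ctx X' (subst s t).
  move=> tw V k /tvars_subst [V' [k' [V'k' /= [[<- <-]|//]]]].
  have [tX _] := typed_In (raw_typed (nf_mor w)) tw.
  have [e|ne] := eqVneq k' i.
    case: nocover; exists t => //; move: (tX _ _ V'k'); rewrite e iZ => -[->].
    by rewrite -e.
  by rewrite onthX' (unbumpK ne); exact: tX.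
have tyw : typed X' Y (map (subst s) (raw (nf_mor w))).
  apply/all2P_onth; rewrite size_map size_raw; split=> // k t V; rewrite onth_map => kt kV.
  have [t' [kt' t'V _]] := onth_raw (nf_mor w) kV; move: kt; rewrite kt' /= => -[<-].
  by split; [exact: subst_sort | apply: sX; exact: onth_In kt'].
pose w' : lhom L X' Y := scls R (exist _ _ tyw).
have ww' : w = w' \oL p.
  rewrite /w' /p /= syn_compE; have [_ {1}<-] := nfP trsR termR w; congr scls; apply: tuple_eq => /=.
  rewrite -raw_nf -map_comp -[LHS]map_id; apply: eq_map_In => t tw /=.
  rewrite /tsubst subst_subst subst_id // => V k Vk; rewrite /s /=.
  have [tX _] := typed_In (raw_typed (nf_mor w)) tw.
  have ki : k != i.
    apply/eqP => e; case: nocover; exists t => //; move: (tX _ _ Vk); rewrite e iZ => -[->].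
    by rewrite -e.
  have kX' : onth X' (unbump i k) = Some V by rewrite onthX' (unbumpK ki); exact: tX.
  have := onth_ctx_vars Sg kX'; rewrite onth_map.
  set z := zip _ _; case e: (onth z _) => [[V' k']|] //= [eV ek].
  have := onth_map (unbump i k) z (fun v : S * nat => Var Sg v.1 (bump i v.2)); rewrite e /=.
  by move=> h; rewrite (@onth_nth _ _ _ _ _ h) eV ek (unbumpK ki).
have pp : partial_perm p.
  apply: ppvars_partial_perm.
  rewrite (@nf_mor_cls _ _ _ trsR termR crR _ _ _ (exist _ _ typ)) //; last first.
    by move=> t /= /In_map [[V k] _ ->]; exact: irreducible_Var.
  rewrite raw_scls /=; exists (bump i); split=> [k V kV|j k _ _ /(can_inj (@bumpK i)) //].
  have := onth_ctx_vars Sg kV; rewrite !onth_map.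
  by case: (onth _ _) => [[V' k']|] //= [-> ->].
have [_] := eff _ _ _ pp ww'; lia.
Qed.

End SynPartialPerm.

(** * Strings and the map Phi *)

(** Proof irrelevance gives this for every index type; it is used to compare strings once their
    hidden intermediate objects have been identified. *)
Lemma existT_inj (A : Type) (P : A -> Type) a (x y : P a) :
  existT P a x = existT P a y -> x = y.
Proof.
move=> e; have h := projT2_eq e.
by rewrite /= (Prop_irrelevance (projT1_eq e) erefl) in h.
Qed.

Section StringTheory.
Variables (S : Type) (L : lawvere S).
Implicit Types X Y Z W : seq S.

Lemma tcat_nil X Y (t : tup L X Y) : tcat t tnil = t.
Proof. by elim: t => //= {}Y Z w t ->. Qed.

Lemma tcatA X Y Z W (t1 : tup L Z W) (t2 : tup L Y Z) (t3 : tup L X Y) :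
  tcat t1 (tcat t2 t3) = tcat (tcat t1 t2) t3.
Proof. by elim: t1 t2 => //= {}W V w t1 IH t2; rewrite IH. Qed.

Lemma tsize_tcat X Y Z (t1 : tup L Y Z) (t2 : tup L X Y) :
  tsize (tcat t1 t2) = (tsize t1 + tsize t2)%N.
Proof. by elim: t1 t2 => //= {}Z W w t1 IH t2; rewrite IH. Qed.

Lemma tall_tcat (P : forall X Y, lhom L X Y -> Prop) X Y Z (t1 : tup L Y Z) (t2 : tup L X Y) :
  tall P (tcat t1 t2) <-> tall P t1 /\ tall P t2.
Proof.
elim: t1 t2 => [|{}Z W w t1 IH] t2 /=; first by split=> // -[].
by rewrite IH; split=> [[? []]|[[]]].
Qed.

Lemma tall_impl (P Q : forall X Y, lhom L X Y -> Prop) X Y (t : tup L X Y) :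
  (forall X Y (w : lhom L X Y), P _ _ w -> Q _ _ w) -> tall P t -> tall Q t.
Proof. by move=> PQ; elim: t => //= {}Y Z w t IH [/PQ ? /IH]. Qed.

Definition tsplit X Y : Type := {W : seq S & (tup L W Y * tup L X W)%type}.

Lemma tcons_inj X Y Z Z' (w : lhom L Z Y) (w' : lhom L Z' Y) (t : tup L X Z) (t' : tup L X Z') :
  tcons w t = tcons w' t' ->
  existT (fun Z => (lhom L Z Y * tup L X Z)%type) Z (w, t) = existT _ Z' (w', t').
Proof.
pose f (u : tup L X Y) : option {Z : seq S & (lhom L Z Y * tup L X Z)%type} :=
  if u is tcons _ _ w t then Some (existT _ _ (w, t)) else None.
by move=> /(congr1 f) /Some_inj.
Qed.

Lemma tsize0 X Y (t : tup L X Y) : tsize t = 0%N ->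
  existT (fun X => tup L X Y) X t = existT _ Y tnil.
Proof. by case: t. Qed.

Lemma tsizeS X Y (t : tup L X Y) : (0 < tsize t)%N ->
  exists Z (w : lhom L Z Y) t', t = tcons w t'.
Proof. by case: t => // {}Y Z w t _; exists Z, w, t. Qed.

Lemma tcat_inj X Y W W' (t1 : tup L W Y) (t2 : tup L X W) (t1' : tup L W' Y) (t2' : tup L X W') :
  tcat t1 t2 = tcat t1' t2' -> tsize t1 = tsize t1' ->
  existT _ W (t1, t2) = existT _ W' (t1', t2') :> tsplit X Y.
Proof.
move: t2 W' t1' t2'; induction t1 as [|Y Z w t1 IH] => t2 W' t1' t2'.
  move=> e /= sz; have h := tsize0 (esym sz); have /= ? := congr1 tag h; subst W'.
  by have ? := existT_inj h; subst t1'; rewrite /= in e *; rewrite e.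
move=> e sz; have [|Z' [w' [t'' ?]]] := @tsizeS _ _ t1'; first by rewrite -sz.
subst t1'; rename t'' into t1'; move: e sz => /= /tcons_inj e [sz]; have /= eZ := congr1 tag e; subst Z'.
have [? /IH h] := existT_inj e; subst w'; have {}h := h sz.
by have /= eW := congr1 tag h; subst W'; have [-> ->] := existT_inj h.
Qed.

Lemma tup_split X Y (t : tup L X Y) k : (k <= tsize t)%N ->
  exists W (t1 : tup L W Y) (t2 : tup L X W), t = tcat t1 t2 /\ tsize t1 = k.
Proof.
elim: t k => [|{}Y Z w t IH] [|k] //= h; first by exists X, tnil, tnil.
  by exists Y, tnil, (tcons w t).
by have [W [t1 [t2 [-> <-]]]] := IH k h; exists W, (tcons w t1), t2.
Qed.

Lemma tup_last X Y (t : tup L X Y) : (0 < tsize t)%N ->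
  exists W (t' : tup L W Y) (w : lhom L X W), t = tcat t' (tone w).
Proof.
move=> t0; have [|W [t1 [t2 [tE sz]]]] := @tup_split _ _ t (tsize t).-1; first lia.
move: sz; rewrite tE tsize_tcat => sz; have [|Z [w [t' t2E]]] := @tsizeS _ _ t2.
  by move: t0; rewrite tE tsize_tcat; lia.
subst t2; have t'0 : tsize t' = 0%N by move: sz => /=; lia.
have e := tsize0 t'0; have /= eX := congr1 tag e; subst Z.
by exists W, t1, w; rewrite (existT_inj e).
Qed.

Lemma tmerge_tcat X Y Z V W (t1 : tup L W Y) (w : lhom L V W) (w' : lhom L Z V) (t2 : tup L X Z) :
  tmerge (tsize t1) (tcat t1 (tcons w (tcons w' t2))) = tcat t1 (tcons (w \oL w') t2).
Proof. by elim: t1 w => //= {}Y U v t1 IH w; rewrite IH. Qed.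

Lemma tinitP X Y (t : tup L X Y) : (0 < tsize t)%N ->
  t = tcat (sm_tup (tinit t)) (tone (sm_map (tinit t))).
Proof.
elim: t => //= {}Y Z w t IH _; case: t w IH => //= {}Z V w' t w IH.
by rewrite /= {1}IH.
Qed.

Lemma UTup_inj X (Y : S) (t t' : tup L X [:: Y]) : UTup t = UTup t' -> t = t'.
Proof.
move=> /(congr1 (fun u : utup L => existT (fun XY : seq S * S => tup L XY.1 [:: XY.2])
  (udom u, ucod u) (uval u))) /= e.
exact: (existT_inj e).
Qed.

Section Push.
Variable c : representatives L.

Lemma factorize_pp X Y (w : lhom L X Y) : partial_perm (fz_perm (factorize c w)).
Proof.
rewrite /factorize; case: pselect => [h|_] /=; last exact: partial_perm_lid.
by case: (cid h) => d [].
Qed.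

(** Over-approximates [push]: it forgets which entry is treated and that [e] is essential, and keeps
    only that a partial permutation is split off and moved to the right. *)
Inductive pushes X : forall Y, tup L X Y -> forall X', tup L X' Y -> lhom L X X' -> Prop :=
| pushes_nil : pushes tnil tnil (lid X)
| pushes_skip Y Z (w : lhom L Z Y) (t : tup L X Z) X' (t' : tup L X' Z) p :
    pushes t t' p -> pushes (tcons w t) (tcons w t') p
| pushes_last Y Z (e : lhom L Z Y) (p : lhom L X Z) :
    partial_perm p -> pushes (tone (e \oL p)) (tone e) p
| pushes_next Y Z Z' V (e : lhom L Z' Y) (p : lhom L Z Z') (w : lhom L V Z) (t : tup L X V) :
    partial_perm p -> pushes (tcons (e \oL p) (tcons w t)) (tcons e (tcons (p \oL w) t)) (lid X).

Lemma push_pushes X Y (t : tup L X Y) : pushes t (sm_tup (push c t)) (sm_map (push c t)).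
Proof.
elim: t => [|{}Y Z w t IH] /=; first exact: pushes_nil.
case: pselect => [_|_] /=; first exact: pushes_skip.
case: t w {IH} => [|{}Z V w' t] w /=; have pp := factorize_pp w; rewrite -{1}(fz_eq (factorize c w)).
  exact: pushes_last.
exact: pushes_next.
Qed.

(** The entry treated by [push] is the first one that is not essential. It lies after [t1], and if
    it is [w], only a partial permutation is split off. *)
Lemma push_prefix X Y Z W (t1 : tup L W Y) (w : lhom L Z W) (t2 : tup L X Z) :
  tall (fun X Y (w : lhom L X Y) => essential c w) t1 ->
  exists Z' (e : lhom L Z' W) (p : lhom L Z Z') (t2' : tup L (sm_mid (push c (tcat t1 (tcons w t2)))) Z'),
  [/\ sm_tup (push c (tcat t1 (tcons w t2))) = tcat t1 (tcons e t2'), partial_perm p & w = e \oL p].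
Proof.
elim: t1 w => [|Y' U v t1 IH] w /=.
  case: pselect => [ew|_] _ /=.
    exists Z, w, (lid Z), (sm_tup (push c t2)).
    by split=> //; [exact: partial_perm_lid | rewrite lcomp1r].
  exists (fz_mid (factorize c w)), (fz_ess (factorize c w)), (fz_perm (factorize c w)).
  case: t2 w => [|Y'' Z' w' t2] w /=.
    by exists tnil; split=> //; [exact: factorize_pp | rewrite fz_eq].
  by eexists; split; [reflexivity | exact: factorize_pp | rewrite fz_eq].
move=> [ev et1]; case: pselect => [_|//] /=.
have [Z' [e [p [t2' [-> pp wE]]]]] := IH w et1.
by exists Z', e, p, t2'.
Qed.

Lemma Phi_rec_coef k (t : utup L) (b : cell c) : Phi_rec c k t b <> 0 -> sval b = t \/
  exists2 k', k = k'.+1 & Phi_rec c k' (UTup (sm_tup (push c (uval t)))) b <> 0.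
Proof.
have gen (h : is_cell c t) :
    fgen (pl := @cplace S L c) (t := exist _ t h) (uone (place t)) b <> 0 -> sval b = t.
  have [<-//|ne] := pselect (exist _ t h = b).
  by rewrite [fgen _ _]dinj_neq.
case: k => [|k] /=; case: (pselect (is_cell c t)) => [h /gen|nc /=]; try by left.
  by case: (pselect (thas _ _)).
case: (pselect (thas _ _)) => [//|np /=]; rewrite fact_mod_coef => ne; right; exists k => // e.
by apply: ne; rewrite e ucomp0r.
Qed.

Lemma d_first_coef (u : utup L) (b : cell c) : (0 < usize u)%N ->
  Phi_lin c (d_first u) b <> 0 ->
  exists Z (w : lhom L Z [:: ucod u]) t i,
    uval u = tcons w t /\ Phi c (UTup (tproj i t)) b <> 0.
Proof.
case: u => X Y t0 u0; have [Z [w [t tE]]] := tsizeS u0; move: w t tE => /= w t tE; subst t0.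
rewrite /d_first /= Phi_lin_sum_coef => /sumr_neq0 [i _ ne]; exists Z, w, t, i; split=> //.
exact: (@Phi_lin_gen_coef _ _ _ (place (UTup (tcons w t))) (UTup (tproj i t)) _ b ne).
Qed.

End Push.

End StringTheory.

(** * Composite terms of strings and the effect of Phi on them *)

Section Faces.
Variables (S : Type) (Sg : signature S) (R : term Sg -> term Sg -> Prop).
Hypotheses (trsR : is_trs R) (termR : terminating R) (crR : church_rosser R).
Variable c : representatives (Syn R).
Implicit Types (X Y W : seq S) (t u : term Sg).

Notation F := (Syn (no_eq Sg)).
Notation L := (Syn R).
Notation rt := (clos_refl_trans _ (step R)).

Definition cell_entry X Y (w : lhom L X Y) : Prop := essential c w /\ ~ is_identity w.

Definition uterm (u : utup L) : term Sg := the_term (juxt (uval u)).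

Lemma juxt_cons X Y Z (w : lhom L Y Z) (t : tup L X Y) :
  juxt (tcons w t) = nf_mor w \oL juxt t.
Proof. by []. Qed.

Lemma juxt_nil X : juxt (@tnil S L X) = lid X.
Proof. by []. Qed.

Lemma juxt_tcat X Y Z (t1 : tup L Y Z) (t2 : tup L X Y) :
  juxt (tcat t1 t2) = juxt t1 \oL juxt t2.
Proof.
elim: t1 t2 => [|{}Z W w t1 IH] t2; first exact: esym (lcomp1l (l := F) _).
by rewrite [tcat _ _]/= !juxt_cons IH lcompA.
Qed.

Lemma juxt_tone X Y (w : lhom L X Y) : juxt (tone w) = nf_mor w.
Proof. by rewrite /tone juxt_cons juxt_nil lcomp1r. Qed.

Lemma essential_covers X Y (w : lhom L X Y) : essential c w -> covers X (raw (nf_mor w)).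
Proof. by move=> [ew _]; exact: efficient_covers. Qed.

Lemma juxt_covers X Y (t : tup L X Y) : tall cell_entry t -> covers X (raw (juxt t)).
Proof.
elim: t => [|{}Y Z w t IH] /=; first by move=> _; exact: covers_lid.
by move=> [[ew _] /IH ct]; apply: (@covers_comp _ _ _ _ _ (nf_mor w)) => //; exact: essential_covers.
Qed.

Lemma pushes_spec X Y (t : tup L X Y) X' (t' : tup L X' Y) (p : lhom L X X') :
  pushes t t' p -> [/\ partial_perm p, tsize t' = tsize t & juxt t = juxt t' \oL nf_mor p].
Proof.
elim=> {Y t X' t' p} [|Y Z w t X' t' p _ [pp sz ju]|Y Z e p pp|Y Z Z' V e p w t pp].
- by rewrite juxt_nil nf_mor_lid // lcomp1r; split=> //; exact: partial_perm_lid.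
- by split=> //; [rewrite /= sz | rewrite !juxt_cons ju lcompA].
- by rewrite !juxt_tone nf_mor_comp_pp.
split=> //; first exact: partial_perm_lid.
by rewrite nf_mor_lid // lcomp1r !juxt_cons nf_mor_comp_pp // nf_mor_pp_comp // !lcompA.
Qed.

(** All that is remembered of a cell [b] occurring in [Phi] of [t]. The last clause follows the
    entries: those before the first entry that may fail to belong to a cell stay, and that entry
    loses at most a partial permutation. For an inner face this locates the composed entry in
    [b]. *)
Definition pushed X (Y : S) (t : tup L X [:: Y]) (b : utup L) : Prop :=
  exists X' (t' : tup L X' [:: Y]) (p : lhom L X X'),
  [/\ b = UTup t', partial_perm p, tsize t' = tsize t, juxt t = juxt t' \oL nf_mor p &
   forall W Z (t1 : tup L W [:: Y]) (w : lhom L Z W) (t2 : tup L X Z),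
     t = tcat t1 (tcons w t2) -> tall cell_entry t1 ->
     exists Z' (e : lhom L Z' W) (t2' : tup L X' Z') (q : lhom L Z Z'),
       [/\ t' = tcat t1 (tcons e t2'), partial_perm q & w = e \oL q]].

Lemma Phi_pushed X (Y : S) (t : tup L X [:: Y]) (b : cell c) :
  Phi c (UTup t) b <> 0 -> pushed t (sval b).
Proof.
rewrite /Phi; move: (usize _) => k; elim: k X t => [|k IH] X t /Phi_rec_coef [bE|[k' //]].
1,2: rewrite bE; exists X, t, (lid X); split=> //; [exact: partial_perm_lid | | ].
1,3: by rewrite nf_mor_lid // lcomp1r.
1,2: move=> W Z t1 w t2 -> _; exists Z, w, t2, (lid Z).
1,2: by split=> //; [exact: partial_perm_lid | rewrite lcomp1r].
move=> [<-] /IH [X' [t' [p [-> pp sz ju pref]]]] {k'}.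
have [pp0 sz0 ju0] := pushes_spec (push_pushes c t).
exists X', t', (p \oL sm_map (push c t)); split=> //.
- exact: partial_perm_comp.
- by rewrite sz sz0.
- by rewrite ju0 ju nf_mor_comp_pp // lcompA.
move=> W Z t1 w t2 tE c1.
have [|Z' [e [q [t2' [pE qq wE]]]]] := @push_prefix _ _ c _ _ _ _ t1 w t2.
  by apply: tall_impl c1 => ? ? ? [].
move: t2' pE; rewrite -tE => t2' pE.
have [Z'' [e' [t2'' [q' [-> qq' eE]]]]] := pref _ _ _ _ _ pE c1.
exists Z'', e', t2'', (q' \oL q); split=> //; first exact: partial_perm_comp.
by rewrite wE eE lcompA.
Qed.

Lemma steps1_App f pf ts us : all2P rt ts us ->
  ts = us \/ steps1 R (App f (pf ++ ts)) (App f (pf ++ us)).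
Proof.
elim: ts us pf => [|t ts IH] [|u us] pf //=; first by left.
move=> [/steps_steps1 tu /IH h].
have {}tu : t = u \/ steps1 R (App f (pf ++ t :: ts)) (App f (pf ++ u :: ts)).
  case: tu => [|tu]; [by left | right].
  elim: tu => [v v' vv'|v v' v'' _ h1 _ h2]; last exact: (t_trans _ _ _ _ _ h1 h2).
  by apply: t_step; exact: step_ctx.
have [e|{}h] := h (rcons pf u).
  by subst us; case: tu => [->|?]; [left | right].
right; rewrite !cat_rcons in h; case: tu => [->//|tu].
exact: (t_trans _ _ _ _ _ tu h).
Qed.

Lemma subst_steps s s' t : (forall Z x, In (Z, x) (tvars t) -> rt (s Z x) (s' Z x)) ->
  subst s t = subst s' t \/ steps1 R (subst s t) (subst s' t).
Proof.
elim/term_ind': t => [X x|f ts IH] h; first by apply: steps_steps1; apply: h; left.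
suff h2 : all2P rt (map (subst s) ts) (map (subst s') ts).
  by have [e|] := @steps1_App f [::] _ _ h2; [left; rewrite /= e | right].
have {}IH t : In t ts -> rt (subst s t) (subst s' t).
  move=> tts; have [|->|ss'] := IH t tts.
  - by move=> Z x Zx; apply: h; apply/(In_tvars_App f); exists t.
  - exact: rt_refl.
  - exact: Operators_Properties.clos_t_clos_rt.
elim: ts IH {h} => [//|t ts IHts] IH /=; split; first by apply: IH; left.
by apply: IHts => u uts; apply: IH; right.
Qed.

Lemma the_term_inj X (Y : S) (f g : lhom F X [:: Y]) : the_term f = the_term g -> f = g.
Proof. by move=> e; apply: raw_inj; rewrite !raw_the_term e. Qed.

Lemma the_term_comp_subst X X' (Y : S) (f : lhom F X' [:: Y]) (g : lhom F X X') :
  exists2 s, wsubst s & forall h : lhom F X' [:: Y], the_term (h \oL g) = subst s (the_term h).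
Proof.
have [s ws sE] := tsubst_wsubst (raw_typed g); exists s => // h.
by rewrite the_term_comp sE //; have [] := the_term_typed h.
Qed.

Lemma emb_comp X X' (Y : S) (f : lhom F X' [:: Y]) (g : lhom F X X') :
  emb (the_term (f \oL g)) (the_term f).
Proof. by have [s ws ->] := the_term_comp_subst f g; exact: emb_subst. Qed.

(** The normal form of [x \oL y] is a reduct of the juxtaposition. As every variable of [juxt u1] is
    replaced by a component of it and [u1] covers its context, the prefix neither hides a rewriting
    nor a difference: equal composites can be cancelled. *)
Lemma merge_nf W V Z X (Y : S) (u1 : tup L W [:: Y]) (x : lhom L V W) (y : lhom L Z V)
    (u2 : tup L X Z) : tall cell_entry u1 ->
  nf_mor (x \oL y) = nf_mor x \oL nf_mor y \/
  steps1 R (the_term (juxt (tcat u1 (tcons x (tcons y u2)))))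
           (the_term (juxt (tcat u1 (tcons (x \oL y) u2)))).
Proof.
move=> c1; pose A := juxt u1 \oL (nf_mor x \oL nf_mor y).
pose B := juxt u1 \oL nf_mor (x \oL y).
have [] : the_term A = the_term B \/ steps1 R (the_term A) (the_term B).
- rewrite !the_term_comp; apply: subst_steps => U i Ui.
  have [_ /(_ _ _ Ui) iU] := the_term_typed (juxt u1).
  have [a [ia _ _]] := onth_raw (nf_mor x \oL nf_mor y) iU.
  have [b [ib _ _]] := onth_raw (nf_mor (x \oL y)) iU.
  rewrite (@onth_nth _ _ _ _ _ ia) (@onth_nth _ _ _ _ _ ib).
  have /all2P_onth [_ h] := nf_mor_comp_steps trsR termR crR x y.
  exact: h ia ib.
- by move=> /the_term_inj /comp_mono -> //; [left | exact: juxt_covers].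
move=> AB; right; rewrite !juxt_tcat !juxt_cons.
have [s ws sE] := the_term_comp_subst A (juxt u2).
have -> : juxt u1 \oL (nf_mor x \oL (nf_mor y \oL juxt u2)) = A \oL juxt u2 by rewrite /A !lcompA.
have -> : juxt u1 \oL (nf_mor (x \oL y) \oL juxt u2) = B \oL juxt u2 by rewrite /B !lcompA.
by rewrite !sE; exact: steps1_subst.
Qed.

Lemma not_identity_pp X Y (w : lhom L X Y) : cell_entry w -> ~ partial_perm w.
Proof. by move=> [ew nw] /(essential_partial_perm ew). Qed.

(** A variable would be a projection, hence a partial permutation. *)
Lemma cell_entry_App X (Y : S) (w : lhom L X [:: Y]) : cell_entry w ->
  exists f ts, the_term (nf_mor w) = App f ts.
Proof.
move=> /not_identity_pp; case e : (the_term (nf_mor w)) => [Z x|f ts] h; last by exists f, ts.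
case: h; apply: ppvars_partial_perm => //; rewrite raw_the_term e.
have [h _] := the_term_typed (nf_mor w); rewrite e /= in h; subst Z.
by exists (fun=> x); split=> [[|i] U //=|[|i] [|j]] //; [case=> -> | rewrite onth0n].
Qed.

Lemma uterm_covers (u : utup L) i (Z : S) : is_cell c u -> onth (udom u) i = Some Z ->
  In (Z, i) (tvars (uterm u)).
Proof.
move=> cu iZ; have [t] := juxt_covers cu iZ.
by rewrite raw_the_term => -[<-|//].
Qed.
End Faces.

(** * Comparison of a cell with the cells occurring in its faces *)

Section BarFaces.
Variables (S : Type) (Sg : signature S) (R : term Sg -> term Sg -> Prop).
Hypotheses (trsR : is_trs R) (termR : terminating R) (crR : church_rosser R).
Variable c : representatives (Syn R).
Implicit Types (X Y W : seq S) (t : term Sg).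

Notation F := (Syn (no_eq Sg)).
Notation L := (Syn R).
Notation cell_entry := (@cell_entry S Sg R c).

Lemma emb_size t (u : term Sg) : emb t u -> (tmsize u <= tmsize t)%N.
Proof.
move=> [p [s [_ /subterm_size [h _]]]]; apply: leq_trans h.
by have [] := tmsize_subst s u.
Qed.

Lemma pushed_emb X (Y : S) (t : tup L X [:: Y]) b :
  pushed c t b -> emb (the_term (juxt t)) (uterm b).
Proof. by move=> [X' [t' [p [-> _ _ -> _]]]]; exact: emb_comp. Qed.

(** An injective renaming can be undone, so each of the two composites is a substitution instance of
    the other. *)
Lemma pushed_size X (Y : S) (t : tup L X [:: Y]) b :
  pushed c t b -> tmsize (uterm b) = tmsize (the_term (juxt t)).
Proof.
move=> [X' [t' [p [-> pp _ ju _]]]]; apply/eqP; rewrite eqn_leq; apply/andP; split.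
  by rewrite ju; apply: emb_size; exact: emb_comp.
rewrite ju the_term_comp /uterm /=; have [_ tX] := the_term_typed (juxt t').
have [s ws sE] := ppvars_inverse (partial_perm_ppvars trsR termR crR pp).
rewrite -{2}(sE _ tX).
by have [] := tmsize_subst s (tsubst (raw (nf_mor p)) (the_term (juxt t'))).
Qed.

Lemma the_term_raw X (Y : S) (f : lhom F X [:: Y]) t : raw f = [:: t] -> the_term f = t.
Proof. by rewrite raw_the_term => -[]. Qed.

Lemma the_term_tproj X Y (t : tup L X Y) (i : 'I_(size Y)) a :
  onth (raw (juxt t)) i = Some a -> the_term (juxt (tproj i t)) = a.
Proof.
case: t i => [|{}Y Z w t] i ia; apply: the_term_raw.
  move: ia; rewrite juxt_nil raw_lid (onth_ctx_vars Sg (onth_tnth i)) => -[<-].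
  by rewrite [tproj _ _]/= juxt_tone; exact: raw_nf_proj.
have [v [iv _ _]] := onth_raw (nf_mor w) (onth_tnth i).
rewrite [tproj _ _]/= juxt_cons raw_comp (raw_nf_proj_comp trsR termR crR iv) /=.
by move: ia; rewrite juxt_cons raw_comp onth_map iv => -[<-].
Qed.

(** The variable i occurs in the term of [w], which is not itself a variable. The i-th component of
    the remaining string therefore sits in the composite at a position other than the root. *)
Lemma face_first (u : utup L) (b : cell c) : is_cell c u -> (0 < usize u)%N ->
  Phi_lin c (d_first u) b <> 0 ->
  emb (uterm u) (uterm (sval b)) /\ (tmsize (uterm (sval b)) < tmsize (uterm u))%N.
Proof.
move=> cu u0 ne0; have [Z [w [t' [i [tE ne]]]]] := d_first_coef u0 ne0.
move: w t' i tE ne {ne0}; case: u cu u0 => X Y t ct _ /= w t' i tE ne; subst t.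
have [ew ct'] : cell_entry w /\ tall cell_entry t' := ct.
have pu := Phi_pushed trsR termR crR ne.
have [f [ts wE]] := cell_entry_App trsR termR crR ew.
have [t] := essential_covers trsR termR crR ew.1 (onth_tnth i).
rewrite raw_the_term => -[<-|//] wi; have [p pw] := subterm_var wi.
have [a [ia _ _]] := onth_raw (juxt t') (onth_tnth i).
have sub : subterm p (uterm (UTup (tcons (w : lhom L Z [:: Y]) t'))) = Some (the_term (juxt (tproj i t'))).
  rewrite (the_term_tproj ia) /uterm [uval _]/= juxt_cons the_term_comp.
  by rewrite (subterm_subst _ pw) /= (@onth_nth _ _ _ _ _ ia).
split; first exact: emb_trans (emb_subterm sub) (pushed_emb pu).
rewrite (pushed_size pu); have [_] := subterm_size sub; apply=> p0.
by subst p; move: pw; rewrite wE.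
Qed.

Lemma Phi_cell_coef (u : utup L) (b : cell c) : is_cell c u -> Phi c u b <> 0 -> sval b = u.
Proof.
move=> h; rewrite (Phi_cell h); have [<-//|ne] := pselect (exist _ u h = b).
by rewrite [fgen _ _]dinj_neq.
Qed.

(** Distinct context variables use up distinct occurrences in [t]. This bounds the growth of
    contexts along a path. *)
Lemma covers_tmsize X t : covers X [:: t] -> (size X <= tmsize t)%N.
Proof.
move=> ct; apply: leq_trans (size_tvars t).
rewrite -(size_map snd) -{1}(size_iota 0 (size X)); apply: uniq_leq_size; first exact: iota_uniq.
move=> i; rewrite mem_iota /= add0n -onthTE; case iX: (onth X i) => [Z|//] _.
have [_ [<-|//]] := ct _ _ iX.
elim: (tvars t) => [//|v vs IH] /= [->|/IH h]; rewrite inE ?eqxx //.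
by rewrite h orbT.
Qed.

(** Since [f] covers [X], its variables define a surjection from the indices of [Y] onto those of
    [X]; the inequality of lengths makes it injective. *)
Lemma ppvars_of_vars X Y (f : lhom F X Y) : covers X (raw f) -> (size Y <= size X)%N ->
  (forall t, In t (raw f) -> tmsize t = 1%N) -> ppvars Y (raw f).
Proof.
move=> cf YX vf.
pose v i := if onth (raw f) i is Some (Var _ x) then x else 0%N.
have vE i (Z : S) : onth Y i = Some Z -> onth (raw f) i = Some (Var Sg Z (v i)).
  move=> iZ; have [t [it tZ _]] := onth_raw f iZ; rewrite /v it.
  by have [W [x tE]] := tmsize1 (vf _ (onth_In it)); subst t; rewrite -tZ.
exists v; split=> // i j iY jY.
suff /mkseq_uniqP h : uniq (mkseq v (size Y)) by apply: h; rewrite inE.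
apply: (@leq_size_uniq _ (iota 0 (size X))); rewrite ?iota_uniq ?size_mkseq ?size_iota //.
move=> k; rewrite mem_iota /= add0n -onthTE; case kX: (onth X k) => [Z|//] _.
have [t tf Zk] := cf _ _ kX; have [l lt] := In_onth tf; have [U lU] := onth_raw_inv lt.
apply/mapP; exists l; first by rewrite mem_iota /= add0n -onthTE lU.
by move: lt; rewrite (vE _ _ lU) => -[tE]; move: Zk; rewrite -tE => -[[]|].
Qed.

(** If removing the last entry [w] does not shrink the term, then [w] consists of variables. Not
    being a partial permutation, it repeats one of them; as it covers its domain, its codomain is
    longer. *)
Lemma face_last (u : utup L) (b : cell c) : is_cell c u -> (0 < usize u)%N ->
  Phi_lin c (d_last u) b <> 0 ->
  emb (uterm u) (uterm (sval b)) /\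
  ((tmsize (uterm (sval b)) < tmsize (uterm u))%N \/
   tmsize (uterm (sval b)) = tmsize (uterm u) /\ (size (udom u) < size (udom (sval b)))%N).
Proof.
move=> cu u0 ne0; have uE := tinitP u0; have := d_last_coef ne0; move=> {ne0}.
case: u cu u0 uE => X Y t; rewrite /is_cell /usize /=.
case: (tinit t) => W t' w tE' /= ct t0 tE; subst t.
have [ct' [ew _]] : tall cell_entry t' /\ tall cell_entry (tone w) by apply/tall_tcat.
move=> ne; have -> : sval b = UTup t' by exact: (@Phi_cell_coef (UTup t') b ct' ne).
rewrite /uterm [uval _]/=.
have e : juxt (tcat t' (tone w)) = juxt t' \oL nf_mor w by rewrite juxt_tcat juxt_tone.
split; first by rewrite e; exact: emb_comp.
rewrite [uval _]/= e the_term_comp /tsubst; set s := fun _ _ => _.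
have [le eq] := tmsize_subst s (the_term (juxt t')).
have [lt|ge] := ltnP (tmsize (the_term (juxt t'))) (tmsize (subst s (the_term (juxt t')))); first by left.
right; have sz : tmsize (subst s (the_term (juxt t'))) = tmsize (the_term (juxt t')) by lia.
split=> //=; rewrite ltnNge; apply/negP => WX; apply: (not_identity_pp ew).
apply: ppvars_partial_perm => //; apply: ppvars_of_vars => //.
  exact: essential_covers ew.1.
move=> a aw; have [i ia] := In_onth aw; have [Z iZ] := onth_raw_inv ia.
have [t1] := juxt_covers trsR termR crR ct' iZ; rewrite raw_the_term => -[<-|//] Zi.
by have := eq sz _ _ Zi; rewrite /s (@onth_nth _ _ _ _ _ ia).
Qed.

Lemma face_mid X (Y : S) (t : tup L X [:: Y]) j (b : cell c) : (0 < j < tsize t)%N ->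
  Phi_lin c (d_mid j (UTup t)) b <> 0 ->
  exists Z V W (u1 : tup L W [:: Y]) (x : lhom L V W) (y : lhom L Z V) (u2 : tup L X Z),
    [/\ t = tcat u1 (tcons x (tcons y u2)), (tsize u1).+1 = j &
        pushed c (tcat u1 (tcons (x \oL y) u2)) (sval b)].
Proof.
move=> /andP[j0 jt] ne0; have := d_mid_coef ne0; move=> {ne0}.
have [|W [u1 [u2 [tE sz]]]] := @tup_split _ _ _ _ t j.-1; first by lia.
subst t; have [|V [x [u3 u2E]]] := @tsizeS _ _ _ _ u2.
  by move: jt; rewrite tsize_tcat; lia.
subst u2; have [|Z [y [u4 u3E]]] := @tsizeS _ _ _ _ u3.
  by move: jt; rewrite tsize_tcat /=; lia.
subst u3; rewrite [uval _]/= -sz tmerge_tcat => ne; have pu := Phi_pushed trsR termR crR ne.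
by exists Z, V, W, u1, x, y, u4; split=> //; lia.
Qed.

End BarFaces.

(** * Positions and unifiers *)

Lemma NoDup_onth (T : Type) (s : seq T) i j x : NoDup s ->
  onth s i = Some x -> onth s j = Some x -> i = j.
Proof.
elim: s i j => [|y s IH] [|i] [|j] //= nd; inversion nd as [|y' s' yns nds]; subst.
- by move=> [e] h; have := onth_In h; rewrite -e.
- by move=> h [e]; case: yns; rewrite e; exact: onth_In h.
- by move=> ix jx; congr S; exact: IH.
Qed.

Section Positions.
Variables (S : Type) (Sg : signature S) (R : term Sg -> term Sg -> Prop).
Hypotheses (trsR : is_trs R) (termR : terminating R) (crR : church_rosser R).
Variable lt : term Sg -> term Sg -> Prop.
Hypothesis hlt : lhs_order R lt.
Implicit Types (X Y : seq S) (t : term Sg) (b : rpos Sg).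

Notation F := (Syn (no_eq Sg)).
Notation L := (Syn R).

Lemma rpos_lt_irr b : lhs R b.2 -> ~ rpos_lt lt b b.
Proof. by move=> lb [|[_ /(lo_irr hlt lb)]] //; rewrite ltxx. Qed.

Lemma rpos_lt_trans b1 b2 b3 : lhs R b1.2 -> lhs R b2.2 -> lhs R b3.2 ->
  rpos_lt lt b1 b2 -> rpos_lt lt b2 b3 -> rpos_lt lt b1 b3.
Proof.
move=> l1 l2 l3 [h1|[e1 h1]] [h2|[e2 h2]].
- by left; exact: lt_trans h2.
- by left; rewrite -e2.
- by left; rewrite e1.
- by right; split; [rewrite e1 | exact: (lo_trans hlt) h2].
Qed.

Lemma is_max_uniq t o o' : is_max R lt t o -> is_max R lt t o' -> o = o'.
Proof.
case: o o' => [b|] [b'|] //=;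
  [|by move=> [? _] h; case: (h b) | by move=> h [/h]].
move=> [Pb mb] [Pb' mb']; congr Some.
have [//|bb'] := mb' _ Pb; have [//|b'b] := mb _ Pb'.
have [lb _] := Pb; have [lb' _] := Pb'.
by case: (rpos_lt_irr lb); exact: rpos_lt_trans b'b.
Qed.
Lemma in_P_subst s t b : wsubst s -> in_P R t b -> in_P R (subst s t) b.
Proof.
move=> ws [lb [s' [ws' tb]]]; split=> //; exists (fun Z x => subst s (s' Z x)).
by split; [exact: wsubst_comp | rewrite (subterm_subst s tb) subst_subst].
Qed.

Lemma in_P_comp X X' (Y : S) (f : lhom F X' [:: Y]) (g : lhom F X X') b :
  in_P R (the_term f) b -> in_P R (the_term (f \oL g)) b.
Proof. by have [s ws ->] := the_term_comp_subst f g; exact: in_P_subst. Qed.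

(** Variables go to variables, so the renaming creates no positions, and undoing it turns an
    instance of a left-hand side into an instance of the same one. *)
Lemma in_P_comp_pp X X' (Y : S) (f : lhom F X' [:: Y]) (p : lhom L X X') b : partial_perm p ->
  in_P R (the_term (f \oL nf_mor p)) b <-> in_P R (the_term f) b.
Proof.
move=> /(partial_perm_ppvars trsR termR crR) pp; split=> [[lb [s [ws tb]]]|]; last exact: in_P_comp.
split=> //; have [s' ws' sE] := ppvars_inverse pp; have [_ fX] := the_term_typed f.
rewrite the_term_comp in tb.
have [v pv e] := subterm_subst_inv (ppvars_Var pp fX) tb.
exists (fun Z x => subst s' (s Z x)); split; first exact: wsubst_comp.
rewrite pv -subst_subst e; congr Some; rewrite -[in LHS](sE v) // => Z x Zx.
by apply: fX; exact: subterm_vars pv Zx.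
Qed.

Lemma is_max_comp_pp X X' (Y : S) (f : lhom F X' [:: Y]) (p : lhom L X X') o : partial_perm p ->
  is_max R lt (the_term (f \oL nf_mor p)) o <-> is_max R lt (the_term f) o.
Proof.
move=> pp; case: o => [b|] /=; split.
- by move=> [/(in_P_comp_pp _ _ pp) ? h]; split=> // b' /(in_P_comp_pp _ _ pp)/h.
- by move=> [? h]; split=> [|b']; rewrite in_P_comp_pp //; exact: h.
- by move=> h b' /(in_P_comp_pp _ _ pp)/h.
- by move=> h b'; rewrite in_P_comp_pp //; exact: h.
Qed.

Lemma irreducible_in_P t b : irreducible R t -> ~ in_P R t b.
Proof.
move=> it [[r lr] [s [ws tb]]]; apply: it.
by have [u tu _] := step_subterm tb (step_root lr ws); exists u.
Qed.

Lemma is_max_nf X (Y : S) (w : lhom L X [:: Y]) : is_max R lt (the_term (nf_mor w)) None.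
Proof.
move=> b; apply: irreducible_in_P; apply: (@raw_nf_irr _ _ _ trsR termR _ _ w).
by rewrite raw_the_term; left.
Qed.

Lemma is_max_sub t (u : term Sg) o : (forall b, in_P R t b -> in_P R u b) ->
  is_max R lt u o -> (forall b, o = Some b -> in_P R t b) -> is_max R lt t o.
Proof.
case: o => [b|] tu /= => [[ub mb] /(_ b erefl) tb|h _ b /tu /h //].
by split=> // b' /tu /mb.
Qed.

Section Unifiers.
Variables (cF : representatives F) (strict : bool).

(* The first component of a unifier of (t|_p, l) determines the second one. *)
Definition unifies X (m : term Sg) (l : term Sg) W (q : lhom F W X) : Prop :=
  exists2 s, wsubst s & subst s l = tsubst (raw q) m.

(** As [G] lists the variables of [l] without repetition, a morphism into that context and a
    substitution on the variables of [l] are the same data. *)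
Lemma unifiesP X (V : S) (m : lhom F X [:: V]) (G : seq (var S))
    (ml : lhom F (unzip1 G) [:: V]) l W (q : lhom F W X) :
  NoDup G -> (forall v, In v G <-> In v (tvars l)) ->
  tsubst [seq Var Sg v.1 v.2 | v <- G] (the_term ml) = l ->
  (exists q', m \oL q = ml \oL q') <-> unifies (the_term m) l q.
Proof.
move=> nd Gl mlE; have [_ mlG] := the_term_typed ml.
have GE i (Z : S) : onth (unzip1 G) i = Some Z -> exists x, onth G i = Some (Z, x).
  by rewrite /unzip1 onth_map; case: (onth G i) => [[Z' x]|] //= [->]; exists x.
have lE s : subst s l = subst (fun Z i => if onth G i is Some v then s v.1 v.2 else s Z i) (the_term ml).
  rewrite -mlE /tsubst subst_subst; apply: subst_ext => Z i /mlG /GE [x ix].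
  have ix' : onth [seq Var Sg v.1 v.2 | v <- G] i = Some (Var Sg Z x) by rewrite onth_map ix.
  by rewrite (@onth_nth _ _ _ _ _ ix') ix.
split=> [[q' e]|[s ws sl]].
  pose P (Z : S) x i := onth G i = Some (Z, x).
  exists (fun Z x => if pselect (exists i, P Z x i) is left h
                     then nth (Var Sg Z x) (raw q') (projT1 (cid h)) else Var Sg Z x).
    move=> Z x; case: pselect => [h|//]; case: (cid h) => i /= Gi.
    have iZ : onth (unzip1 G) i = Some Z by rewrite /unzip1 onth_map Gi.
    by have [t [it tZ _]] := onth_raw q' iZ; rewrite (@onth_nth _ _ _ _ _ it).
  rewrite -the_term_comp e the_term_comp lE; apply: subst_ext => Z i /mlG iZ.
  have [x ix] := GE _ _ iZ; rewrite ix /=; case: pselect => [h|[]]; last by exists i.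
  case: (cid h) => j /= jx; have -> : j = i by exact: NoDup_onth nd jx ix.
  by have [t [it _ _]] := onth_raw q' iZ; rewrite !(@onth_nth _ _ _ _ _ it).
(* Each variable in [G] occurs in [l], so the variables of its image occur in the composite of [m]
   and [q] and lie in the context W. *)
have ty : typed W (unzip1 G) [seq s v.1 v.2 | v <- G].
  apply/all2P_onth; rewrite !size_map; split=> // i t Z.
  rewrite onth_map => + /GE [x ix]; rewrite ix /= => -[<-]; split; first exact: ws.
  move=> Z' x' Zx'; have [_] := the_term_typed (m \oL q); apply.
  rewrite the_term_comp -sl; apply: (In_tvars_subst _ Zx').
  by apply/Gl; exact: onth_In ix.
exists (scls (no_eq Sg) (exist _ _ ty)); apply: the_term_inj.
rewrite !the_term_comp raw_scls -sl lE /=; apply: subst_ext => Z i /mlG /GE [x ix].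
have ix' : onth [seq s v.1 v.2 | v <- G] i = Some (s Z x) by rewrite onth_map ix.
by rewrite ix (@onth_nth _ _ _ _ _ ix').
Qed.

Lemma mgu_at_universal X (Y : S) Z (t : lhom F X [:: Y]) p l (s : lhom F Z X) :
  mgu_at cF strict t p l s -> exists m, [/\ subterm p (the_term t) = Some m,
    in_ctx X m, unifies m l s &
    forall W (q : lhom F W X), unifies m l q -> exists u, q = s \oL u].
Proof.
move=> [V [m [G [ml [s' [sub [nd Gl] mlE U]]]]]]; exists (the_term m).
have [un univ] : is_universal_unifier m ml s s' by case: (strict) U => // -[].
split=> //; first by have [] := the_term_typed m.
  by apply/(@unifiesP _ _ m G ml l _ s nd Gl mlE); exists s'.
move=> W q /(@unifiesP _ _ m G ml l _ q nd Gl mlE) [q' /univ [u [-> _]]]; by exists u.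
Qed.

End Unifiers.

Section Universal.
Variable c : representatives L.

(** A component of [v] becomes a variable after substitution, so it is a variable; components with
    the same variable would be sent to the same projection. *)
Lemma section_ppvars X Y (v : lhom F Y X) (u : lhom F X Y) : v \oL u = lid X -> ppvars X (raw v).
Proof.
move=> vu; have e i Z : onth X i = Some Z -> exists x, onth (raw v) i = Some (Var Sg Z x) /\
    tsubst (raw u) (Var Sg Z x) = Var Sg Z i.
  move=> iZ; have [t [it tZ _]] := onth_raw v iZ.
  have := congr1 (fun f => onth (raw f) i) vu; rewrite /= raw_comp onth_map it raw_lid.
  rewrite (onth_ctx_vars Sg iZ) => -[]; case: t it tZ => [Z' x|//] it /= ZZ' tE.
  by subst Z'; exists x.
exists (fun i => if onth (raw v) i is Some (Var _ x) then x else 0%N); split.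
  by move=> i Z /e [x [-> _]].
move=> i j; rewrite -!onthTE; case iX: (onth X i) => [Z|//] _; case jX: (onth X j) => [Z'|//] _.
have [x [-> xE]] := e _ _ iX; have [y [-> yE]] := e _ _ jX => xy; subst y.
(* Inside the range both projections are the same component of [u]; outside it the default values
   show that i and j are both x. *)
move: xE yE; rewrite /tsubst /=; case: (ltnP x (size (raw u))) => xu.
  by rewrite (set_nth_default (Var Sg Z x) (Var Sg Z' x) xu) => -> [].
by rewrite !nth_default // => -[->] [->].
Qed.

Lemma ppvars_size X Y (f : lhom F X Y) : ppvars Y (raw f) -> (size Y <= size X)%N.
Proof.
move=> [u [uE uinj]]; have : uniq (mkseq u (size Y)) by apply/mkseq_uniqP => i j; rewrite !inE; exact: uinj.
rewrite -{2}(size_mkseq u (size Y)) -(size_iota 0 (size X)) => /uniq_leq_size; apply=> k.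
move=> /mapP [i]; rewrite !mem_iota /= !add0n -onthTE => + ->; case iY: (onth Y i) => [Z|//] _.
have [t [it _ tX]] := onth_raw f iY; move: it; rewrite (uE _ _ iY) => -[tE].
by rewrite -onthTE (tX Z (u i)) // -tE; left.
Qed.

Lemma section_identity X Y (w : lhom L Y X) (u : lhom F X Y) :
  essential c w -> nf_mor w \oL u = lid X -> is_identity w.
Proof.
move=> ew wu; apply: (essential_partial_perm ew); apply: (ppvars_partial_perm trsR termR crR).
exact: section_ppvars wu.
Qed.

(** Each of the two factors through the other, and by cancellation [u] and [v] are mutually inverse.
    They are then permutations, so [w1] and [w2] represent the same class. *)
Lemma universal_uniq X Z1 Z2 (w1 : lhom L Z1 X) (w2 : lhom L Z2 X) u v :
  essential c w1 -> essential c w2 -> nf_mor w1 = nf_mor w2 \oL u -> nf_mor w2 = nf_mor w1 \oL v ->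
  mk_to w1 = mk_to w2.
Proof.
move=> e1 e2 w1E w2E; have c1 := essential_covers trsR termR crR e1.
have c2 := essential_covers trsR termR crR e2.
have vu : v \oL u = lid Z1 by apply: (comp_mono c1); rewrite lcompA -w2E -w1E lcomp1r.
have uv : u \oL v = lid Z2 by apply: (comp_mono c2); rewrite lcompA -w1E -w2E lcomp1r.
have pu := section_ppvars uv; have pv := section_ppvars vu.
pose p : lhom L Z1 Z2 := scls R (srep u).
have pE : nf_mor p = u.
  rewrite (@nf_mor_cls _ _ _ trsR termR crR _ _ p (srep u)) //; first exact: srepK.
  move=> t tu; have [i it] := In_onth tu; have [V iV] := onth_raw_inv (f := u) it.
  have [h [hE _]] := pu; move: (hE _ _ iV); rewrite /raw it => -[->]; exact: irreducible_Var.
have ppp : partial_perm p by apply: (ppvars_partial_perm trsR termR crR); rewrite pE.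
have [_ <-] := e1; have [_ <-] := e2; apply: rep_eq; exists p; split=> /=.
  by split=> //; apply/eqP; rewrite eqn_leq (ppvars_size pv) (ppvars_size pu).
by apply: (nf_mor_inj trsR termR); rewrite nf_mor_comp_pp // pE.
Qed.

(** A term f(x_1, ..., x_n) in distinct variables is universal among the terms with head f. This
    puts the case of the first entry on the same footing as that of most general unifiers. *)
Lemma in_signature_universal X (Y : S) (w : lhom L X [:: Y]) : essential c w -> in_signature w ->
  exists f ts, the_term (nf_mor w) = App f ts /\
  forall W (q : lhom F W [:: Y]) us, the_term q = App f us -> exists u, q = nf_mor w \oL u.
Proof.
move=> ew [f [xs [nd wE]]]; exists f; eexists; split; first exact: wE.
move=> W q us qE; have [wY wX] := the_term_typed (nf_mor w); have [qY qW] := the_term_typed q.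
rewrite wE /= in wY wX; rewrite qE /= in qY qW.
have [_ /all2P_onth [sxs hxs]] := wY; have [_ /all2P_onth [sus hus]] := qY.
rewrite size_map in sxs.
have xsX k (Z : S) i : onth xs k = Some (Z, i) -> onth X i = Some Z.
  move=> kZ; apply: wX; apply/In_flatten; exists [:: (Z, i)]; last by left.
  apply/In_map; exists (Var Sg Z i) => //; apply/In_map; exists (Z, i) => //; exact: onth_In kZ.
have Xxs i (Z : S) : onth X i = Some Z -> exists k, onth xs k = Some (Z, i).
  move=> iZ; have [t] := essential_covers trsR termR crR ew iZ.
  rewrite raw_the_term wE => -[<-|//] /In_tvars_App [v /In_map [[Z' x] vxs ->]] /= [[<- <-]|//].
  exact: In_onth.
pose P (Z : S) i k := onth xs k = Some (Z, i).
(* The variables in [xs] may be listed in another order than in the context, so the argument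
   replacing variable i is found through its place in [xs]. *)
pose s (Z : S) i := if pselect (exists k, P Z i k) is left h
                    then nth (Var Sg Z i) us (projT1 (cid h)) else Var Sg Z i.
have sE k (Z : S) i : onth xs k = Some (Z, i) -> onth us k = Some (s Z i).
  move=> kZ; rewrite /s; case: pselect => [h|[]]; last by exists k.
  case: (cid h) => k' /= k'Z; rewrite (NoDup_onth nd k'Z kZ).
  have : onth us k by rewrite onthTE sus -sxs -onthTE kZ.
  by case e: (onth us k) => [t|//] _; rewrite (@onth_nth _ _ _ _ _ e).
have ctxE i (Z : S) : onth X i = Some Z ->
    onth [seq s v.1 v.2 | v <- zip X (iota 0 (size X))] i = Some (s Z i).
  move=> /(onth_ctx_vars Sg); rewrite !onth_map.
  by case: (onth _ _) => [[Z' i']|] //= [-> ->].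
have ty : typed W X [seq s v.1 v.2 | v <- zip X (iota 0 (size X))].
  apply/all2P_onth; rewrite size_map size_zip size_iota minnn; split=> // i t Z it iZ.
  move: it; rewrite (ctxE _ _ iZ) => -[<-]; have [k kZ] := Xxs _ _ iZ.
  have ks := sE _ _ _ kZ; have : onth (op_dom f) k by rewrite onthTE -sxs -onthTE kZ.
  case kD: (onth _ k) => [D|//] _.
  have : has_sort (Var Sg Z i) D by apply: hxs kD; rewrite onth_map kZ.
  rewrite /= => ZD; subst D; split; first exact: hus ks kD.
  move=> V x Vx; apply: qW; apply/In_flatten; exists (tvars (s Z i)) => //.
  by apply/In_map; exists (s Z i) => //; exact: onth_In ks.
exists (scls (no_eq Sg) (exist _ _ ty)); apply: the_term_inj.
rewrite the_term_comp raw_scls wE qE /tsubst /=; congr App; rewrite -map_comp.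
apply: eq_from_onth => k; rewrite onth_map.
case kxs: (onth xs k) => [[Z i]|] /=.
  rewrite (sE _ _ _ kxs); congr Some.
  by rewrite (@onth_nth _ _ _ _ _ (ctxE _ _ (xsX _ _ _ kxs))).
by rewrite onth_default // sus -sxs leqNgt -onthTE kxs.
Qed.

End Universal.

End Positions.

(** * The matching *)

Section Prefixes.
Variables (S : Type) (L : lawvere S).

Lemma tcat_prefix X Y W V (t1 : tup L W Y) (t2 : tup L X W) (s1 : tup L V Y) (s2 : tup L X V) :
  tcat t1 t2 = tcat s1 s2 -> (tsize t1 <= tsize s1)%N ->
  exists r, s1 = tcat t1 r /\ t2 = tcat r s2.
Proof.
move=> e le; have [U [s3 [s4 [sE sz]]]] := tup_split le; subst s1.
rewrite -tcatA in e; have h := tcat_inj e (esym sz); have /= ? := congr1 tag h; subst U.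
by have [<- ->] := existT_inj h; exists s4.
Qed.

Lemma tone_prefix X Y W V (t : tup L V Y) (w : lhom L X V) (t1 : tup L W Y) (t2 : tup L X W) :
  tcat t (tone w) = tcat t1 t2 ->
  existT (fun X => tup L X Y) W t1 = existT _ X (tcat t (tone w)) \/
  exists t2', t = tcat t1 t2'.
Proof.
have [t20|t2S] := posnP (tsize t2).
  have e := tsize0 t20; have /= ? := congr1 tag e; subst W.
  by have -> := existT_inj e; rewrite tcat_nil => ->; left.
have [U [t2' [w' ->]]] := tup_last t2S; rewrite tcatA => e; right.
have sz : tsize t = tsize (tcat t1 t2').
  by have := congr1 (@tsize _ _ _ _) e; rewrite !tsize_tcat /=; lia.
have h := tcat_inj e sz; have /= ? := congr1 tag h; subst U.
by have [-> _] := existT_inj h; exists t2'.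
Qed.

Lemma matched_eq X Y Z1 Z2 W1 W2 (t1 : tup L W1 Y) (t2 : tup L W2 Y)
    (w1 : lhom L Z1 W1) (w2 : lhom L Z2 W2) (s1 : tup L X Z1) (s2 : tup L X Z2) :
  tcat t1 (tcons w1 s1) = tcat t2 (tcons w2 s2) -> tsize t1 = tsize t2 ->
  existT (fun W => {Z : seq S & (tup L W Y * (lhom L Z W * tup L X Z))%type}) W1
    (existT _ Z1 (t1, (w1, s1))) = existT _ W2 (existT _ Z2 (t2, (w2, s2))).
Proof.
move=> e sz; have h := tcat_inj e sz; have /= ? := congr1 tag h; subst W2.
have e1 := congr1 fst (existT_inj h); have e2 := congr1 snd (existT_inj h); move: e1 e2 => /=.
by move=> <- /tcons_inj h'; have /= ? := congr1 tag h'; subst Z2; have [<- <-] := existT_inj h'.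
Qed.

End Prefixes.

Section Matching.
Variables (S : Type) (Sg : signature S) (R : term Sg -> term Sg -> Prop).
Hypotheses (trsR : is_trs R) (termR : terminating R) (crR : church_rosser R).
Variable lt : term Sg -> term Sg -> Prop.
Hypothesis hlt : lhs_order R lt.
Variables (cF : representatives (Syn (no_eq Sg))) (c : representatives (Syn R)).
Variable strict : bool.
Implicit Types (X : seq S) (Y : S).

Notation F := (Syn (no_eq Sg)).
Notation L := (Syn R).
Notation cell_entry := (@cell_entry S Sg R c).
Notation chain := (@is_chain S Sg R lt cF strict _ _).
Notation maxP t := (is_max R lt (the_term (juxt t))).
Notation ell := (@is_ell S Sg R lt cF strict).

Lemma chain_prefix X Y W (t1 : tup L W [:: Y]) (t2 : tup L X W) : chain (tcat t1 t2) -> chain t1.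
Proof.
move e : (tcat t1 t2) => t ct; elim: ct W t1 t2 e => {X t}.
- move=> W t1 t2 /(congr1 (@tsize _ _ _ _)); rewrite tsize_tcat /= => sz.
  have e : tsize t1 = 0%N by lia.
  have {}e := tsize0 e; have /= ? := congr1 tag e; subst W; rewrite (existT_inj e); exact: chain0.
- move=> X w sw W t1 t2 /esym /(@tone_prefix _ _ _ _ _ _ tnil) [e|[t2' /(congr1 (@tsize _ _ _ _))]].
    have /= ? := congr1 tag e; subst W; rewrite (existT_inj e); exact: chain1.
  rewrite tsize_tcat /= => sz; have e : tsize t1 = 0%N by lia.
  have {}e := tsize0 e; have /= ? := congr1 tag e; subst W; rewrite (existT_inj e); exact: chain0.
move=> X Z t w b p l t0 ct IH mb mpl lb mgu W t1 t2 /esym /tone_prefix [e|[t2' tE]].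
  have /= ? := congr1 tag e; subst W; rewrite (existT_inj e); exact: chainS ct mb mpl lb mgu.
exact: IH (esym tE).
Qed.

Lemma chain_last X Y Z (t : tup L Z [:: Y]) (w : lhom L X Z) : (0 < tsize t)%N ->
  chain (tcat t (tone w)) ->
  exists o o', [/\ maxP t o, maxP (tcat t (tone w)) o' & omax_lt lt o o'].
Proof.
move=> t0; move e : (tcat t (tone w)) => u cu; case: cu w e => {X u}.
- by move=> w /(congr1 (@tsize _ _ _ _)); rewrite tsize_tcat /=; lia.
- by move=> X w' _ w /(congr1 (@tsize _ _ _ _)); rewrite tsize_tcat /=; lia.
move=> X Z' t' w' b p l t'0 ct' mb mpl lb _ w e; rewrite -e in mpl *.
exists b, (Some (p, l)); split=> //.
have sz : tsize t = tsize t'.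
  by have := congr1 (@tsize _ _ _ _) e; rewrite !tsize_tcat /=; lia.
have h := tcat_inj e sz; have /= ? := congr1 tag h; subst Z'.
by have [-> _] := existT_inj h.
Qed.

Lemma chain_max X Y (t : tup L X [:: Y]) : (0 < tsize t)%N -> chain t -> exists o, maxP t o.
Proof.
move=> + ct; case: ct => {X t} [//|X w _ _|X Z t w b p l _ _ _ mpl _ _ _].
  by exists None; rewrite juxt_tone; exact: is_max_nf.
by exists (Some (p, l)).
Qed.

Lemma prefix_chainE X Y W (t1 : tup L W [:: Y]) (t2 : tup L X W) :
  prefix_chain lt cF strict (UTup (tcat t1 t2)) (tsize t1) <-> chain t1.
Proof.
split=> [[Z [s1 [s2 [/= e sz cs]]]]|ct]; last by exists W, t1, t2.
have h := tcat_inj e (esym sz); have /= ? := congr1 tag h; subst Z.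
by have [-> _] := existT_inj h.
Qed.

Lemma ell_uniq u k k' : ell u k -> ell u k' -> k = k'.
Proof.
move=> [k0 pk mk] [k'0 pk' mk']; apply/eqP; case: ltngtP => // kk'.
  by case: (mk k') => //; lia.
by case: (mk' k) => //; lia.
Qed.

(* nf_mor w' is the universal q satisfying this condition, which depends on t1 and w
   only: hence a cell is the target of at most one matching edge. *)
Definition target_spec Y W Z (t1 : tup L W [:: Y]) (w : lhom L Z W) V (q : lhom F V W) : Prop :=
  if tsize t1 == 0%N then exists f us vs, raw q = [:: App f us] /\ raw (nf_mor w) = [:: App f vs]
  else exists p l m, [/\ maxP (tcat t1 (tone w)) (Some (p, l)),
    subterm p (the_term (juxt t1)) = Some m & unifies m l q].

(** Common form of the two kinds of matching edges, with [t1] empty for the first kind. Here [o] is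
    the maximum after the entry that is split, and [m_max'] says that its head [w'] already attains
    it. *)
Record matched X Y Z Z' W (t1 : tup L W [:: Y]) (w : lhom L Z W) (w' : lhom L Z' W)
    (w'' : lhom L Z Z') (t2 : tup L X Z) (o : option (rpos Sg)) : Prop := Matched {
  m_ell : ell (UTup (tcat t1 (tcons w t2))) (tsize t1).+1;
  m_nf : nf_mor w = nf_mor w' \oL nf_mor w'';
  m_chain : chain (tcat t1 (tone w'));
  m_max : maxP (tcat t1 (tone w)) o;
  m_max' : maxP (tcat t1 (tone w')) o;
  m_new : (0 < tsize t1)%N -> exists2 b, o = Some b & ~ in_P R (the_term (juxt t1)) b;
  m_spec : target_spec t1 w (nf_mor w');
  m_univ : forall V (q : lhom F V W), target_spec t1 w q -> exists u, q = nf_mor w' \oL u }.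

Lemma tcat_cells X X' (s : tup L X X') W Z (t1 : tup L W X') (w : lhom L Z W) (t2 : tup L X Z) :
  tall cell_entry s -> s = tcat t1 (tcons w t2) ->
  [/\ tall cell_entry t1, cell_entry w & tall cell_entry t2].
Proof. by move=> + e; rewrite e => /tall_tcat [? []]. Qed.

(** In the case of a unifier, (p, l) belongs to P after [w'], and P can only grow when [w''] is
    composed; so (p, l) is the maximum after [w'] as well as after [w]. Being new, it exceeds the
    maximum after [t1], and [w'] extends the chain. *)
Lemma matchingP (g a : cell c) : matching lt cF strict c g a ->
  exists X Y Z Z' W (t1 : tup L W [:: Y]) (w : lhom L Z W) (w' : lhom L Z' W) (w'' : lhom L Z Z')
    (t2 : tup L X Z) o, [/\ sval g = UTup (tcat t1 (tcons w' (tcons w'' t2))),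
    sval a = UTup (tcat t1 (tcons w t2)) & matched t1 w w' w'' t2 o].
Proof.
case: g a => [g cg] [a ca]; rewrite /matching /= => ga; case: ga cg ca.
  move=> X Y Z Z' w w' w'' t2 el wE sw' cg ca.
  exists X, Y, Z, Z', [:: Y], tnil, w, w', w'', t2, None; split=> //.
  have [ew' _] : cell_entry w' := cg.1.
  have [f [us [w'f univ]]] := in_signature_universal trsR termR crR ew' sw'.
  have [vs wf] : exists vs, the_term (nf_mor w) = App f vs.
    by rewrite wE the_term_comp w'f; eexists; reflexivity.
  split=> //.
  - exact: chain1.
  - by rewrite juxt_tone; exact: is_max_nf.
  - by rewrite juxt_tone; exact: is_max_nf.
  - by exists f, us, vs; rewrite !raw_the_term wf w'f.
  move=> V q [f' [us' [vs' [qE w'E]]]]; move: w'E; rewrite raw_the_term wf => -[ff' _]; subst f'.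
  exact: (univ _ _ us' (the_term_raw qE)).
move=> X Y W Z Z' t1 w w' w'' t2 p l t10 el wE mpl mgu cg ca.
exists X, Y, Z, Z', W, t1, w, w', w'', t2, (Some (p, l)); split=> //.
have [m [sub mX [s ws sE] univ]] := mgu_at_universal mgu.
have [_ [ew' nw'] _] := tcat_cells cg erefl.
have Tw : the_term (juxt (tcat t1 (tone w))) = the_term (juxt (tcat t1 (tone w')) \oL nf_mor w'').
  by rewrite !juxt_tcat !juxt_tone wE lcompA.
have [[lhsl _] _] := mpl.
have Ppl : in_P R (the_term (juxt (tcat t1 (tone w')))) (p, l).
  split=> //; exists s; split=> //; rewrite juxt_tcat juxt_tone the_term_comp.
  by rewrite (subterm_subst _ sub) sE.
have mpl' : maxP (tcat t1 (tone w')) (Some (p, l)).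
  apply: is_max_sub mpl _ => [b|b [<-//]].
  by rewrite Tw; exact: in_P_comp.
(* If l already matched at p, the identity would be a unifier and factor through [w'], so that [w']
   would be an identity. *)
have new : ~ in_P R (the_term (juxt t1)) (p, l).
  move=> [_ [s0 [ws0 /=]]]; rewrite sub => -[mE]; apply: nw'.
  have [|u] := univ _ (lid W); last first.
    by move=> /esym e; exact: (section_identity trsR termR crR ew' e).
  exists s0 => //; rewrite raw_lid -mE; apply/esym; apply: subst_id => U i /mX iU.
  by rewrite (@onth_nth _ _ _ _ _ (onth_ctx_vars Sg iU)).
have ct1 : chain t1.
  have [_ pc _] := el; exact/(prefix_chainE t1 (tcons w t2)).
have [o mo] := chain_max t10 ct1.
have os : omax_lt lt o (Some (p, l)).
  case: o mo => [b|//] [Pb _] /=.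
  have [|bpl|//] := mpl'.2 b; first by rewrite juxt_tcat juxt_tone; exact: in_P_comp.
  by case: new; rewrite -bpl.
split=> //.
- exact: chainS t10 ct1 mo mpl' os mgu.
- by move=> _; exists (p, l).
- rewrite /target_spec gtn_eqF //; exists p, l, m; split=> //; by exists s.
move=> V q; rewrite /target_spec gtn_eqF // => -[p' [l' [m' [mpl2 sub2 uq]]]].
have [? ?] : (p', l') = (p, l) by have := is_max_uniq hlt mpl2 mpl => -[-> ->].
by subst p' l'; apply: univ; move: sub2; rewrite sub => -[->].
Qed.

End Matching.

(** * Each cell lies on at most one matching edge *)

Section MatchingUniqueness.
Variables (S : Type) (Sg : signature S) (R : term Sg -> term Sg -> Prop).
Hypotheses (trsR : is_trs R) (termR : terminating R) (crR : church_rosser R).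
Variable lt : term Sg -> term Sg -> Prop.
Hypothesis hlt : lhs_order R lt.
Variables (cF : representatives (Syn (no_eq Sg))) (c : representatives (Syn R)).
Variable strict : bool.
Implicit Types (X : seq S) (Y : S).

Notation L := (Syn R).
Notation maxP t := (is_max R lt (the_term (juxt t))).
Notation ell := (@is_ell S Sg R lt cF strict).
Notation match_ := (matching lt cF strict c).

Lemma omax_lt_irr t o : is_max R lt t o -> ~ omax_lt lt o o.
Proof. by case: o => [b [[lb _] _]|_ []]; exact: (rpos_lt_irr hlt). Qed.

Lemma juxt_merge Y X Z Z' W (t1 : tup L W [:: Y]) (w : lhom L Z W) (w' : lhom L Z' W)
    (w'' : lhom L Z Z') (t2 : tup L X Z) : nf_mor w = nf_mor w' \oL nf_mor w'' ->
  juxt (tcat t1 (tcons w' (tcons w'' t2))) = juxt (tcat t1 (tcons w t2)).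
Proof. by move=> wE; rewrite !juxt_tcat !juxt_cons wE !lcompA. Qed.

Section Matched.
Variables (X : seq S) (Y : S) (Z Z' W : seq S) (t1 : tup L W [:: Y]) (w : lhom L Z W)
  (w' : lhom L Z' W) (w'' : lhom L Z Z') (t2 : tup L X Z) (o : option (rpos Sg)).
Hypothesis m : matched lt cF strict t1 w w' w'' t2 o.

(** The chain [t1] extends by [w'] but not by [w'']: after [w''] the maximum is the one after [w],
    already attained after [w']. *)
Lemma matched_ell :
  ell (UTup (tcat t1 (tcons w' (tcons w'' t2)))) (tsize t1).+2.
Proof.
split.
- by rewrite /usize /= tsize_tcat /=; lia.
- exists Z', (tcat t1 (tone w')), (tcons w'' t2); split=> /=.
  + by rewrite -tcatA.
  + by rewrite tsize_tcat /= addn1.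
  + exact: m_chain m.
move=> k' /andP[kk' _] [V [s1 [s2 [/= e sz cs]]]].
have E : tcat t1 (tcons w' (tcons w'' t2)) = tcat (tcat (tcat t1 (tone w')) (tone w'')) t2.
  by rewrite -!tcatA.
have [|r [s1E _]] := tcat_prefix (etrans (esym E) e).
  by rewrite !tsize_tcat /= sz; lia.
rewrite s1E in cs; have cs' := chain_prefix cs.
have [|o1 [o2 [mo1 mo2 o12]]] := chain_last _ cs'; first by rewrite tsize_tcat /=; lia.
have o1E : o1 = o by exact: (is_max_uniq hlt mo1 (m_max' m)).
have : maxP (tcat t1 (tone w)) o2.
  by rewrite /tone -(juxt_merge _ _ (m_nf m)) /tone in mo2 *; rewrite -tcatA in mo2.
move=> /(is_max_uniq hlt (m_max m)) o2E; apply: (omax_lt_irr (m_max m)).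
by subst o1 o2.
Qed.

End Matched.

Lemma match_source_ell g a k : match_ g a -> ell (sval a) k -> ell (sval g) k.+1.
Proof.
move=> /(matchingP trsR termR crR hlt) [X [Y [Z [Z' [W [t1 [w [w' [w'' [t2 [o [-> -> m]]]]]]]]]]]].
by move=> /(ell_uniq (m_ell m)) <-; exact: matched_ell m.
Qed.

Lemma match_target_ell g a : match_ g a -> exists k, ell (sval a) k.
Proof.
move=> /(matchingP trsR termR crR hlt) [X [Y [Z [Z' [W [t1 [w [w' [w'' [t2 [o [_ -> m]]]]]]]]]]]].
by exists (tsize t1).+1; exact: m_ell m.
Qed.

Lemma cell_eq (a b : cell c) : sval a = sval b -> a = b.
Proof.
by case: a b => [a ca] [b cb] /= e; subst b; rewrite (Prop_irrelevance ca cb).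
Qed.

(** The value of [ell] at the source locates the split, and the entry of the target there is
    recovered from the normal forms of the two halves. *)
Lemma match_source_uniq g a a' : match_ g a -> match_ g a' -> a = a'.
Proof.
move=> ga ga'; have [k ek] := match_target_ell ga; have [k' ek'] := match_target_ell ga'.
have kk' : k = k' by have := ell_uniq (match_source_ell ga ek) (match_source_ell ga' ek') => -[].
move: ga ga' => /(matchingP trsR termR crR hlt)
  [X [Y [Z [Z' [W [t1 [w [w' [w'' [t2 [o [gE aE m]]]]]]]]]]]].
move=> /(matchingP trsR termR crR hlt)
  [X2 [Y2 [Z2 [Z2' [W2 [u1 [v [v' [v'' [u2 [o2 [gE2 aE2 m2]]]]]]]]]]]].
apply: cell_eq; rewrite aE aE2.
have sz : tsize t1 = tsize u1.
  rewrite aE in ek; rewrite aE2 in ek'.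
  by have := ell_uniq (m_ell m) ek; have := ell_uniq (m_ell m2) ek'; lia.
rewrite gE in gE2; have /= ? := congr1 (@udom _ _) gE2; have /= ? := congr1 (@ucod _ _) gE2.
subst X2 Y2; have h := matched_eq (UTup_inj gE2) sz.
have /= ? := congr1 tag h; subst W2; have {}h := existT_inj h; have /= ? := congr1 tag h; subst Z2'.
have /= ? := congr1 fst (existT_inj h); have /= ? := congr1 (fst \o snd) (existT_inj h).
have /= /tcons_inj h' := congr1 (snd \o snd) (existT_inj h); subst u1 v'.
have /= ? := congr1 tag h'; subst Z2.
have [? ?] := existT_inj h'; subst v'' u2.
suff -> : w = v by [].
by apply: (nf_mor_inj trsR termR); rewrite (m_nf m) (m_nf m2).
Qed.

(** As a target, [g] would be split at [w''], and the maximum after [w''] would be new. As a source,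
    it has that maximum already after [w']. *)
Lemma match_disjoint g a h : match_ g a -> ~ match_ h g.
Proof.
move=> ga hg; have [k ek] := match_target_ell ga; have ek1 := match_source_ell ga ek.
move: ga hg => /(matchingP trsR termR crR hlt)
  [X [Y [Z [Z' [W [t1 [w [w' [w'' [t2 [o [gE aE m]]]]]]]]]]]].
move=> /(matchingP trsR termR crR hlt)
  [X2 [Y2 [Z2 [Z2' [W2 [u1 [v [v' [v'' [u2 [o2 [hE gE2 m2]]]]]]]]]]]].
have sz : tsize u1 = tsize (tcat t1 (tone w')).
  rewrite aE in ek; rewrite gE2 in ek1; rewrite tsize_tcat /=.
  by have := ell_uniq (m_ell m) ek; have := ell_uniq (m_ell m2) ek1; lia.
rewrite gE in gE2; have /= ? := congr1 (@udom _ _) gE2; have /= ? := congr1 (@ucod _ _) gE2.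
subst X2 Y2; have := UTup_inj gE2.
have -> : tcat t1 (tcons w' (tcons w'' t2)) = tcat (tcat t1 (tone w')) (tcons w'' t2).
  by rewrite -tcatA.
move=> /matched_eq /(_ (esym sz)) e; have /= ? := congr1 tag e; subst W2.
have {}e := existT_inj e; have /= ? := congr1 tag e; subst Z2.
have [? ? ?] := existT_inj e; subst u1 v u2.
have [|b oE nb] := m_new m2; first by rewrite tsize_tcat /=; lia.
have oo2 : o = o2.
  apply: (is_max_uniq hlt (m_max m)); have := m_max m2.
  by rewrite -tcatA /tone (juxt_merge _ _ (m_nf m)).
by apply: nb; have := m_max' m; rewrite oo2 oE => -[].
Qed.

(** Both heads are essential and universal for the same condition, hence equal; the second halves
    then agree by cancellation. *)
Lemma match_target_uniq g g' a : match_ g a -> match_ g' a -> g = g'.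
Proof.
move=> ga ga'; have cg := svalP g; have cg' := svalP g'; move: ga ga'.
move=> /(matchingP trsR termR crR hlt)
  [X [Y [Z [Z' [W [t1 [w [w' [w'' [t2 [o [gE aE m]]]]]]]]]]]].
move=> /(matchingP trsR termR crR hlt)
  [X2 [Y2 [Z2 [Z2' [W2 [u1 [v [v' [v'' [u2 [o2 [gE2 aE2 m2]]]]]]]]]]]].
apply: cell_eq; rewrite gE gE2; rewrite gE in cg; rewrite gE2 in cg'.
have /= ? := congr1 (@udom _ _) (etrans (esym aE) aE2); subst X2.
have /= ? := congr1 (@ucod _ _) (etrans (esym aE) aE2); subst Y2.
rewrite aE in aE2.
have sz : tsize t1 = tsize u1.
  have em2 := m_ell m2; rewrite -aE2 in em2.
  by have := ell_uniq (m_ell m) em2; lia.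
have h := matched_eq (UTup_inj aE2) sz.
have /= ? := congr1 tag h; subst W2; have {}h := existT_inj h; have /= ? := congr1 tag h; subst Z2.
have [? ? ?] := existT_inj h; subst u1 v u2.
have [_ [ew' _] _] := tcat_cells cg erefl; have [_ [ev' _] _] := tcat_cells cg' erefl.
have [u uE] := m_univ m2 (m_spec m); have [u' uE'] := m_univ m (m_spec m2).
have e := universal_uniq trsR termR crR ew' ev' uE uE'.
have /= ? := congr1 tag e; subst Z2'; have ? := existT_inj e; subst v'.
suff -> : w'' = v'' by [].
apply: (nf_mor_inj trsR termR); apply: (comp_mono (essential_covers trsR termR crR ew')).
by rewrite -(m_nf m) -(m_nf m2).
Qed.

Lemma matching_at_most_one_edge : at_most_one_edge match_.
Proof.
move=> v a b a' b' ab a'b' [->|->] [e|e]; subst.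
- by split=> //; exact: match_source_uniq ab a'b'.
- by case: (match_disjoint ab a'b').
- by case: (match_disjoint a'b' ab).
- by split=> //; exact: match_target_uniq ab a'b'.
Qed.

End MatchingUniqueness.

(** * Incidence numbers as sums over the faces *)

Section Incidence.
Variables (S : Type) (L : lawvere S) (c : representatives L).

Lemma Phi_lin_sign x (b : Bu x) j : Phi_lin c (b *~ (-1) ^+ j) = Phi_lin c b *~ (-1) ^+ j.
Proof.
rewrite -signr_odd; case: (odd j); rewrite ?expr0 ?expr1 ?mulr1z // !mulrN1z.
by apply/eqP; rewrite -subr_eq0 opprK -Phi_linD addNr Phi_lin0.
Qed.

Lemma coef_sign x (h : Bbar c x) j b : (h *~ (-1) ^+ j) b = h b *~ (-1) ^+ j.
Proof. by rewrite -signr_odd; case: (odd j); rewrite ?expr0 ?expr1 ?mulr1z // !mulrN1z. Qed.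

Lemma Phi_lin_coefD x (h h' : Bu x) (b : cell c) :
  Phi_lin c (h + h') b = Phi_lin c h b + Phi_lin c h' b.
Proof. by rewrite Phi_linD dsum_addE. Qed.

Lemma Phi_lin_coef_sign x (h : Bu x) j (b : cell c) :
  Phi_lin c (h *~ (-1) ^+ j) b = Phi_lin c h b *~ (-1) ^+ j.
Proof. by rewrite Phi_lin_sign coef_sign. Qed.

Lemma deltaU_coef (u : utup L) (b : cell c) : (1 < usize u)%N ->
  Phi_lin c (deltaU u) b = Phi_lin c (d_first u) b
    + \sum_(1 <= j < usize u) Phi_lin c (d_mid j u) b *~ (-1) ^+ j
    + Phi_lin c (d_last u) b *~ (-1) ^+ (usize u).
Proof.
move=> u1; have -> : deltaU u = d_first u + \sum_(1 <= j < usize u) d_mid j u *~ (-1) ^+ j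
    + d_last u *~ (-1) ^+ (usize u).
  by rewrite /deltaU; case: (usize u) u1 => [|[|n]].
rewrite [LHS]Phi_lin_coefD.
rewrite [X in X + _ = _]Phi_lin_coefD.
rewrite [X in _ + X = _]Phi_lin_coef_sign.
congr (_ + _ + _).
rewrite [LHS]Phi_lin_sum_coef.
by apply: eq_bigr => j _; exact: Phi_lin_coef_sign.
Qed.

Lemma incidence_faces (g b : cell c) : (1 < usize (sval g))%N -> incidence g b <> 0 ->
  [\/ Phi_lin c (d_first (sval g)) b <> 0,
      exists2 j, (0 < j < usize (sval g))%N & Phi_lin c (d_mid j (sval g)) b <> 0 |
      Phi_lin c (d_last (sval g)) b <> 0].
Proof.
rewrite /incidence /delta => g1; rewrite deltaU_coef // => ne.
have [f0|] := pselect (Phi_lin c (d_first (sval g)) b = 0); last by constructor 1.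
have [l0|] := pselect (Phi_lin c (d_last (sval g)) b = 0); last by constructor 3.
constructor 2; apply: contrapT => h; apply: ne.
rewrite f0 l0 mul0rz add0r addr0 big_nat; apply: big1 => j jg.
have -> : Phi_lin c (d_mid j (sval g)) b = 0; last by rewrite mul0rz.
by apply: contrapT => ne; apply: h; exists j.
Qed.

(** The composed string is already a cell, so [Phi] is the identity on it. The equation [e] is
    needed because the two placements agree only up to associativity. *)
Lemma d_mid_unit j (u : utup L) (a : cell c) : sval a = UTup (tmerge j.-1 (uval u)) ->
  exists e : cplace a = place u, Phi_lin c (d_mid j u) a = uone_eq e.
Proof.
case: a => v cv /= vE; subst v.
have e : cplace (exist _ _ cv : cell c) = place u.
  by rewrite /cplace /place /= tmerge_comp.
exists e; rewrite Phi_lin_gen (Phi_cell cv) fact_mod_gen ucomp_uone [fgen _ _]dinjE.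
exact: upull_id.
Qed.

Lemma incidence_unit (g a : cell c) j : (0 < j < usize (sval g))%N ->
  sval a = UTup (tmerge j.-1 (uval (sval g))) ->
  Phi_lin c (d_first (sval g)) a = 0 -> Phi_lin c (d_last (sval g)) a = 0 ->
  (forall k, (0 < k < usize (sval g))%N -> k <> j -> Phi_lin c (d_mid k (sval g)) a = 0) ->
  exists e : cplace a = cplace g, incidence g a = uone_eq e \/ incidence g a = - uone_eq e.
Proof.
move=> jg aE f0 l0 m0; have [e eE] := d_mid_unit aE; exists e.
rewrite /incidence /delta deltaU_coef; last by lia.
rewrite f0 l0 mul0rz add0r addr0 (bigD1_seq j) /=; first last.
- exact: iota_uniq.
- by rewrite mem_index_iota.
rewrite eE big_nat_cond big1 => [|k /andP[kg /eqP kj]]; last by rewrite m0 // mul0rz.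
rewrite addr0 -signr_odd; case: (odd j); rewrite ?expr0 ?expr1 ?mulr1z ?mulrN1z; by [right | left].
Qed.

End Incidence.

(** * Edges of the graph and incidence along matching edges *)

Section Edges.
Variables (S : Type) (Sg : signature S) (R : term Sg -> term Sg -> Prop).
Hypotheses (trsR : is_trs R) (termR : terminating R) (crR : church_rosser R).
Variable lt : term Sg -> term Sg -> Prop.
Hypothesis hlt : lhs_order R lt.
Variables (cF : representatives (Syn (no_eq Sg))) (c : representatives (Syn R)).
Variable strict : bool.
Implicit Types (X : seq S) (Y : S).

Notation F := (Syn (no_eq Sg)).
Notation L := (Syn R).
Notation cell_entry := (@cell_entry S Sg R c).
Notation ell := (@is_ell S Sg R lt cF strict).
Notation match_ := (matching lt cF strict c).

Lemma match_usize g a : match_ g a -> usize (sval g) = (usize (sval a)).+1 /\ (0 < usize (sval a))%N.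
Proof.
move=> /(matchingP trsR termR crR hlt) [X [Y [Z [Z' [W [t1 [w [w' [w'' [t2 [o [-> -> m]]]]]]]]]]]].
by rewrite /usize /= !tsize_tcat /=; lia.
Qed.

Lemma match_uterm g a : match_ g a -> uterm (sval g) = uterm (sval a) /\ udom (sval g) = udom (sval a).
Proof.
move=> /(matchingP trsR termR crR hlt) [X [Y [Z [Z' [W [t1 [w [w' [w'' [t2 [o [-> -> m]]]]]]]]]]]].
by rewrite /uterm /= (juxt_merge _ _ (m_nf m)).
Qed.

(* b can occur in Phi (d_j u), where the composite of the entries j and j + 1 of u, counted
   from 1, is irreducible. *)
Definition mid_face (u : utup L) (j : nat) (b : utup L) : Prop :=
  exists X Y Z V W (u1 : tup L W [:: Y]) (x : lhom L V W) (y : lhom L Z V) (u2 : tup L X Z),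
  [/\ u = UTup (tcat u1 (tcons x (tcons y u2))), nf_mor (x \oL y) = nf_mor x \oL nf_mor y,
      (tsize u1).+1 = j & pushed c (tcat u1 (tcons (x \oL y) u2)) b].

Lemma mid_face_uterm u j b : mid_face u j b ->
  exists X X' Y (f : lhom F X' [:: Y]) (p : lhom L X X'), [/\ udom u = X, udom b = X',
    uterm b = the_term f, uterm u = the_term (f \oL nf_mor p) & partial_perm p].
Proof.
move=> [X [Y [Z [V [W [u1 [x [y [u2 [-> nfE _ [X' [t' [p [-> pp _ ju _]]]]]]]]]]]]]].
exists X, X', Y, (juxt t'), p; split=> //.
by rewrite -ju /uterm /= (juxt_merge _ _ nfE).
Qed.

Lemma face_mid_cases (g b : cell c) j : (0 < j < usize (sval g))%N ->
  Phi_lin c (d_mid j (sval g)) b <> 0 ->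
  gtR R (uterm (sval g)) (uterm (sval b)) \/ mid_face (sval g) j (sval b).
Proof.
have cg : is_cell c (sval g) := svalP g.
case: (sval g) cg => X Y t ct jt ne.
have [Z [V [W [u1 [x [y [u2 [tE jE pu]]]]]]]] := face_mid trsR termR crR jt ne.
move: u1 u2 tE jE pu => /= u1 u2 tE jE pu; subst t.
have cu1 : tall cell_entry u1 by have [] := tcat_cells ct erefl.
have [nfE|gt] := merge_nf trsR termR crR x y u2 cu1.
  by right; exists X, Y, Z, V, W, u1, x, y, u2.
by left; exists (the_term (juxt (tcat u1 (tcons (x \oL y) u2)))) => //; exact: pushed_emb pu.
Qed.

Lemma face_cases (g b : cell c) : (1 < usize (sval g))%N -> incidence g b <> 0 ->
  [\/ gtR R (uterm (sval g)) (uterm (sval b)),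
      emb (uterm (sval g)) (uterm (sval b)) /\
        (tmsize (uterm (sval b)) < tmsize (uterm (sval g)))%N,
      [/\ emb (uterm (sval g)) (uterm (sval b)),
          tmsize (uterm (sval b)) = tmsize (uterm (sval g)) &
          (size (udom (sval g)) < size (udom (sval b)))%N] |
      exists2 j, Phi_lin c (d_mid j (sval g)) b <> 0 & mid_face (sval g) j (sval b)].
Proof.
move=> g1; have cg : is_cell c (sval g) := svalP g.
move=> /(incidence_faces g1) [ne|[j jg ne]|ne].
- by constructor 2; apply: face_first ne => //; exact: ltnW.
- have [gt|mf] := face_mid_cases jg ne; first by constructor 1.
  by constructor 4; exists j.
- have [|e [lt_sz|[eq_sz lt_dom]]] := face_last trsR termR crR cg _ ne.
  + exact: ltnW.
  + by constructor 2.
  + by constructor 3.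
Qed.

Lemma cell_merge X Y Z Z' W (t1 : tup L W [:: Y]) (w : lhom L Z W) (w' : lhom L Z' W)
    (w'' : lhom L Z Z') (t2 : tup L X Z) : nf_mor w = nf_mor w' \oL nf_mor w'' -> w' \oL w'' = w.
Proof.
move=> wE; apply: (nf_mor_inj trsR termR); rewrite wE; apply: nf_mor_comp => //.
by rewrite -wE => t; exact: raw_nf_irr.
Qed.

Lemma match_merge g a k : match_ g a -> ell (sval a) k ->
  sval a = UTup (tmerge k.-1 (uval (sval g))).
Proof.
move=> /(matchingP trsR termR crR hlt) [X [Y [Z [Z' [W [t1 [w [w' [w'' [t2 [o [-> -> m]]]]]]]]]]]].
move=> /(ell_uniq (m_ell m)) <-; rewrite [uval _]/= [_.-1]/= tmerge_tcat.
by rewrite (cell_merge t1 t2 (m_nf m)).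
Qed.

(** Composing at the matched position undoes the split. The result is the cell [a] itself, and [Phi]
    of a cell contains no other cell. *)
Lemma d_mid_at_ell g a k (b : cell c) : match_ g a -> ell (sval a) k ->
  Phi_lin c (d_mid k (sval g)) b <> 0 -> b = a.
Proof.
move=> ga ek ne; have := d_mid_coef ne; rewrite -(match_merge ga ek) => ne'.
by apply: cell_eq; apply: Phi_cell_coef ne'; exact: svalP.
Qed.

(* Comparing the first entries in which the two cells could differ. *)
Lemma mid_face_not_target g a j : match_ g a -> ~ ell (sval a) j -> ~ mid_face (sval g) j (sval a).
Proof.
move=> ga; have cg : is_cell c (sval g) := svalP g.
move: ga => /(matchingP trsR termR crR hlt)
  [X [Y [Z [Z' [W [t1 [w [w' [w'' [t2 [o [gE aE m]]]]]]]]]]]] nej.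
move=> [X2 [Y2 [Z2 [V2 [W2 [u1 [x [y [u2 [gE2 nfE jE [X' [t' [p [aE2 _ _ _ pref]]]]]]]]]]]]]].
rewrite gE in gE2 cg; rewrite aE in aE2.
have /= ? := congr1 (@udom _ _) gE2; have /= ? := congr1 (@ucod _ _) gE2; subst X2 Y2.
have /= ? := congr1 (@udom _ _) aE2; subst X'.
have gE' := UTup_inj gE2; have aE' := UTup_inj aE2.
have cg' : tall cell_entry (tcat u1 (tcons x (tcons y u2))) by rewrite -gE'.
have [cu1 [ex nx] [ey cu2]] := tcat_cells cg' erefl.
have [ct1 [ew' nw'] [[ew'' nw''] ct2]] := tcat_cells cg erefl.
have [V [e [t2' [q [t'E qq xyE]]]]] := pref _ _ _ _ _ erefl cu1.
case: (ltngtP (tsize u1) (tsize t1)) => sz; last first.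
- by apply: nej; rewrite -jE sz aE; exact: m_ell m.
(* The face composes to the right of [w'], so [a] keeps [w'] as its entry after [t1]. Then [w]
   equals [w'], and [w''] is an identity by cancellation. *)
- have gE3 : tcat (tcat t1 (tone w')) (tcons w'' t2) = tcat u1 (tcons x (tcons y u2)).
    by rewrite -gE' -tcatA.
  have [|r [u1E _]] := tcat_prefix gE3; first by rewrite tsize_tcat /= addn1.
  move: aE'; rewrite t'E u1E -!tcatA [tcat (tone w') _]/= => /matched_eq /(_ erefl) h.
  have {}h := existT_inj h; have /= ? := congr1 tag h; subst Z'.
  have [? _] := existT_inj h; subst w'.
  apply: nw''; have ww : w'' = lid Z.
    apply: (nf_mor_inj trsR termR); apply: (comp_mono (essential_covers trsR termR crR ew')).
    by rewrite -(m_nf m) nf_mor_lid // lcomp1r.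
  by rewrite ww.
(* The face composes to the left of the split, so [a] still has [x] where [e] should stand. Then [e]
   is [x], and cancelling [x] identifies [y] with the partial permutation [q]. *)
have gE3 : tcat (tcat u1 (tone x)) (tcons y u2) = tcat t1 (tcons w' (tcons w'' t2)).
  by rewrite gE' -tcatA.
have [|r [t1E _]] := tcat_prefix gE3; first by rewrite tsize_tcat /= addn1.
move: aE'; rewrite t'E t1E -!tcatA [tcat (tone x) _]/= => /matched_eq /(_ erefl) h.
have {}h := existT_inj h; have /= ? := congr1 tag h; subst V.
have [? _] := existT_inj h; subst e.
apply: (not_identity_pp ey); suff -> : y = q by [].
apply: (nf_mor_inj trsR termR); apply: (comp_mono (essential_covers trsR termR crR ex)).
by rewrite -nfE xyE nf_mor_comp_pp.
Qed.

Lemma cell_well_sorted (a : cell c) : well_sorted (uterm (sval a)).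
Proof. by exists (ucod (sval a)); have [] := the_term_typed (juxt (uval (sval a))). Qed.

Lemma matching_unit g a : match_ g a -> exists e : cplace a = cplace g,
  incidence g a = uone_eq e \/ incidence g a = - uone_eq e.
Proof.
move=> ga; have [gs as0] := match_usize ga; have [Tga dga] := match_uterm ga.
have [k ek] := match_target_ell trsR termR crR hlt ga; have [/andP[k0 kl] _ _] := ek.
have cg : is_cell c (sval g) := svalP g.
apply: (@incidence_unit _ _ _ _ _ k) (match_merge ga ek) _ _ _; first by lia.
- apply: contrapT => ne; have [|_] := face_first trsR termR crR cg _ ne; first by lia.
  by rewrite Tga ltnn.
- apply: contrapT => ne; have [|_ []] := face_last trsR termR crR cg _ ne; first by lia.
    by rewrite Tga ltnn.
  by rewrite dga ltnn => -[].
move=> j jg jk; apply: contrapT => ne.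
have ejk : ~ ell (sval a) j by move=> ej; apply: jk; exact: ell_uniq ej ek.
have [|/(mid_face_not_target ga ejk) //] := face_mid_cases jg ne.
by rewrite Tga => /gtR_irr; apply=> //; exact: cell_well_sorted.
Qed.

End Edges.

(** * Acyclicity *)

Section Keys.
Variables (S : Type) (Sg : signature S) (R : term Sg -> term Sg -> Prop).
Hypotheses (trsR : is_trs R) (termR : terminating R) (crR : church_rosser R).
Variable lt : term Sg -> term Sg -> Prop.
Hypothesis hlt : lhs_order R lt.
Variables (cF : representatives (Syn (no_eq Sg))) (c : representatives (Syn R)).
Variable strict : bool.
Implicit Types (X : seq S) (Y : S).

Notation L := (Syn R).
Notation cell_entry := (@cell_entry S Sg R c).
Notation chain := (@is_chain S Sg R lt cF strict _ _).
Notation maxP t := (is_max R lt (the_term (juxt t))).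
Notation ell := (@is_ell S Sg R lt cF strict).
Notation match_ := (matching lt cF strict c).

(* o = p(t_1 ... t_i) for u = (t_1, ..., t_n), None being -oo. *)
Definition key (u : utup L) (i : nat) (o : option (rpos Sg)) : Prop :=
  exists W (s1 : tup L W [:: ucod u]) (s2 : tup L (udom u) W),
    [/\ uval u = tcat s1 s2, tsize s1 = i & maxP s1 o].

Lemma keyE X Y W (s1 : tup L W [:: Y]) (s2 : tup L X W) o :
  key (UTup (tcat s1 s2)) (tsize s1) o <-> maxP s1 o.
Proof.
split=> [[V [r1 [r2 [/= e sz mo]]]]|mo]; last by exists W, s1, s2.
have h := tcat_inj e (esym sz); have /= ? := congr1 tag h; subst V.
by have [-> _] := existT_inj h.
Qed.

Lemma key_uniq u i o o' : key u i o -> key u i o' -> o = o'.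
Proof.
case: u => X Y t [W [s1 [s2 [/= -> <- mo]]]] /keyE mo'.
exact: (is_max_uniq hlt mo mo').
Qed.

Lemma key_in_P u i o b : key u i o -> o = Some b -> in_P R (uterm u) b.
Proof.
move=> [W [s1 [s2 [uE _ mo]]]] oE; rewrite oE in mo; have [Pb _] := mo.
by rewrite /uterm uE juxt_tcat; exact: in_P_comp.
Qed.

Lemma key_exists g a k i : match_ g a -> ell (sval a) k -> (0 < i <= k)%N ->
  exists o, key (sval g) i o.
Proof.
move=> /(matchingP trsR termR crR hlt) [X [Y [Z [Z' [W [t1 [w [w' [w'' [t2 [o [-> -> m]]]]]]]]]]]].
move=> /(ell_uniq (m_ell m)) <- /andP[i0 ik].
have [|V [s1 [s2 [tE sz]]]] := @tup_split _ _ _ _ (tcat t1 (tone w')) i.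
  by rewrite tsize_tcat /=; lia.
have ct := m_chain m; rewrite tE in ct.
have [|o' mo'] := chain_max trsR termR _ (chain_prefix ct); first by rewrite sz.
have -> : tcat t1 (tcons w' (tcons w'' t2)) = tcat s1 (tcat s2 (tcons w'' t2)).
  by rewrite tcatA -tE -tcatA.
by exists o'; rewrite -sz; apply/keyE.
Qed.

Lemma ell_bound k u X Y W (t1 : tup L W [:: Y]) (t2 : tup L X W) : ell u k ->
  u = UTup (tcat t1 t2) -> chain t1 -> (0 < tsize t2)%N -> (tsize t1 < k)%N.
Proof.
move=> [_ _ mk] uE ct t20; rewrite ltnNge; apply/negP => kt.
case: (mk (tsize t1).+1); first by rewrite uE /usize /= tsize_tcat; lia.
by rewrite uE; apply/prefix_chainE.
Qed.

(** A face changes nothing before the two entries it composes, and the split leading from b to g'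
    preserves the maximum at its place. If the face lies inside the chain, the composed entry
    inherits the larger maximum of its right half. *)
Lemma key_step g a b g' k k' j : match_ g a -> ell (sval a) k -> mid_face c (sval g) j (sval b) ->
  j <> k -> match_ g' b -> ell (sval b) k' ->
  [/\ (minn k.+1 j <= k')%N,
      forall i o, (i <= k)%N -> (i < j)%N -> key (sval g) i o -> key (sval g') i o &
      (j < k)%N -> forall o, key (sval g) j o ->
        exists2 o', key (sval g') j o' & omax_lt lt o o'].
Proof.
move=> ga ek mf jk; have cg : is_cell c (sval g) := svalP g; move: ga ek mf.
move=> /(matchingP trsR termR crR hlt)
  [X [Y [Z [Z' [W [t1 [w [w' [w'' [t2 [o [gE -> m]]]]]]]]]]]].
move=> /(ell_uniq (m_ell m)) kE; subst k.
move=> [X2 [Y2 [Z2 [V2 [W2 [u1 [x [y [u2 [gE2 nfE jE [Xb [tb [p [bE _ _ _ pref]]]]]]]]]]]]]].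
move=> /(matchingP trsR termR crR hlt)
  [X3 [Y3 [Z3 [Z3' [W3 [v1 [z [z' [z'' [v2 [o3 [g'E bE' m']]]]]]]]]]]].
rewrite bE' => /(ell_uniq (m_ell m')) k'E; subst k' j.
rewrite gE in gE2 cg *; rewrite bE' in bE; rewrite g'E.
have /= ? := congr1 (@udom _ _) gE2; have /= ? := congr1 (@ucod _ _) gE2; subst X2 Y2.
have /= ? := congr1 (@udom _ _) bE; have /= ? := congr1 (@ucod _ _) bE; subst Xb Y3.
have gE' := UTup_inj gE2; have {}bE := UTup_inj bE.
have cg' : tall cell_entry (tcat u1 (tcons x (tcons y u2))) by rewrite -gE'.
have [cu1 _ _] := tcat_cells cg' erefl.
have [V [e [tb' [q [tbE qq xyE]]]]] := pref _ _ _ _ _ erefl cu1; rewrite tbE in bE.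
have szt : tsize (tcat t1 (tone w')) = (tsize t1).+1 by rewrite tsize_tcat /= addn1.
have gE3 : tcat (tcat t1 (tone w')) (tcons w'' t2) = tcat u1 (tcons x (tcons y u2)).
  by rewrite -gE' -tcatA.
(* The chain ending in [w'] survives in b if it ends before the composed entry; otherwise its prefix
   [u1] of length j - 1 survives. The value of [ell] at b exceeds the length of either. *)
have bnd : (minn (tsize t1).+2 (tsize u1).+1 <= (tsize v1).+1)%N.
  have em' := m_ell m'; rewrite bE in em'.
  case: (leqP (tsize t1).+1 (tsize u1)) => le.
    have [|r [u1E _]] := tcat_prefix gE3; first by rewrite szt.
    have := ell_bound em' (t1 := tcat t1 (tone w')) (t2 := tcat r (tcons e tb')).
    rewrite szt u1E -!tcatA => /(_ erefl (m_chain m)).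
    by rewrite tsize_tcat /=; lia.
  have [|r [t1E _]] := tcat_prefix (esym gE3); first by rewrite szt; lia.
  have cu := m_chain m; rewrite t1E in cu.
  have := ell_bound em' erefl (chain_prefix cu) (ltn0Sn _); lia.
split=> //.
- move=> i o1 ik ij [V1 [s1 [s2 [s12 sz mo1]]]]; move: s1 s2 s12 sz mo1 => /= s1 s2 s12 sz mo1.
  have [|r [u1E _]] := tcat_prefix (etrans (esym s12) gE'); first by lia.
  have bE2 : tcat s1 (tcat r (tcons e tb')) = tcat v1 (tcons z v2) by rewrite tcatA -u1E bE.
  have [|r' [v1E _]] := tcat_prefix bE2;  first by lia.
  by rewrite v1E -tcatA -sz; apply/keyE.
move=> jk' o1; have -> : tcat t1 (tcons w' (tcons w'' t2)) = tcat (tcat u1 (tone x)) (tcons y u2).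
  by rewrite gE' -tcatA.
have szu : tsize (tcat u1 (tone x)) = (tsize u1).+1 by rewrite tsize_tcat /= addn1.
rewrite -szu => /keyE mo1.
have gE4 : tcat (tcat (tcat u1 (tone x)) (tone y)) u2 = tcat (tcat t1 (tone w')) (tcons w'' t2).
  by rewrite gE3 -!tcatA.
have [|r [t1E _]] := tcat_prefix gE4; first by rewrite szt tsize_tcat szu /=; lia.
have cxy := m_chain m; rewrite t1E in cxy.
have [|o1' [o2 [mo1' mo2 o12]]] := chain_last _ (chain_prefix cxy); first by rewrite szu.
have ? := is_max_uniq hlt mo1 mo1'; subst o1'.
exists o2 => //.
(* Up to the partial permutation [q], the first j entries of b compose to the first j + 1 entries of
   g, where the chain has a larger maximum. *)
have {}mo2 : maxP (tcat u1 (tone e)) o2.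
  apply/(is_max_comp_pp trsR termR crR _ _ _ qq).
  move: mo2; rewrite !juxt_tcat !juxt_tone -!lcompA -nfE xyE nf_mor_comp_pp // !lcompA.
have sze : tsize (tcat u1 (tone e)) = (tsize u1).+1 by rewrite tsize_tcat /= addn1.
(* Either [e] is the entry that is split in g', and its head has the same maximum by [m_max'], or
   the split lies further to the right. *)
rewrite szu -sze; have [le|gt] := leqP (tsize v1) (tsize u1).
  have sz : tsize v1 = tsize u1 by lia.
  have h := matched_eq bE sz; have /= ? := congr1 tag h; subst W3.
  have {}h := existT_inj h; have /= ? := congr1 tag h; subst Z3.
  have [? ? _] := existT_inj h; subst v1 z.
  have ? := is_max_uniq hlt mo2 (m_max m'); subst o3.
  have -> : tsize (tcat u1 (tone e)) = tsize (tcat u1 (tone z')) by rewrite !tsize_tcat.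
  have -> : tcat u1 (tcons z' (tcons z'' v2)) = tcat (tcat u1 (tone z')) (tcons z'' v2).
    by rewrite -tcatA.
  by apply/keyE; exact: m_max' m'.
have bE2 : tcat (tcat u1 (tone e)) tb' = tcat v1 (tcons z v2) by rewrite bE -tcatA.
have [|r' [v1E _]] := tcat_prefix bE2; first by rewrite sze.
by rewrite v1E -tcatA; apply/keyE.
Qed.

End Keys.

(** * Infinite paths *)

Section Acyclicity.
Variables (S : Type) (Sg : signature S) (R : term Sg -> term Sg -> Prop).
Hypotheses (trsR : is_trs R) (termR : terminating R) (crR : church_rosser R).
Variable lt : term Sg -> term Sg -> Prop.
Hypothesis hlt : lhs_order R lt.
Variables (cF : representatives (Syn (no_eq Sg))) (c : representatives (Syn R)).
Variable strict : bool.
Implicit Types (X : seq S) (Y : S).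

Notation L := (Syn R).
Notation ell := (@is_ell S Sg R lt cF strict).
Notation match_ := (matching lt cF strict c).

Notation key := (key lt).

Lemma count_lt (T : eqType) (a1 a2 : pred T) x l : subpred a2 a1 -> x \in l -> a1 x -> ~~ a2 x ->
  (count a2 l < count a1 l)%N.
Proof.
move=> sub + a1x /negbTE a2x; elim: l => [//|y l IH] /=; rewrite inE => /orP[/eqP <-|/IH h].
  by rewrite a1x a2x add0n add1n ltnS; exact: sub_count.
by have := sub y; case: (a2 y) => [/(_ isT) ->|_]; lia.
Qed.

(** There are finitely many positions in [t], so along an increasing sequence the position is
    eventually constant; from then on the left-hand sides would increase forever. *)
Lemma Acc_omax t o : Acc (fun o' o => [/\ omax_lt lt o o',
  forall b, o = Some b -> in_P R t b & forall b, o' = Some b -> in_P R t b]) o.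
Proof.
apply: (@no_seq_Acc _ (fun o o' => [/\ omax_lt lt o o',
  forall b, o = Some b -> in_P R t b & forall b, o' = Some b -> in_P R t b]) (fun=> True)) => //.
move=> [u [_ uP]].
(* None is never the larger side of [omax_lt], so it can occur only at index 0; hence the shift by
   one. *)
have /choice [b bE] i : exists b, u i.+1 = Some b.
  by have [] := uP i; case: (u i.+1) => [b|]; [exists b | case: (u i)].
have Pb i : in_P R t (b i) by have [_ _] := uP i; apply.
have ltb i : rpos_lt lt (b i) (b i.+1) by have [] := uP i.+1; rewrite !bE.
have [l lP] := finite_positions t.
have bl i : (b i).1 \in l by have [_ [s [_ /lP]]] := Pb i.
(* The number of listed positions above the current one; it drops whenever the position moves. *)
pose f i := count (fun q : seqlexi nat => ((b i).1 : seqlexi nat) < q)%O l.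
have le i : (f i.+1 <= f i)%N.
  apply: sub_count => q /=; case: (ltb i) => [h1|[-> _] //]; exact: lt_trans.
have [N _ fE] := @eventually_const f 0 (fun i _ => le i).
apply: (lo_noinc hlt); exists (fun i => (b (N + i)%N).2); split=> i; first by have [] := Pb (N + i)%N.
rewrite addnS; case: (ltb (N + i)%N) => [h|[]//].
suff : (f (N + i).+1 < f (N + i))%N by rewrite fE ?ltnn // leq_addr.
apply: (@count_lt _ _ _ (b (N + i).+1).1) => //; last by rewrite ltxx.
by move=> q /=; exact: lt_trans.
Qed.

(** Every variable in the context of g occurs in its composite, hence is one of the variables listed
    by the partial permutation. *)
Lemma mid_face_udom (g b : cell c) j : mid_face c (sval g) j (sval b) ->
  (size (udom (sval g)) <= size (udom (sval b)))%N.
Proof.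
move=> mf; have [X [X' [Y [f [p [gX bX bf gf pp]]]]]] := mid_face_uterm mf.
have cg i (Z : S) (iZ : onth (udom (sval g)) i = Some Z) :=
  uterm_covers trsR termR crR (svalP g : is_cell c (sval g)) iZ.
move: cg; rewrite gX bX gf {gX bX bf gf mf} => cg.
have [u [uE _]] := partial_perm_ppvars trsR termR crR pp.
rewrite -(size_mkseq u (size X')) -{1}(size_iota 0 (size X)).
apply: uniq_leq_size; first exact: iota_uniq.
move=> i; rewrite mem_iota /= add0n -onthTE; case iX: (onth X i) => [Z|//] _.
have := cg _ _ iX; rewrite the_term_comp => /tvars_subst [Z' [x [Z'x]]].
have [_ fX'] := the_term_typed f; have xZ' := fX' _ _ Z'x.
rewrite (@onth_nth _ _ _ _ _ (uE _ _ xZ')) /= => -[[_ ux]|//].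
by apply/mapP; exists x => //; rewrite mem_iota /= add0n -onthTE xZ'.
Qed.

Lemma mid_face_in_P (u b : utup L) j r : mid_face c u j b -> in_P R (uterm b) r -> in_P R (uterm u) r.
Proof.
move=> mf; have [X [X' [Y [f [p [_ _ -> -> _]]]]]] := mid_face_uterm mf; exact: in_P_comp.
Qed.

Section Sequence.
Variables al ga : nat -> cell c.
Hypothesis path : forall i,
  [/\ match_ (ga i) (al i), edge (ga i) (al i.+1) & ~ match_ (ga i) (al i.+1)].

Let T i := uterm (sval (al i)).
Let D i := size (udom (sval (al i))).

Lemma path_cases i :
  [\/ gtR R (T i) (T i.+1),
      emb (T i) (T i.+1) /\ (tmsize (T i.+1) < tmsize (T i))%N,
      [/\ emb (T i) (T i.+1), tmsize (T i.+1) = tmsize (T i) & (D i < D i.+1)%N] |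
      exists2 j, Phi_lin c (d_mid j (sval (ga i))) (al i.+1) <> 0 &
                 mid_face c (sval (ga i)) j (sval (al i.+1))].
Proof.
have [ma [_ inc] _] := path i; have [sz sz0] := match_usize trsR termR crR hlt ma.
have [Tga Dga] := match_uterm trsR termR crR hlt ma.
rewrite /T /D -Tga -Dga; apply: face_cases => //; by rewrite sz.
Qed.

Lemma mid_face_weak i j : mid_face c (sval (ga i)) j (sval (al i.+1)) ->
  [/\ emb (T i) (T i.+1), tmsize (T i.+1) = tmsize (T i) & (D i <= D i.+1)%N].
Proof.
have [ma _ _] := path i; have [Tga Dga] := match_uterm trsR termR crR hlt ma.
rewrite /T /D -Tga -Dga => mf; split; last exact: mid_face_udom mf.
  by have [X [X' [Y [f [p [_ _ -> -> _]]]]]] := mid_face_uterm mf; exact: emb_comp.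
have [X [Y [Z [V [W [u1 [x [y [u2 [-> nfE _ pu]]]]]]]]]] := mf.
by rewrite (pushed_size trsR termR crR pu) /uterm /= (juxt_merge _ _ nfE).
Qed.

(** Three quantities become stable one after the other: the term with respect to [gtR], its size,
    and its size minus the length of its context. Any other kind of face makes one of them drop. *)
Lemma eventually_mid : exists N, forall i, (N <= i)%N ->
  exists2 j, Phi_lin c (d_mid j (sval (ga i))) (al i.+1) <> 0 &
             mid_face c (sval (ga i)) j (sval (al i.+1)).
Proof.
have [N1 _ h1] : exists2 M, (0 <= M)%N & forall i, (M <= i)%N -> ~ gtR R (T i) (T i.+1).
  apply: (@eventually_stop _ (gtR R) (@emb _ Sg) T 0) => [x y z|| i _].
  - exact: emb_gtR.
  - by apply: (Acc_gtR termR); exact: cell_well_sorted.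
  - by have [|[]|[]|[j _ /mid_face_weak []]] := path_cases i; by [left | right].
have [N2 N12 h2] : exists2 M, (N1 <= M)%N & forall i, (M <= i)%N -> tmsize (T i.+1) = tmsize (T i).
  apply: (@eventually_const (fun i => tmsize (T i))) => i N1i.
  have [/(h1 _ N1i)//|[_ /ltnW]//|[_ -> _]//|[j _ /mid_face_weak [_ -> _]]//] := path_cases i.
(* Keeps the truncated difference below exact, so that a growing context really makes it drop. *)
have DT i : (D i <= tmsize (T i))%N.
  apply: covers_tmsize => k Z kZ; exists (T i); first by left.
  exact: (uterm_covers trsR termR crR (svalP (al i)) kZ).
have [N3 N23 h3] : exists2 M, (N2 <= M)%N & forall i, (M <= i)%N ->
    (tmsize (T i.+1) - D i.+1 = tmsize (T i) - D i)%N.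
  apply: (@eventually_const (fun i => (tmsize (T i) - D i)%N)) => i N2i; rewrite h2 //.
  apply: leq_sub2l; have N1i := leq_trans N12 N2i.
  have [/(h1 _ N1i)//|[_]|[_ _ /ltnW]//|[j _ /mid_face_weak [_ _]]//] := path_cases i.
  by rewrite h2 // ltnn.
exists N3 => i N3i; have N2i := leq_trans N23 N3i; have N1i := leq_trans N12 N2i.
have [/(h1 _ N1i)//|[_]|[_ _ lt_D]|//] := path_cases i; first by rewrite h2 // ltnn.
by have := h3 _ N3i; have := DT i.+1; rewrite h2 //; lia.
Qed.

Lemma path_absurd : False.
Proof.
have [N midN] := eventually_mid.
have /choice [k kP] i : exists k, ell (sval (al i)) k.
  by have [ma _ _] := path i; exact: match_target_ell ma.
(* The face at the matched position yields only [al i], so with [j i = k i] the edge would belong to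
   the matching. *)
have /choice [j jP] i : exists j, (N <= i)%N -> mid_face c (sval (ga i)) j (sval (al i.+1)) /\ j <> k i.
  have [Ni|_] := boolP (N <= i)%N; last by exists 0%N.
  have [j ne mf] := midN i Ni; exists j => _; split=> // jk; have [ma _ nma] := path i.
  apply: nma; rewrite jk in ne.
  by rewrite (d_mid_at_ell trsR termR crR hlt ma (kP i) ne).
have stepP i (Ni : (N <= i)%N) := key_step trsR termR crR hlt
  (let: And3 ma _ _ := path i in ma) (kP i) (jP i Ni).1 (jP i Ni).2
  (let: And3 ma _ _ := path i.+1 in ma) (kP i.+1).
have PN i r : (N <= i)%N -> in_P R (T i) r -> in_P R (T N) r.
  move=> Ni; rewrite -(subnKC Ni); elim: (i - N)%N => [|d IH]; first by rewrite addn0.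
  rewrite addnS => Pr; apply: IH; have [mf _] := jP (N + d)%N (leq_addr _ _).
  have [ma _ _] := path (N + d)%N; have [Tga _] := match_uterm trsR termR crR hlt ma.
  by rewrite /T -Tga; exact: mid_face_in_P mf Pr.
(* For the step from n to n + 1: a face with j = n has n < k and raises the maximum after n entries,
   while one with j > n keeps it. So eventually j > n, and the lower bound of [key_step] then forces
   k > n. *)
have main n : exists2 M, (N <= M)%N & forall i, (M <= i)%N -> (n <= k i)%N /\ (n <= j i)%N.
  elim: n => [|n [M NM IH]]; first by exists N.
  have /choice [o oP] i : exists o, (M <= i)%N -> (0 < n)%N -> key (sval (ga i)) n o.
    have [Mi|_] := boolP (M <= i)%N; last by exists None.
    have [n0|_] := boolP (0 < n)%N; last by exists None.
    have [ma _ _] := path i; have [nk _] := IH i Mi.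
    by have [|o oP] := key_exists trsR termR crR hlt ma (kP i) (i := n); [rewrite n0 | exists o].
  pose r o o' := [/\ omax_lt lt o o', forall b, o = Some b -> in_P R (T N) b &
    forall b, o' = Some b -> in_P R (T N) b].
  have okP i b : (M <= i)%N -> (0 < n)%N -> o i = Some b -> in_P R (T N) b.
    move=> Mi n0 oE; apply: (PN i); first exact: leq_trans Mi.
    have [ma _ _] := path i; have [Tga _] := match_uterm trsR termR crR hlt ma.
    by rewrite /T -Tga; exact: key_in_P (oP i Mi n0) oE.
  have jr i : (M <= i)%N -> (0 < n)%N -> j i = n -> r (o i) (o i.+1).
    move=> Mi n0 jE; have Mi1 := leqW Mi; have Ni := leq_trans NM Mi.
    have [nk _] := IH i Mi; have [_ nk'] := jP i Ni.
    have [_ _] := stepP i Ni; rewrite jE => /(_ _ _ (oP i Mi n0)) [|o' ko' oo'].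
      by rewrite ltn_neqAle nk andbT; apply/eqP => e; apply: nk'; rewrite jE.
    rewrite (key_uniq hlt ko' (oP _ Mi1 n0)) in oo'; split=> // b; exact: okP.
  have [M' MM' jn] : exists2 M', (M <= M')%N & forall i, (M' <= i)%N -> j i <> n.
    (* No maximum is followed for the empty prefix; here it suffices that the indices of inner faces
       start at 1. *)
    have [n0|n0] := posnP n.
      exists M => // i Mi; have [mf _] := jP i (leq_trans NM Mi).
      by have [X [Y [Z [V [W [u1 [x [y [u2 [_ _ <- _]]]]]]]]]] := mf; rewrite n0.
    have [] := @eventually_stop _ r eq o M.
    - by move=> x y z ->.
    - exact: Acc_omax.
    - move=> i Mi; have [|jn] := eqVneq (j i) n; first by left; exact: jr.
      right; have Mi1 := leqW Mi; have Ni := leq_trans NM Mi; have [nk nj] := IH i Mi.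
      have [_ keep _] := stepP i Ni; have ko := keep _ _ nk _ (oP i Mi n0).
      by apply: (key_uniq hlt (ko _) (oP _ Mi1 n0)); rewrite ltn_neqAle eq_sym jn.
    by move=> M' MM' stop; exists M' => // i M'i e; apply: (stop _ M'i); apply: jr => //; exact: leq_trans M'i.
  (* The bound on k at index i + 1 comes from the face at index i. *)
  exists M'.+1; first lia.
  have jn1 i : (M' <= i)%N -> (n < j i)%N.
    move=> M'i; have [_ nj] := IH i (leq_trans MM' M'i).
    by rewrite ltn_neqAle nj andbT; apply/eqP => /esym; exact: jn.
  move=> [//|i] M'i; split; last by apply: jn1; exact: ltnW.
  have [nk _] := IH i (leq_trans MM' M'i).
  have [bnd _ _] := stepP i (leq_trans NM (leq_trans MM' M'i)).
  by have := jn1 i M'i; lia.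
(* One more than the dimension of the matched targets, which is an upper bound for [ell] at all of
   them. *)
have [M NM h] := main (usize (sval (al 0%N))).+1.
have sz i : usize (sval (al i)) = usize (sval (al 0%N)).
  elim: i => [//|i <-]; have [ma [dim _] _] := path i.
  by have [sz _] := match_usize trsR termR crR hlt ma; move: dim; rewrite /cdim sz => -[].
have [kM _] := h M (leqnn M); have [/andP[_ kl] _ _] := kP M.
by move: (leq_trans kM kl); rewrite sz ltnn.
Qed.

End Sequence.

Lemma matching_morse : morse_matching match_.
Proof.
split.
- by move=> a b /(match_usize trsR termR crR hlt) [].
- move=> a b ab one; split; first by have [] := match_usize trsR termR crR hlt ab.
  have [e ie] := matching_unit trsR termR crR hlt ab.
  have ne : uone_eq e <> 0 by exact: uone_eq_neq0.
  by case: ie => -> // /eqP; rewrite oppr_eq0 => /eqP.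
- exact: matching_at_most_one_edge.
- exact: matching_unit.
- by move=> [al [ga path]]; exact: path_absurd path.
Qed.

End Acyclicity.

Theorem theorem5p20 (S : Type) (Sg : signature S)
    (R : term Sg -> term Sg -> Prop) (hR : is_trs R)
    (hcomplete : complete R) (hreduced : reduced R)
    (lt : term Sg -> term Sg -> Prop) (hlt : lhs_order R lt)
    (cF : representatives (Syn (no_eq Sg))) (cL : representatives (Syn R))
    (strict : bool) :
  morse_matching (matching lt cF strict cL).
Proof.
by have [termR crR] := hcomplete; exact: matching_morse.
Qed.
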